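(* If $n\ge d$, the left $\mathcal{MS}_{n,d}$-action and the right $\mathcal{MH}$-action on $\mathcal{MV}$ by convolution form a double centralizer, i.e. $$\operatorname{End}_{\mathcal{MS}_{n,d}}(\mathcal{MV})\cong\mathcal{MH},\qquad \operatorname{End}_{\mathcal{MH}}(\mathcal{MV})\cong\mathcal{MS}_{n,d}.$$
   Context: Let $v$ be an indeterminate, $\mathcal{A}=\mathbb{Z}[v,v^{-1}]$, and $n,d$ positive integers. For a prime power $q$ let $V=\mathbb{F}_q^d$ and $G=GL_d(\mathbb{F}_q)$. Let $\mathscr{X}$ be the set of $n$-step partial flags $(0=V_0\subseteq V_1\subseteq\cdots\subseteq V_n=V)$ (inclusions not necessarily strict) and $\mathscr{Y}$ the set of complete flags in $V$. $G$ acts diagonally on $\mathscr{X}\times\mathscr{X}\times V$, $\mathscr{Y}\times\mathscr{Y}\times V$ and $\mathscr{X}\times\mathscr{Y}\times V$; the set of orbits is finite and labelled independently of $q$ by decorated matrices: pairs $(A,\Delta)$ with $A=(a_{ij})$ a matrix over $\mathbb{N}=\{0,1,\ldots\}$ with entries summing to $d$ and $\Delta=\{(i_1,j_1),\dots,(i_k,j_k)\}$ a (possibly empty) set of positions with $i_1<\cdots<i_k$, $j_1>\cdots>j_k$, $a_{ij}>0$ for $(i,j)\in\Delta$. Here $A$ is $n\times n$ for $\mathscr{X}\times\mathscr{X}\times V$; $n\times d$ with all column sums $1$ for $\mathscr{X}\times\mathscr{Y}\times V$; a $d\times d$ permutation matrix for $\mathscr{Y}\times\mathscr{Y}\times V$.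 The orbit $\mathcal{O}_{A,\Delta}$ consists of the triples $((V_i),(V'_j),\omega)$ for which there is a basis $\{e^{s}_{ij}:1\le s\le a_{ij}\}$ of $V$ with $V_i=\mathrm{span}\{e^s_{i'j}:i'\le i\}$, $V'_j=\mathrm{span}\{e^s_{ij'}:j'\le j\}$, $\omega=\sum_{(i,j)\in\Delta}e^1_{ij}$. $\mathcal{MS}_{n,d}=\mathcal{A}_G(\mathscr{X}\times\mathscr{X}\times V)$, $\mathcal{MH}=\mathcal{A}_G(\mathscr{Y}\times\mathscr{Y}\times V)$, $\mathcal{MV}=\mathcal{A}_G(\mathscr{X}\times\mathscr{Y}\times V)$ are the $\mathcal{A}$-modules of $G$-invariant $\mathcal{A}$-valued functions, free on the characteristic functions of the orbits. The products on $\mathcal{MS}_{n,d}$ and $\mathcal{MH}$, the left action of $\mathcal{MS}_{n,d}$ and the right action of $\mathcal{MH}$ on $\mathcal{MV}$ are given by convolution $$(g*h)(f,f',\omega)=\sum_{f'',\,\mu\in V}g(f,f'',\mu)\,h(f'',f',\omega-\mu)$$ ($f''$ running over the relevant flag variety), in the usual generic sense: the structure constants are the elements of $\mathcal{A}$ which for every prime power $q$ specialize at $v=\sqrt q$ to the structure constants of this convolution. *)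

(* Defs.v *)
From HB Require Import structures.
From mathcomp Require Import all_boot all_order all_algebra all_field.
From mathcomp Require Import boolp classical_sets functions.

Set Implicit Arguments.
Unset Strict Implicit.
Unset Printing Implicit Defensive.

Import GRing.Theory Num.Theory.
Import VectorInternalTheory.

Local Open Scope ring_scope.

Local Notation "p %:F" := (@FracField.tofrac {poly int} p) : ring_scope.

(* Z[v, v^-1], realised inside the fraction field of Z[v] *)

Definition laurent_pred : {pred {fraction {poly int}}} :=
  [pred x | `[< exists (p : {poly int}) (k : nat),
                  x = p%:F / ('X : {poly int})%:F ^+ k >]].

Fact tofracX_neq0 k : ('X : {poly int})%:F ^+ k != 0.
Proof. by rewrite expf_neq0 // tofrac_eq0 polyX_eq0. Qed.

Fact laurent_subring_closed : subring_closed laurent_pred.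
Proof.
split.
- by apply/asboolP; exists 1, 0%N; rewrite expr0 divr1 rmorph1.
- move=> x y /asboolP[p [k ->]] /asboolP[r [l ->]]; apply/asboolP.
  exists (p * 'X^l - r * 'X^k), (k + l)%N.
  rewrite -mulNr addf_div ?tofracX_neq0 // exprD.
  by rewrite rmorphB !rmorphM !rmorphXn mulNr.
- move=> x y /asboolP[p [k ->]] /asboolP[r [l ->]]; apply/asboolP.
  by exists (p * r), (k + l)%N; rewrite mulf_div exprD rmorphM.
Qed.

HB.instance Definition _ :=
  GRing.isSubringClosed.Build _ laurent_pred laurent_subring_closed.

Record laurent := Laurent {
  laurent_frac :> {fraction {poly int}};
  _ : laurent_frac \in laurent_pred }.

HB.instance Definition _ := [isSub for laurent_frac].
HB.instance Definition _ := [Choice of laurent by <:].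
HB.instance Definition _ := [SubChoice_isSubComNzRing of laurent by <:].

(* Specialization v := x, meaningful for x != 0 (see laurent_evalE). *)
Definition laurent_eval (x : algC) (a : laurent) : algC :=
  xget 0 [set y | exists (p : {poly int}) (k : nat),
    laurent_frac a = p%:F / ('X : {poly int})%:F ^+ k
    /\ y = (map_poly intr p).[x] / x ^+ k].

Lemma laurent_evalE (x : algC) (a : laurent) (p : {poly int}) (k : nat) :
  x != 0 -> laurent_frac a = p%:F / ('X : {poly int})%:F ^+ k ->
  laurent_eval x a = (map_poly intr p).[x] / x ^+ k.
Proof.
move=> x0 ap; rewrite /laurent_eval.
case: xgetP => [y _ [r [l [ar ->]]]|/(_ _ (ex_intro _ p (ex_intro _ k
  (conj ap erefl))))] //.
have /eqP := ar; rewrite ap eqr_div ?tofracX_neq0 // -!rmorphXn -!rmorphM.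
rewrite tofrac_eq => /eqP/(congr1 (fun s => (map_poly (intr : int -> algC) s).[x])).
rewrite !rmorphM /= !map_polyXn !hornerM !hornerXn => E.
by apply/eqP; rewrite eqr_div ?expf_neq0 // E.
Qed.

(* A member of Y is a d-step flag whose i-th space has dimension i. *)

HB.instance Definition _ (F : finFieldType) (vT : vectType F) :=
  [Countable of {vspace vT} by <:].
HB.instance Definition _ (F : finFieldType) (vT : vectType F) :=
  [Finite of {vspace vT} by <:].

Definition chain (F : finFieldType) (n d : nat) :=
  {ffun 'I_n.+1 -> {vspace 'rV[F]_d}}.

Definition is_flag (F : finFieldType) (n d : nat) (f : chain F n d) : bool :=
  [&& f ord0 == 0%VS, f ord_max == fullv &
      [forall i : 'I_n.+1, forall j : 'I_n.+1, (i <= j)%N ==> (f i <= f j)%VS]].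

Definition is_complete_flag (F : finFieldType) (d : nat) (f : chain F d d) :
    bool :=
  is_flag f && [forall i : 'I_d.+1, \dim (f i) == i].

(* Entries live in 'I_d.+1 because they sum to d. *)

Definition label (m n d : nat) : Type :=
  ('M['I_d.+1]_(m, n) * {set 'I_m * 'I_n})%type.

Definition decorated (m n d : nat) (x : label m n d) : bool :=
  [&& (\sum_i \sum_j (x.1 i j : nat) == d)%N,
      [forall p in x.2, (0 < x.1 p.1 p.2)%N] &
      [forall p in x.2, forall r in x.2, (p != r) ==>
         ((p.1 < r.1)%N && (r.2 < p.2)%N) || ((r.1 < p.1)%N && (p.2 < r.2)%N)]].

Definition XX_label (n d : nat) := {x : label n n d | decorated x}.

Definition XY_label (n d : nat) :=
  {x : label n d d | decorated x && [forall j, (\sum_i (x.1 i j : nat) == 1)%N]}.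

Definition YY_label (d : nat) :=
  {x : label d d d | decorated x && is_perm_mx (map_mx (@nat_of_ord _) x.1)}.

(* Indices (p, s), p = (i, j), of the basis vectors e^{s+1}_{ij}. *)
Definition cells (m n d : nat) (A : 'M['I_d.+1]_(m, n)) :
    seq ('I_m * 'I_n * nat) :=
  [seq (p, s) | p <- enum {: 'I_m * 'I_n}, s <- iota 0 (A p.1 p.2)].

(* Rows and columns are numbered from 0, so "i' <= i" becomes "i' < i" below. *)
Definition in_orbit (F : finFieldType) (m n d : nat) (x : label m n d)
    (f : chain F m d) (f' : chain F n d) (w : 'rV[F]_d) : Prop :=
  exists e : 'I_m * 'I_n * nat -> 'rV[F]_d,
    [/\ basis_of fullv (map e (cells x.1)),
        forall i : 'I_m.+1,
          f i =
            <<[seq e c | c : 'I_m * 'I_n * nat <- cells x.1 & (c.1.1 < i)%N]>>%VS,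
        forall j : 'I_n.+1,
          f' j =
            <<[seq e c | c : 'I_m * 'I_n * nat <- cells x.1 & (c.1.2 < j)%N]>>%VS &
        w = \sum_(p in x.2) e (p, 0%N)].

Definition char_fun (F : finFieldType) (m n d : nat) (x : label m n d)
    (f : chain F m d) (f' : chain F n d) (w : 'rV[F]_d) : algC :=
  `[< in_orbit x f f' w >]%:R.

Definition convolution (F : finFieldType) (m k n d : nat)
    (Z : pred (chain F k d))
    (g : chain F m d -> chain F k d -> 'rV[F]_d -> algC)
    (h : chain F k d -> chain F n d -> 'rV[F]_d -> algC)
    (f : chain F m d) (f' : chain F n d) (w : 'rV[F]_d) : algC :=
  \sum_(f'' : chain F k d | Z f'') \sum_(u : 'rV[F]_d) g f f'' u * h f'' f' (w - u).

(* The coefficient of the orbit z in the convolution of the orbits x and y.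
   Finite fields stand for prime powers q = #|F|.  At most one element of A
   satisfies the condition, as every orbit is non-empty over every F. *)
Definition struct_const (m k n d : nat)
    (Z : forall F : finFieldType, pred (chain F k d))
    (x : label m k d) (y : label k n d) (z : label m n d) : laurent :=
  xget 0 [set c : laurent |
    forall (F : finFieldType) (f : chain F m d) (f' : chain F n d)
           (w : 'rV[F]_d), in_orbit z f f' w ->
      laurent_eval (sqrtC #|F|%:R) c
      = convolution (Z F) (char_fun x) (char_fun y) f f' w].

(* The free A-modules on the orbits; an element is its family of coordinates. *)
Definition MS (n d : nat) := {ffun XX_label n d -> laurent^o}.
Definition MV (n d : nat) := {ffun XY_label n d -> laurent^o}.
Definition MH (d : nat) := {ffun YY_label d -> laurent^o}.

HB.instance Definition _ n d := GRing.Lmodule.on (MS n d).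
HB.instance Definition _ n d := GRing.Lmodule.on (MV n d).
HB.instance Definition _ d := GRing.Lmodule.on (MH d).

Definition bilinear_ext (I J K : finType) (c : I -> J -> K -> laurent)
    (g : {ffun I -> laurent^o}) (h : {ffun J -> laurent^o}) :
    {ffun K -> laurent^o} :=
  [ffun z => \sum_x \sum_y (g x : laurent) * (h y : laurent) * c x y z].

Definition in_X (n d : nat) (F : finFieldType) : pred (chain F n d) :=
  @is_flag F n d.
Definition in_Y (d : nat) (F : finFieldType) : pred (chain F d d) :=
  @is_complete_flag F d.

Definition MS_mul (n d : nat) : MS n d -> MS n d -> MS n d :=
  bilinear_ext (fun x y z => struct_const (@in_X n d) (val x) (val y) (val z)).

Definition MH_mul (d : nat) : MH d -> MH d -> MH d :=
  bilinear_ext (fun x y z => struct_const (@in_Y d) (val x) (val y) (val z)).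

Definition MS_act (n d : nat) : MS n d -> MV n d -> MV n d :=
  bilinear_ext (fun x y z => struct_const (@in_X n d) (val x) (val y) (val z)).

(* The MV argument comes second, so that MH_act h is an endomorphism of MV. *)
Definition MH_act (n d : nat) (h : MH d) (m : MV n d) : MV n d :=
  bilinear_ext (fun x y z => struct_const (@in_Y d) (val x) (val y) (val z)) m h.

Definition End_MS (n d : nat) : set (MV n d -> MV n d) :=
  [set phi | linear phi
             /\ forall (s : MS n d) (m : MV n d),
                  phi (MS_act s m) = MS_act s (phi m)].

Definition End_MH (n d : nat) : set (MV n d -> MV n d) :=
  [set phi | linear phi
             /\ forall (h : MH d) (m : MV n d),
                  phi (MH_act h m) = MH_act h (phi m)].

(* Main.v *)
(* An orbit of (f, f', w) is determined, independently of the field, by its type: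
   the dimensions of the f_i :&: f'_j and the truth values of w \in f_i + f'_j.

   Structure constants.  For complete flags, T_s (move one step of f, w = 0) and
   X_a (f fixed, w \in f_a) have polynomial left multiplication: an adjacent flag
   is given by a scalar c, and its type depends only on whether c = 0 or c = 1.
   For an order ideal S of the permutation p, the function "(f, f') in position p
   and w in the subspace attached to S" is a product T..T X_a T..T, and Moebius
   inversion over the ideals recovers the orbits.  For partial flags, replace the
   middle flag by its unique complete refinement closest to f.

   Double centralizer.  Let xi_b be the function (f, f', 0) with f the coarsening
   of f' along b.  As a right module MV is generated, up to nonzero factors, by
   the xi_b, and an image of xi_b under an MH-endomorphism is invariant under the
   parabolic of b, hence comes from MS.  If n >= d, some b is injective on complete
   flags; then xi_b generates MV as a left module and is fixed by an idempotent of
   MS that cuts MV down to MH. *)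
From HB Require Import structures.
From Pilot Require Import Defs.
From mathcomp Require Import all_boot all_order all_fingroup all_algebra all_field.
From mathcomp Require Import boolp ring zify.
From mathcomp Require classical_sets.
Import Pilot.Defs.
Set Implicit Arguments.
Unset Strict Implicit.
Unset Printing Implicit Defensive.
Import GRing.Theory Num.Theory.
Local Open Scope ring_scope.

(** * Specialization of Laurent polynomials *)

Local Notation "p %:F" := (@FracField.tofrac {poly int} p) : ring_scope.

(** The structure constants are defined by a choice with default 0, so nothing can be said about the
    products until one Laurent polynomial is known to give the convolution of two orbits over all
    finite fields at once. No closed formula is computed: preserving genericity under left
    convolution is stable under products and linear combinations, so it is checked on two kinds of
    generators only. Afterwards elements are handled through their values over every F, where
    associativity is a rearrangement of sums; equality over every F is equality, since a Laurent
    polynomial is determined by its values at infinitely many sqrt q. The second obstacle is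
    integrality. An element of MV is reached from the xi_b only up to the number N of refinements of
    a flag, which is in general no unit of A. N is never inverted: two maps are compared after
    multiplication by N, and N is cancelled over each field, where it is a positive integer. For the
    same reason the element of MS is read off from invariant values instead of being obtained by
    averaging. *)

Lemma laurentP (a : laurent) : exists (p : {poly int}) (k : nat),
  laurent_frac a = p%:F / ('X : {poly int})%:F ^+ k.
Proof. by case: a => a /= /asboolP. Qed.

Definition sqrtq (F : finFieldType) : algC := sqrtC #|F|%:R.

Lemma sqrtq_neq0 (F : finFieldType) : sqrtq F != 0.
Proof. by rewrite sqrtC_eq0 pnatr_eq0 -lt0n; apply/card_gt0P; exists 0. Qed.

Definition evF (F : finFieldType) (a : laurent) : algC := laurent_eval (sqrtq F) a.

Section EvalMorphism.
Variable F : finFieldType.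
Let x := sqrtq F.
Let x0 : x != 0 := sqrtq_neq0 F.

Lemma evF_sub : {morph evF F : a b / a - b}.
Proof.
move=> a b; have [p [k ap]] := laurentP a; have [r [l br]] := laurentP b.
rewrite /evF (laurent_evalE x0 ap) (laurent_evalE x0 br).
rewrite (@laurent_evalE x _ (p * 'X^l - r * 'X^k) (k + l)) //; last first.
  rewrite /= ap br -mulNr addf_div ?tofracX_neq0 // exprD.
  by rewrite rmorphB !rmorphM !rmorphXn mulNr.
rewrite rmorphB !rmorphM /= !map_polyXn hornerD hornerN !hornerM !hornerXn exprD.
by field; rewrite !expf_neq0.
Qed.

Lemma evF_mul : {morph evF F : a b / a * b}.
Proof.
move=> a b; have [p [k ap]] := laurentP a; have [r [l br]] := laurentP b.
rewrite /evF (laurent_evalE x0 ap) (laurent_evalE x0 br).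
rewrite (@laurent_evalE x _ (p * r) (k + l)) //; last first.
  by rewrite /= ap br mulf_div exprD rmorphM.
by rewrite rmorphM hornerM mulf_div exprD.
Qed.

Lemma evF_1 : evF F 1 = 1.
Proof.
rewrite /evF (@laurent_evalE x _ 1 0%N) //; last by rewrite /= expr0 divr1 rmorph1.
by rewrite rmorph1 hornerC expr0 divr1.
Qed.

End EvalMorphism.

HB.instance Definition _ F := GRing.isZmodMorphism.Build laurent algC (evF F) (@evF_sub F).
HB.instance Definition _ F := GRing.isMonoidMorphism.Build laurent algC (evF F)
  (conj (evF_1 F) (@evF_mul F)).

(** The numerator of the difference vanishes at sqrt p for every prime p, hence has more roots than
    its degree allows. *)
Lemma evF_inj (a b : laurent) : (forall F, evF F a = evF F b) -> a = b.
Proof.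
move=> eab; apply/eqP; rewrite -subr_eq0; apply/eqP.
have {eab} : forall F, evF F (a - b) = 0 by move=> F; rewrite rmorphB /= eab subrr.
move: (a - b) => c c0; have [p [k cp]] := laurentP c.
apply: val_inj; rewrite /= cp.
suff -> : p = 0 by rewrite rmorph0 mul0r.
pose P := map_poly (intr : int -> algC) p.
suff P0 : P = 0.
  apply/eqP; apply: contraT => pn0.
  have := map_poly_eq0_id0 (f := intr : int -> algC) (p := p).
  by rewrite -/P P0 eqxx (negPf pn0) intr_eq0 lead_coef_eq0 pn0 => /(_ isT).
apply/eqP; apply: contraT => Pn0.
(* A prime above the sum of the primes already listed is a new one. *)
have [rs rsU [rsP rsS]] : exists2 rs : seq nat, uniq rs & all prime rs /\ (size P <= size rs)%N.
  elim: (size P) => [|n [rs rsU [rsP rsS]]]; first by exists [::].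
  have [q qs qP] := prime_above (sumn rs); exists (q :: rs); rewrite /= ?qP ?rsU ?andbT //.
  apply: contraL qs => qrs; rewrite -leqNgt.
  by rewrite (perm_sumn (perm_to_rem qrs)) /= leq_addr.
suff : (size [seq sqrtC (q%:R : algC) | q <- rs] < size P)%N.
  by rewrite size_map ltnNge rsS.
apply: max_poly_roots => //.
  apply/allP => y /mapP[q qrs ->]; rewrite /root.
  have qp : prime q by apply: (allP rsP).
  have := c0 'F_q; rewrite /evF (laurent_evalE (sqrtq_neq0 _) cp) => /eqP.
  by rewrite mulf_eq0 invr_eq0 expf_eq0 (negPf (sqrtq_neq0 _)) andbF orbF /sqrtq card_Fp.
rewrite map_inj_in_uniq // => q r _ _ /(congr1 (fun y => y ^+ 2)).
by rewrite !sqrtCK => /eqP; rewrite eqr_nat => /eqP.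
Qed.

Definition laurent_v : laurent.
Proof.
apply: (@Laurent ('X : {poly int})%:F); apply/asboolP; exists 'X, 0%N.
by rewrite expr0 divr1.
Defined.

Definition laurent_q : laurent := laurent_v ^+ 2.

Lemma evF_q F : evF F laurent_q = #|F|%:R.
Proof.
rewrite rmorphXn /= /evF (@laurent_evalE _ _ 'X 0%N) ?sqrtq_neq0 //=.
  by rewrite map_polyX hornerX expr0 divr1 sqrtCK.
by rewrite expr0 divr1.
Qed.

(** * Coordinates adapted to two flags *)

Definition otype (m n : nat) := {ffun 'I_m.+1 * 'I_n.+1 -> nat * bool}.

Definition ftype (F : finFieldType) (m n d : nat) (f : chain F m d)
    (f' : chain F n d) (w : 'rV[F]_d) : otype m n :=
  [ffun p => (\dim (f p.1 :&: f' p.2)%VS, w \in (f p.1 + f' p.2)%VS)].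

Definition ltype (m n d : nat) (x : label m n d) : otype m n :=
  [ffun p : 'I_m.+1 * 'I_n.+1 =>
             ((\sum_(q : 'I_m * 'I_n | (q.1 < p.1) && (q.2 < p.2)) x.1 q.1 q.2)%N,
              [forall q in x.2, (q.1 < p.1)%N || (q.2 < p.2)%N])].

(* Only the support of the vector matters for the type. *)
Definition cotype (m n d : nat) (row col : 'I_d -> nat) (D : {set 'I_d}) : otype m n :=
  [ffun p : 'I_m.+1 * 'I_n.+1 =>
             (#|[set k | (row k < p.1)%N && (col k < p.2)%N]|,
              [forall k in D, (row k < p.1)%N || (col k < p.2)%N])].

Lemma ftype_dim (F : finFieldType) m n d (f : chain F m d) (f' : chain F n d) w i j :
  (ftype f f' w (i, j)).1 = \dim (f i :&: f' j).
Proof. by rewrite ffunE. Qed.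

Lemma ftype_mem (F : finFieldType) m n d (f : chain F m d) (f' : chain F n d) w i j :
  (ftype f f' w (i, j)).2 = (w \in f i + f' j)%VS.
Proof. by rewrite ffunE. Qed.

Section Frames.
Variables (F : finFieldType) (d : nat).
Implicit Types (u v w : 'rV[F]_d) (P : 'M[F]_d) (S : {set 'I_d}).

Definition supp P v : {set 'I_d} := [set k | (v *m P) 0 k != 0].

Lemma supp_subP P v S : reflect (forall k, k \notin S -> (v *m P) 0 k = 0) (supp P v \subset S).
Proof.
apply: (iffP subsetP) => [sS k kS|h k]; last first.
  by rewrite inE; apply: contraR => /h ->.
by apply/eqP; apply: contraNT kS => vk; apply: sS; rewrite inE.
Qed.

Lemma card_coords (a : 'I_d -> pred F) :
  #|[set v : 'rV[F]_d | [forall k, a k (v 0 k)]]| = (\prod_k #|a k|)%N.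
Proof.
pose g (v : 'rV[F]_d) : {ffun 'I_d -> F} := [ffun k => v 0 k].
have gi : injective g.
  by move=> u v /ffunP uv; apply/rowP => k; have := uv k; rewrite !ffunE.
rewrite -(card_imset _ gi).
transitivity #|family a|.
  apply: eq_card => h; apply/imsetP/familyP.
    by move=> [v + ->] k; rewrite inE ffunE => /forallP/(_ k).
  move=> ha; exists (\row_k h k); last by apply/ffunP => k; rewrite ffunE mxE.
  by rewrite inE; apply/forallP => k; rewrite mxE; apply: ha.
by rewrite card_family foldrE big_map big_enum.
Qed.

Lemma card_frame P (a : 'I_d -> pred F) : P \in unitmx ->
  #|[set v : 'rV[F]_d | [forall k, a k ((v *m P) 0 k)]]| = (\prod_k #|a k|)%N.
Proof.
move=> uP; rewrite -card_coords -(card_imset _ (can_inj (mulmxK uP))).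
apply: eq_card => v; rewrite inE; apply/imsetP/idP => [[u + ->]|av]; first by rewrite inE.
by exists (v *m invmx P); rewrite ?inE mulmxKV.
Qed.

(** The dimension is read off the number of vectors, which is a power of q. *)
Lemma dim_frame P (U : {vspace 'rV[F]_d}) S : P \in unitmx ->
  (forall v, (v \in U) = (supp P v \subset S)) -> \dim U = #|S|.
Proof.
move=> uP hU; apply/eqP; rewrite -(eqn_exp2l _ _ (finRing_gt1 F)) -card_vspace.
have -> : #|U| = #|[set v : 'rV[F]_d | [forall k, (if k \in S then predT else pred1 0) ((v *m P) 0 k)]]|.
  apply: eq_card => v; rewrite inE hU; apply/supp_subP/forallP => h k.
    by case: ifP => //= /negbT/h ->.
  by move=> kS; have := h k; rewrite (negPf kS) => /eqP.
rewrite (card_frame (fun k => if k \in S then predT else pred1 0) uP); apply/eqP.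
rewrite (bigID (mem S)) /= [X in (_ * X)%N]big1 ?muln1; last first.
  by move=> k /negPf ->; rewrite card1.
by rewrite (eq_bigr (fun=> #|F|)) ?prod_nat_const // => k ->.
Qed.

Lemma supp_add_frame P (U U' : {vspace 'rV[F]_d}) S S' v : P \in unitmx ->
  (forall v, (v \in U) = (supp P v \subset S)) ->
  (forall v, (v \in U') = (supp P v \subset S')) ->
  (v \in (U + U')%VS) = (supp P v \subset S :|: S').
Proof.
move=> uP hU hU'; apply/memv_addP/idP => [[u + [u' + ->]]|].
  rewrite hU hU' => /supp_subP uS /supp_subP uS'; apply/supp_subP => k.
  by rewrite inE => /norP[kS kS']; rewrite mulmxDl mxE uS // uS' // addr0.
move=> /supp_subP vS.
exists ((\row_k (if k \in S then (v *m P) 0 k else 0)) *m invmx P).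
  by rewrite hU; apply/supp_subP => k kS; rewrite mulmxKV // mxE (negPf kS).
exists ((\row_k (if k \in S then 0 else (v *m P) 0 k)) *m invmx P).
  rewrite hU'; apply/supp_subP => k kS; rewrite mulmxKV // mxE.
  by case: ifPn => // kS'; apply: vS; rewrite inE negb_or kS kS'.
rewrite -mulmxDl; apply: (can_inj (mulmxK uP)); rewrite mulmxKV //.
by apply/rowP => k; rewrite !mxE; case: ifP; rewrite ?addr0 ?add0r.
Qed.

(** Coordinates with respect to a basis adapted to both flags: [v *m P] lists the coordinates of v,
    and the k-th basis vector belongs to the steps of f after [row k] and to the steps of f' after
    [col k]. *)
Definition frame m n (row col : 'I_d -> nat) (f : chain F m d) (f' : chain F n d) P :=
  [/\ P \in unitmx,
      forall i v, (v \in f i) = (supp P v \subset [set k | (row k < i)%N]) &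
      forall j v, (v \in f' j) = (supp P v \subset [set k | (col k < j)%N])].

Lemma frame_ftype m n row col (f : chain F m d) (f' : chain F n d) P w :
  frame row col f f' P -> ftype f f' w = cotype m n row col (supp P w).
Proof.
move=> [uP hf hf']; apply/ffunP => -[i j]; rewrite !ffunE /=; congr pair.
  apply: (dim_frame uP) => v; rewrite memv_cap hf hf'.
  rewrite -subsetI; congr (_ \subset (mem (pred_of_set _))).
  by apply/setP => k; rewrite !inE.
rewrite (supp_add_frame _ uP (hf i) (hf' j)).
apply/subsetP/forall_inP => h k /h; by rewrite !inE.
Qed.

Lemma span_frame (X : d.-tuple 'rV[F]_d) (p : pred 'I_d) (s : seq 'rV[F]_d) v :
  basis_of fullv X -> s =i [seq X`_k | k : 'I_d in p] ->
  let P := invmx (\matrix_k X`_k) in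
  [/\ P \in unitmx, forall k : 'I_d, X`_k *m P = delta_mx 0 k &
    (v \in <<s>>%VS) = (supp P v \subset [set k | p k])].
Proof.
move=> bX sX P; set B := \matrix_k X`_k in P *.
have uB : B \in unitmx.
  rewrite -row_free_unit; apply: inj_row_free => u uB0.
  have /freeP fX := basis_free bX; apply/rowP => k; rewrite mxE; apply: fX.
  by rewrite -[RHS]uB0 mulmx_sum_row; apply: eq_bigr => l _; rewrite rowK.
have uP : P \in unitmx by rewrite unitmx_inv.
have XP (k : 'I_d) : X`_k *m P = delta_mx 0 k.
  by rewrite -[X`_k](rowK (fun k : 'I_d => X`_k)) -/B rowE -mulmxA mulmxV // mulmx1.
split => //; apply/idP/supp_subP => [vs k kS|h].
  rewrite [v](coord_span (X := in_tuple s)) // mulmx_suml summxE big1 // => i _.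
  have /imageP[l pl ->] : s`_i \in [seq X`_k | k : 'I_d in p] by rewrite -sX mem_nth.
  rewrite -scalemxAl XP !mxE eqxx andTb [k == l]negbTE ?mulr0 //.
  by apply: contraNneq kS => ->; rewrite inE.
rewrite -[v](mulmxK uP) /P invmxK -/P mulmx_sum_row; apply: memv_suml => k _.
rewrite /B rowK; case pk: (p k); last by rewrite h ?scale0r ?mem0v // inE pk.
by apply/memvZ/memv_span; rewrite sX; apply: image_f.
Qed.

End Frames.

Section LabelFrame.
Variables (m n d : nat) (x : label m n d).

Definition lrow (k : 'I_d) := nth 0%N [seq (c.1.1 : nat) | c : 'I_m * 'I_n * nat <- cells x.1] k.
Definition lcol (k : 'I_d) := nth 0%N [seq (c.1.2 : nat) | c : 'I_m * 'I_n * nat <- cells x.1] k.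
Definition lmark : {set 'I_d} :=
  [set k : 'I_d | nth false [seq (c.1 \in x.2) && (c.2 == 0)%N | c : 'I_m * 'I_n * nat <- cells x.1] k].

Lemma size_cells : size (cells x.1) = (\sum_i \sum_j (x.1 i j : nat))%N.
Proof.
rewrite size_allpairs_dep sumnE big_map big_enum pair_big /=.
by apply: eq_bigr => -[i j] _; rewrite size_iota.
Qed.

Lemma cells_uniq : uniq (cells x.1).
Proof.
apply: allpairs_uniq_dep => [|p _|]; rewrite ?enum_uniq ?iota_uniq //.
by move=> [p s] [q t] _ _ /= [-> ->].
Qed.

Lemma mem_cells p s : ((p, s) \in cells x.1) = (s < x.1 p.1 p.2)%N.
Proof.
apply/allpairsPdep/idP => [[q [t [_ +]]] [-> ->]|h]; first by rewrite mem_iota add0n.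
by exists p, s; rewrite mem_enum mem_iota.
Qed.

Hypothesis dx : decorated x.

Lemma size_cells_decorated : size (cells x.1) = d.
Proof. by rewrite size_cells; case/and3P: dx => /eqP. Qed.

(** Says that c is the k-th cell. Quantifying over the default value z avoids the choice of a
    default cell, which need not exist. *)
Definition cell_at (k : 'I_d) (c : 'I_m * 'I_n * nat) :=
  [/\ lrow k = c.1.1, lcol k = c.1.2, (k \in lmark) = ((c.1 \in x.2) && (c.2 == 0)%N)
    & forall T (e : 'I_m * 'I_n * nat -> T) z, nth z (map e (cells x.1)) k = e c].

Lemma cell_at_index c : c \in cells x.1 -> exists2 k : 'I_d, cell_at k c & index c (cells x.1) = k.
Proof.
move=> cx; have kd : (index c (cells x.1) < d)%N by rewrite -[X in (_ < X)%N]size_cells_decorated index_mem.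
exists (Ordinal kd) => //.
have E T (e : 'I_m * 'I_n * nat -> T) z : nth z (map e (cells x.1)) (Ordinal kd) = e c.
  by rewrite (nth_map c) ?index_mem //= nth_index.
by split; rewrite ?inE; do ?exact: E.
Qed.

Lemma cell_at_exists (k : 'I_d) : exists2 c, c \in cells x.1 & cell_at k c.
Proof.
have ks : (k < size (cells x.1))%N by rewrite size_cells_decorated.
have [c0 _] : exists c0, c0 \in cells x.1.
  by case: (cells x.1) ks => // c s _; exists c; rewrite mem_head.
exists (nth c0 (cells x.1) k); first exact: mem_nth.
have E T (e : 'I_m * 'I_n * nat -> T) z : nth z (map e (cells x.1)) k = e (nth c0 (cells x.1) k).
  by rewrite (nth_map c0).
by split; rewrite ?inE; do ?exact: E.
Qed.

Lemma cell_at_inj k c c' : cell_at k c -> cell_at k c' -> c = c'.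
Proof. by case=> _ _ _ /(_ _ id c) <- [_ _ _ /(_ _ id c) <-]. Qed.

(** The inverse of the matrix of basis vectors is the frame. The coordinates of w are exactly 0 or
    1, so they depend on the label alone and not on the field. *)
Lemma frame_orbit (F : finFieldType) (f : chain F m d) (f' : chain F n d) w :
  in_orbit x f f' w ->
  exists P, frame lrow lcol f f' P /\ forall k, (w *m P) 0 k = (k \in lmark)%:R.
Proof.
move=> [e [be hf hf' hw]].
have sX : size (map e (cells x.1)) = d by rewrite size_map size_cells_decorated.
pose X : d.-tuple 'rV[F]_d := tcast sX (in_tuple (map e (cells x.1))).
have XE : X = map e (cells x.1) :> seq _ by rewrite val_tcast.
have bX : basis_of fullv X by rewrite XE.
have mX (p : pred ('I_m * 'I_n * nat)) (r : pred 'I_d) :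
    (forall k c, cell_at k c -> r k = p c) ->
    [seq e c | c <- cells x.1 & p c] =i [seq X`_k | k : 'I_d in r].
  move=> rp v; rewrite XE; apply/mapP/imageP => [[c + ->]|[k rk ->]].
    rewrite mem_filter => /andP[pc /cell_at_index[k kc _]]; exists k.
      by rewrite unfold_in (rp _ _ kc).
    by case: kc => _ _ _ ->.
  have [c cx kc] := cell_at_exists k; exists c; last by case: kc => _ _ _ ->.
  by rewrite mem_filter cx -(rp _ _ kc) andbT; exact: rk.
have h0 : [::] =i [seq X`_k | k : 'I_d in pred0] by move=> v; rewrite image_pred0.
have [uP XP _] := span_frame 0 bX h0.
exists (invmx (\matrix_k X`_k)); split; first split => //.
- move=> i v; rewrite hf.
  have [|_ _ ->] // := span_frame (p := fun k => (lrow k < i)%N) v bX (mX (fun c => (c.1.1 < i)%N) _ _).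
  by move=> k c [->].
- move=> j v; rewrite hf'.
  have [|_ _ ->] // := span_frame (p := fun k => (lcol k < j)%N) v bX (mX (fun c => (c.1.2 < j)%N) _ _).
  by move=> k c [_ ->].
have eP k c : cell_at k c -> e c *m invmx (\matrix_k X`_k) = delta_mx 0 k.
  by case=> _ _ _ E; rewrite -XP XE E.
have ea p : p \in x.2 -> (p, 0%N) \in cells x.1.
  by move=> px; rewrite mem_cells; case/and3P: dx => _ /forall_inP/(_ _ px).
move=> k; rewrite hw mulmx_suml summxE.
have [c cx kc] := cell_at_exists k; case: (kc) => _ _ -> _.
case cm: (_ && _); last first.
  rewrite big1 // => p px; have [l lc _] := cell_at_index (ea _ px).
  rewrite (eP _ _ lc) mxE eqxx /=; case: eqP => // kl; subst l.
  by move: cm; rewrite (cell_at_inj kc lc) px.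
have /andP[cx2 /eqP c0] := cm.
have cE : c = (c.1, 0%N) by case: c c0 {cx kc cx2 cm} => ? ? /= ->.
rewrite (bigD1 c.1) //= -cE (eP _ _ kc) mxE !eqxx big1 ?addr0 // => p /andP[px pc].
have [l lc _] := cell_at_index (ea _ px).
rewrite (eP _ _ lc) mxE eqxx /=; case: eqP => // kl; subst l.
by move: pc; rewrite (cell_at_inj kc lc) eqxx.
Qed.

Lemma ltype_frame : ltype x = cotype m n lrow lcol lmark.
Proof.
apply/ffunP => -[i j]; rewrite !ffunE /=; congr pair.
  pose G (c : 'I_m * 'I_n * nat) : nat := ((c.1.1 < i) && (c.1.2 < j))%N.
  transitivity (\sum_(c <- cells x.1) G c)%N.
    rewrite big_allpairs_dep /= big_enum /= [LHS]big_mkcond; apply: eq_bigr => p _.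
    rewrite /G /= big_const_seq count_predT size_iota iter_addn_0.
    by case: ifP => _; rewrite ?mul1n ?mul0n.
  rewrite -sum1_card [RHS]big_mkcond /= -[LHS](big_map G predT id) (big_nth 0%N) big_mkord size_map.
  rewrite size_cells_decorated.
 apply: eq_bigr => k _.
  have [c _ [lr lc _ E]] := cell_at_exists k.
  by rewrite E inE lr lc /G; case: andP.
apply/forall_inP/forall_inP => h.
  move=> k kx; have [c _ [-> -> cm _]] := cell_at_exists k.
  by move: kx; rewrite cm => /andP[/h].
move=> p px; have /cell_at_index[k [<- <- cm _] _] : (p, 0%N) \in cells x.1.
  by rewrite mem_cells; case/and3P: dx => _ /forall_inP/(_ _ px).
by apply: h; rewrite cm /= px.
Qed.

End LabelFrame.

(** * Classification of orbits by types *)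

Lemma cell_at_injl m n d (x : label m n d) (k l : 'I_d) c : decorated x ->
  cell_at x k c -> cell_at x l c -> k = l.
Proof.
move=> dx [_ _ _ /(_ _ id c) kc] [_ _ _ /(_ _ id c) lc]; apply/val_inj/eqP => /=.
by rewrite -(nth_uniq c _ _ (cells_uniq x)) ?size_cells_decorated // -{1}(map_id (cells x.1)) -[in X in _ == X](map_id (cells x.1)) kc lc.
Qed.

Lemma in_orbit_ftype (F : finFieldType) m n d (x : label m n d) (f : chain F m d) (f' : chain F n d) w :
  decorated x -> in_orbit x f f' w -> ftype f f' w = ltype x.
Proof.
move=> dx /(frame_orbit dx)[P [fP wP]]; rewrite (frame_ftype w fP) ltype_frame //.
congr cotype; apply/setP => k; rewrite [LHS]inE wP.
by case: (k \in lmark x); rewrite ?oner_eq0 ?eqxx.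
Qed.

Lemma in_orbit_flag (F : finFieldType) m n d (x : label m n d) (f : chain F m d) (f' : chain F n d) w :
  in_orbit x f f' w -> is_flag f && is_flag f'.
Proof.
move=> [e [be hf hf' _]]; have eF : <<map e (cells x.1)>>%VS = fullv by case/andP: be => /eqP.
apply/andP; split; apply/and3P; split.
- by rewrite hf filter_pred0 span_nil.
- rewrite hf -eF; apply/eqP; congr (span (map e _)).
  by apply/all_filterP/allP => c _; apply: ltn_ord.
- apply/forallP => i; apply/forallP => j; apply/implyP => ij; rewrite !hf.
  apply: sub_span => v /mapP[c + ->]; rewrite mem_filter => /andP[ci cx].
  by apply: map_f; rewrite mem_filter cx (leq_trans ci).
- by rewrite hf' filter_pred0 span_nil.
- rewrite hf' -eF; apply/eqP; congr (span (map e _)).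
  by apply/all_filterP/allP => c _; apply: ltn_ord.
- apply/forallP => i; apply/forallP => j; apply/implyP => ij; rewrite !hf'.
  apply: sub_span => v /mapP[c + ->]; rewrite mem_filter => /andP[ci cx].
  by apply: map_f; rewrite mem_filter cx (leq_trans ci).
Qed.

Lemma orbit_nonempty (F : finFieldType) m n d (x : label m n d) : decorated x ->
  exists (f : chain F m d) (f' : chain F n d) w, in_orbit x f f' w.
Proof.
(* The k-th cell receives the k-th standard basis vector. *)
move=> dx; pose e c : 'rV[F]_d := \row_k (nth false [seq c == c' | c' <- cells x.1] k)%:R.
have ek (k : 'I_d) c : cell_at x k c -> e c = delta_mx 0 k.
  move=> kc; apply/rowP => l; rewrite !mxE eqxx /=; congr (_%:R).
  have [c' _ lc] := cell_at_exists dx l; case: (lc) => _ _ _ ->; congr nat_of_bool.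
  apply/eqP/eqP => [cc|kl]; first by subst c'; apply: cell_at_injl lc kc.
  by subst l; apply: cell_at_inj kc lc.
exists [ffun i : 'I_m.+1 => <<[seq e c | c : 'I_m * 'I_n * nat <- cells x.1 & (c.1.1 < i)%N]>>%VS].
exists [ffun j : 'I_n.+1 => <<[seq e c | c : 'I_m * 'I_n * nat <- cells x.1 & (c.1.2 < j)%N]>>%VS].
exists (\sum_(p in x.2) e (p, 0%N)), e; split => // [|i|j]; rewrite ?ffunE //.
rewrite basisEdim size_map size_cells_decorated // dimvf /dim /= mul1n leqnn andbT.
apply/subvP => v _; rewrite [v]row_sum_delta; apply: memv_suml => k _; apply: memvZ.
by have [c cx kc] := cell_at_exists dx k; rewrite -(ek k c) //; apply/memv_span/map_f.
Qed.

(** Inclusion-exclusion for the corner of a box, with all terms moved to avoid subtraction. *)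
Lemma box_sum m n (g : 'I_m * 'I_n -> nat) (p : 'I_m * 'I_n) :
  (\sum_(q : 'I_m * 'I_n | (q.1 < p.1.+1) && (q.2 < p.2.+1)) g q +
   \sum_(q : 'I_m * 'I_n | (q.1 < p.1) && (q.2 < p.2)) g q =
   g p + (\sum_(q : 'I_m * 'I_n | (q.1 < p.1) && (q.2 < p.2.+1)) g q +
   \sum_(q : 'I_m * 'I_n | (q.1 < p.1.+1) && (q.2 < p.2)) g q))%N.
Proof.
have -> : g p = (\sum_(q | q == p) g q)%N by rewrite big_pred1_eq.
rewrite ![(\sum_(q | _) g q)%N]big_mkcond -!big_split; apply: eq_bigr => q _ /=.
case: p q => [p1 p2] [q1 q2] /=; rewrite xpair_eqE -!val_eqE /=.
move: (g _) => c; rewrite !eqn_leq.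
by do 5!(case: ifP => ?); lia.
Qed.

(* The positions i and i+1, as indices of a chain of length m.+1. *)
Definition olo m (i : 'I_m) : 'I_m.+1 := widen_ord (leqnSn m) i.
Definition oup m (i : 'I_m) : 'I_m.+1 := lift ord0 i.

Lemma oloE m (i : 'I_m) : olo i = i :> nat.
Proof. by []. Qed.

Lemma oupE m (i : 'I_m) : oup i = i.+1 :> nat.
Proof. by rewrite /= /bump leq0n add1n. Qed.

(** The matrix comes back from its box sums by inclusion-exclusion. The bits of the type tell which
    positions lie weakly below a marked one; thus a marked position of x lies below one of y, which
    lies below one of x, and since the marked positions form an antichain all three coincide. *)
Lemma ltype_inj m n d (x y : label m n d) : decorated x -> decorated y ->
  ltype x = ltype y -> x = y.
Proof.
case: x y => [A D] [A' D'] dx dy /ffunP xy.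
have {}xy i j := xy (i, j).
have AA : A = A'.
  apply/matrixP => i j; apply: val_inj => /=.
  have S i' j' := congr1 fst (xy i' j').
  have := S (oup i) (oup j); have := S (olo i) (olo j).
  have := S (oup i) (olo j); have := S (olo i) (oup j).
  rewrite !ffunE /= /bump !leq0n !add1n => h1 h2 h3 h4.
  have := box_sum (fun q => A q.1 q.2 : nat) (i, j); have := box_sum (fun q => A' q.1 q.2 : nat) (i, j).
  move=> /=; rewrite h1 h2 h3 h4; lia.
have key (E E' : {set 'I_m * 'I_n}) (B B' : 'M['I_d.+1]_(m, n)) : decorated (B, E) -> 
   (forall i j, ltype (B, E) (i, j) = ltype (B', E') (i, j)) -> E \subset E'.
  move=> dB; move=> h.
  have up (G G' : {set 'I_m * 'I_n}) (C C' : 'M['I_d.+1]_(m, n)) p : (forall i j, ltype (C, G) (i, j) = ltype (C', G') (i, j)) -> p \in G ->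
      exists2 q, q \in G' & (p.1 <= q.1)%N && (p.2 <= q.2)%N.
    move=> {}h pG; have := congr1 snd (h (olo p.1) (olo p.2)); rewrite !ffunE /= => e.
    have : ~~ [forall q in G', (q.1 < p.1)%N || (q.2 < p.2)%N].
      by rewrite -e; apply/forall_inPn; exists p; rewrite ?ltnn.
    by case/forall_inPn => q qG; rewrite negb_or -!leqNgt; exists q.
  apply/fintype.subsetP => p pE; have [q qE' pq] := up _ _ _ _ _ h pE.
  have [r rE qr] := up _ _ _ _ _ (fun i j => esym (h i j)) qE'.
  have rp : r = p.
    apply/eqP/contraT => nrp; case/and3P: dB => _ _ /forall_inP/(_ _ rE)/forall_inP/(_ _ pE).
    rewrite nrp; case: (p) (q) (r) pq qr => [p1 p2] [q1 q2] [r1 r2] /=; lia.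
  suff -> : p = q by [].
  subst r; apply/eqP; case: p q pq qr {pE qE' rE} => [p1 p2] [q1 q2] /= pq qr.
  by apply/eqP; congr pair; apply: val_inj => /=; lia.
congr pair => //; apply/eqP; rewrite eqEsubset; apply/andP; split.
  exact: key dx xy.
exact: key dy (fun i j => esym (xy i j)).
Qed.

Lemma dim_add_line (F : finFieldType) d (U : {vspace 'rV[F]_d}) v :
  v \notin U -> \dim (U + <[v]>) = (\dim U).+1.
Proof.
move=> vU; have := dimv_sum_cap U <[v]>.
have -> : (U :&: <[v]> = 0)%VS.
  apply/eqP; rewrite -subv0; apply/subvP => u; rewrite memv_cap memv0 => /andP[uU /vlineP[c uE]].
  move: uU; rewrite uE rpredZeq; case: eqP => [->|] //=; first by rewrite scale0r.
  by rewrite (negPf vU).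
have vn0 : v != 0 by apply: contraNneq vU => ->; apply: mem0v.
by rewrite dimv0 dim_vline vn0 addn0 addn1.
Qed.

(** * Existence of a basis adapted to two flags and a vector *)

Section Existence.
Variables (F : finFieldType) (m n d : nat) (f : chain F m d) (f' : chain F n d).
Hypotheses (ff : is_flag f) (ff' : is_flag f').
Notation V := 'rV[F]_d.
Implicit Types (p q : 'I_m * 'I_n).

Lemma flagS k (g : chain F k d) (i j : 'I_k.+1) : is_flag g -> (i <= j)%N -> (g i <= g j)%VS.
Proof. by case/and3P=> _ _ /forallP/(_ i)/forallP/(_ j)/implyP. Qed.

Lemma flag0 k (g : chain F k d) (i : 'I_k.+1) : is_flag g -> i = 0%N :> nat -> g i = 0%VS.
Proof. by case/and3P=> /eqP <- _ _ i0; congr (g _); apply: val_inj. Qed.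

Lemma flag_full k (g : chain F k d) (i : 'I_k.+1) : is_flag g -> i = k :> nat -> g i = fullv.
Proof. by case/and3P=> _ /eqP <- _ i0; congr (g _); apply: val_inj. Qed.

Let top p := (f (oup p.1) :&: f' (oup p.2))%VS.
Let bot p := (f (olo p.1) :&: f' (oup p.2) + f (oup p.1) :&: f' (olo p.2))%VS.

Let lo_up k (g : chain F k d) i : is_flag g -> (g (olo i) <= g (oup i))%VS.
Proof. by move=> fg; apply: flagS => //; rewrite oupE. Qed.

Let bot_top p : (bot p <= top p)%VS.
Proof. by rewrite subv_add !capvS ?lo_up ?subvv. Qed.

(** Each [b p] lifts a basis of the quotient of [top p] by [bot p], the bigraded piece of the two
    filtrations at p. *)
Definition adapted_choice (b : 'I_m * 'I_n -> seq V) := forall p,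
  (<<b p>> + bot p)%VS = top p /\ (size (b p) + \dim (bot p) = \dim (top p))%N.

Section Choice.
Variable b : 'I_m * 'I_n -> seq V.
Hypothesis gb : adapted_choice b.

Let ord_cases k (i : 'I_k.+1) : i = 0%N :> nat \/ exists i' : 'I_k, i = oup i' /\ olo i' = i.-1 :> nat.
Proof.
case: (unliftP ord0 i) => [i' ->|->]; last by left.
by right; exists i'; rewrite -[lift _ _]/(oup i') oupE.
Qed.

(** Induction on i + j. The corner piece together with the two smaller boxes spans; the sizes follow
    from [box_sum] compared with the dimension formula for the two summands of [bot], whose
    intersection is the smallest box. *)
Lemma sub_span_choice i j :
  (f i :&: f' j <= \sum_(p : 'I_m * 'I_n | (p.1 < i)%N && (p.2 < j)%N) <<b p>>)%VS /\
  (\sum_(p : 'I_m * 'I_n | (p.1 < i) && (p.2 < j)) size (b p) = \dim (f i :&: f' j))%N.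
Proof.
have [N] := ubnP (i + j)%N; elim: N i j => // N IH i j ijN.
have [i0|[i' [iE i'E]]] := ord_cases i.
  rewrite (flag0 ff i0) cap0v sub0v dimv0; split => //.
  by rewrite big_pred0 // => p; rewrite i0.
have [j0|[j' [jE j'E]]] := ord_cases j.
  rewrite (flag0 ff' j0) capv0 sub0v dimv0; split => //.
  by rewrite big_pred0 // => p; rewrite j0 andbF.
have [|s1 d1] := IH (olo i') j; first by move: ijN; rewrite iE jE !oupE /=; lia.
have [|s2 d2] := IH i (olo j'); first by move: ijN; rewrite iE jE !oupE /=; lia.
have [|_ d3] := IH (olo i') (olo j'); first by move: ijN; rewrite iE jE !oupE /=; lia.
have [gs gd] := gb (i', j').
have := box_sum (fun p => size (b p)) (i', j'); rewrite /= -!oupE -iE -jE.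
have -> : i' = olo i' :> nat by [].
have -> : j' = olo j' :> nat by [].
rewrite d1 d2 d3 => E; split; last first.
  have := dimv_sum_cap (f (olo i') :&: f' (oup j')) (f (oup i') :&: f' (olo j')).
  have -> : ((f (olo i') :&: f' (oup j')) :&: (f (oup i') :&: f' (olo j')) = f (olo i') :&: f' (olo j'))%VS.
    rewrite -!capvA [(f' (oup j') :&: _)%VS]capvA [(f' (oup j') :&: f _)%VS]capvC !capvA.
    by rewrite (capv_idPl (lo_up _ ff)) -capvA (capv_idPr (lo_up _ ff')).
  by move: gd E; rewrite /bot /top /= -iE -jE; lia.
have -> : (f i :&: f' j)%VS = top (i', j') by rewrite /top iE jE.
rewrite -gs !subv_add; apply/and3P; split.
- by apply: (sumv_sup (i', j')) => //=; rewrite iE jE !oupE !leqnn.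
- rewrite /= -jE; apply: subv_trans s1 _; apply/subv_sumP => p /andP[pi pj].
  by apply: (sumv_sup p) => //; rewrite pj iE oupE ltnS ltnW.
- rewrite /= -iE; apply: subv_trans s2 _; apply/subv_sumP => p /andP[pi pj].
  by apply: (sumv_sup p) => //; rewrite pi jE oupE ltnS ltnW.
Qed.

End Choice.

(** The marked vector is put at the head because [in_orbit] writes w as the sum of the vectors of
    index 0 in the marked cells. *)
Let marked_choice (v : 'I_m * 'I_n -> V) (D : {set 'I_m * 'I_n}) p : seq V :=
  if p \in D then v p :: vbasis (top p :\: (bot p + <[v p]>)) else vbasis (top p :\: bot p).

Let marked_choiceP v (D : {set 'I_m * 'I_n}) : (forall p, p \in D -> (v p \in top p) && (v p \notin bot p)) ->
  adapted_choice (marked_choice v D).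
Proof.
move=> vD p; rewrite -/(top p) -/(bot p) /marked_choice; case: ifP => pD; last first.
  rewrite (span_basis (vbasisP _)) size_tuple addv_diff (addv_idPl (bot_top p)); split=> //.
  by have := dimv_cap_compl (top p) (bot p); rewrite (capv_idPr (bot_top p)) addnC.
have /andP[vt vb] := vD p pD.
have st : (bot p + <[v p]> <= top p)%VS by rewrite subv_add bot_top -memvE.
rewrite span_cons (span_basis (vbasisP _)) /= size_tuple; split.
  by rewrite -addvA addvC -addvA addv_diff (addv_idPl st).
have := dimv_cap_compl (top p) (bot p + <[v p]>); rewrite (capv_idPr st) dim_add_line //.
by move=> <-; rewrite !addSn addnC.
Qed.

Variable w : V.

Let le_pos p q := (p.1 <= q.1)%N && (p.2 <= q.2)%N.

(* First split w along any adapted basis; then absorb every component into a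
   maximal position of the support. *)
Lemma marked_vectors : exists (v : 'I_m * 'I_n -> V) (D : {set 'I_m * 'I_n}),
  [/\ forall p, p \in D -> (v p \in top p) && (v p \notin bot p),
      w = \sum_(p in D) v p &
      forall p q, p \in D -> q \in D -> le_pos p q -> p = q].
Proof.
pose b0 := marked_choice (fun=> 0) finset.set0.
have g0 : adapted_choice b0 by apply: marked_choiceP => p; rewrite inE.
have [sub _] := sub_span_choice g0 ord_max ord_max.
have /memv_sumP[u uP wE] : w \in (\sum_(p : 'I_m * 'I_n | (p.1 < m)%N && (p.2 < n)%N) <<b0 p>>)%VS.
  by apply: (subvP sub); rewrite (flag_full ff) // (flag_full ff') // capvv memvf.
(* The components lie in complements of [bot p], so a nonzero component at p is not in [bot p]. *)
have {}uP p : u p \in (top p :\: bot p)%VS.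
  by have := uP p; rewrite !ltn_ord /= /b0 /marked_choice inE (span_basis (vbasisP _)); apply.
have {}wE : w = \sum_p u p by rewrite wE; apply: eq_bigl => p; rewrite !ltn_ord.
pose N p := u p != 0.
pose D := [set p | N p && [forall q, N q && le_pos p q ==> (q == p)]].
have antisym p q : le_pos p q -> le_pos q p -> p = q.
  case: p q => [p1 p2] [q1 q2]; rewrite /le_pos /= => h h'.
  by congr pair; apply: val_inj => /=; lia.
have trans p q r : le_pos p q -> le_pos q r -> le_pos p r.
  by case: p q r => [p1 p2] [q1 q2] [r1 r2]; rewrite /le_pos /=; lia.
have ex p : N p -> exists2 q, q \in D & le_pos p q.
  move=> Np; have Pp : N p && le_pos p p by rewrite Np /le_pos !leqnn.
  case: (arg_maxnP (P := fun q => N q && le_pos p q) (fun q : 'I_m * 'I_n => q.1 + q.2)%N Pp) => q /andP[Nq pq] qmax.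
  exists q => //; rewrite inE Nq; apply/forallP => r; apply/implyP => /andP[Nr qr].
  have := qmax r; rewrite Nr (trans _ _ _ pq qr) => /(_ isT) rq; apply/eqP.
  case: q r qr rq {Nq Nr pq qmax} => [q1 q2] [r1 r2]; rewrite /le_pos /= => h h'.
  by congr pair; apply: val_inj => /=; lia.
pose dl p := odflt p [pick q in D | le_pos p q].
have dlP p : N p -> dl p \in D /\ le_pos p (dl p).
  move=> /ex[q qD pq]; rewrite /dl; case: pickP => [r /andP[]//|/(_ q)].
  by rewrite qD pq.
pose v q := \sum_(p | N p && (dl p == q)) u p.
exists v, D; split.
- move=> p pD; have := pD; rewrite inE => /andP[Np /forallP mx].
  have dp : dl p = p.
    have [dD pd] := dlP p Np; move: dD (mx (dl p)); rewrite inE => /andP[-> _].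
    by rewrite pd => /eqP.
  rewrite /v (bigD1 p) ?Np ?dp ?eqxx //=.
  set r := \sum_(_ | _) _.
  (* What p absorbs comes from positions q below p and different from it, where [top q] is contained
     in one of the two summands of [bot p]; modulo [bot p] only [u p] remains. *)
  have rb : r \in bot p.
    apply: memv_suml => q /andP[/andP[Nq /eqP dq] qp].
    have [_ qlp] := dlP q Nq; rewrite dq in qlp.
    have [ql|ql] : (q.1 < p.1)%N \/ (q.2 < p.2)%N.
    + apply/orP; apply: contraNT qp => h; apply/eqP/antisym => //.
      by move: h; rewrite /le_pos negb_or -!leqNgt.
    + have : (top q <= f (olo p.1) :&: f' (oup p.2))%VS.
        by apply: capvS; apply: flagS => //; rewrite ?oupE ?ltnS //; case/andP: qlp.
      move/subvP/(_ (u q)); rewrite (subvP (diffvSl _ _) _ (uP q)) => /(_ isT).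
      by apply/subvP/addvSl.
    + have : (top q <= f (oup p.1) :&: f' (olo p.2))%VS.
        by apply: capvS; apply: flagS => //; rewrite ?oupE ?ltnS //; case/andP: qlp.
      move/subvP/(_ (u q)); rewrite (subvP (diffvSl _ _) _ (uP q)) => /(_ isT).
      by apply/subvP/addvSr.
  apply/andP; split.
    by apply: memvD; [apply: (subvP (diffvSl _ _) _ (uP p))|apply: (subvP (bot_top p))].
  rewrite rpredDr //; apply: contra Np => ub.
  have : u p \in ((top p :\: bot p) :&: bot p)%VS by rewrite memv_cap uP.
  by rewrite capv_diff memv0.
- rewrite wE (bigID N) /= [X in _ + X]big1 ?addr0; last by move=> p; rewrite negbK => /eqP.
  by apply: partition_big => p /dlP[].
- move=> p q; rewrite !inE => /andP[_ /forallP mx] /andP[Nq _] pq.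
  by move: (mx q); rewrite Nq pq => /eqP.
Qed.

Lemma orbit_exists : exists2 x : label m n d, decorated x & in_orbit x f f' w.
Proof.
have [v [D [vD wE anti]]] := marked_vectors.
have gb := marked_choiceP vD; set b := marked_choice v D in gb.
have btop p : (<<b p>> <= top p)%VS.
  by have [<- _] := gb p; apply: addvSl.
have sumb : (\sum_p size (b p) = d)%N.
  have [_] := sub_span_choice gb ord_max ord_max.
  rewrite (flag_full ff) // (flag_full ff') // capvv dimvf /dim /= mul1n => h; apply: etrans h.
  by apply: eq_bigl => p; rewrite !ltn_ord.
have sb p : (size (b p) <= d)%N by rewrite -[leqRHS]sumb (bigD1 p) //= leq_addr.
pose x : label m n d := (\matrix_(i, j) inord (size (b (i, j))), D).
have xE p : x.1 p.1 p.2 = size (b p) :> nat by rewrite mxE inordK; case: p => //= i j; rewrite ltnS.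
pose e (c : 'I_m * 'I_n * nat) := nth 0 (b c.1) c.2.
have spanE (P : pred ('I_m * 'I_n)) :
    <<[seq e c | c : 'I_m * 'I_n * nat <- cells x.1 & P c.1]>>%VS = (\sum_(p | P p) <<b p>>)%VS.
  apply/eqP; rewrite eqEsubv; apply/andP; split.
    apply/span_subvP => u /mapP[[p s]]; rewrite mem_filter mem_cells xE => /andP[Pp sp] ->.
    by apply: (subvP (sumv_sup p _ (subvv _))) => //; apply/memv_span/mem_nth.
  apply/subv_sumP => p Pp; apply: sub_span => u vp.
  apply/mapP; exists (p, index u (b p)); last by rewrite /e nth_index.
  by rewrite mem_filter Pp mem_cells xE index_mem.
have dx : decorated x.
  apply/and3P; split.
  - rewrite pair_big; apply/eqP/(etrans _ sumb)/eq_bigr => p _; exact: xE.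
  - apply/forall_inP => p pD; rewrite xE /b /marked_choice; move: (pD); rewrite /x /= => ->.
    by [].
  - apply/forall_inP => p pD; apply/forall_inP => q qD; apply/implyP => pq.
    have n1 : ~~ le_pos p q by apply: contraNN pq => /(anti p q pD qD) ->.
    have n2 : ~~ le_pos q p by apply: contraNN pq => /(anti q p qD pD) ->.
    case: p q n1 n2 {pq pD qD} => [p1 p2] [q1 q2]; rewrite /le_pos /=; lia.
have ord_lt k (i : 'I_k) : (i < @ord_max k)%N by apply: ltn_ord.
exists x => //; exists e; split.
- have := spanE predT; rewrite filter_predT => E.
  rewrite basisEdim size_map size_cells_decorated // dimvf /dim /= mul1n leqnn andbT E.
  have [+ _] := sub_span_choice gb ord_max ord_max.
  rewrite (flag_full ff) // (flag_full ff') // capvv => h; apply: subv_trans h _.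
  by apply/subv_sumP => p _; apply: (sumv_sup p).
- move=> i; rewrite (spanE (fun p => p.1 < i)%N); apply/eqP; rewrite eqEsubv; apply/andP; split.
    have [+ _] := sub_span_choice gb i ord_max; rewrite (flag_full ff') // capvf => h.
    apply: subv_trans h _; apply/subv_sumP => p /andP[pi _]; exact: (sumv_sup p).
  apply/subv_sumP => p pi; apply: subv_trans (btop p) _; apply: subv_trans (capvSl _ _) _.
  by apply: flagS => //; rewrite oupE.
- move=> j; rewrite (spanE (fun p => p.2 < j)%N); apply/eqP; rewrite eqEsubv; apply/andP; split.
    have [+ _] := sub_span_choice gb ord_max j; rewrite (flag_full ff) // capfv => h.
    apply: subv_trans h _; apply/subv_sumP => p /andP[_ pi]; exact: (sumv_sup p).
  apply/subv_sumP => p pi; apply: subv_trans (btop p) _; apply: subv_trans (capvSr _ _) _.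
  by apply: flagS => //; rewrite oupE.
- by rewrite wE; apply: eq_bigr => p pD; rewrite /e /b /marked_choice /= pD.
Qed.

End Existence.

(** Every triple lies in some orbit and labels are separated by their types. From here on,
    membership in an orbit is a condition on dimensions and memberships instead of the existence of
    a basis. *)
Lemma in_orbitP (F : finFieldType) m n d (x : label m n d) (f : chain F m d) (f' : chain F n d) w :
  decorated x ->
  in_orbit x f f' w <-> [/\ is_flag f, is_flag f' & ftype f f' w = ltype x].
Proof.
move=> dx; split => [xo|[ff ff' tx]].
  by have /andP[ff ff'] := in_orbit_flag xo; split => //; apply: in_orbit_ftype.
have [y dy yo] := orbit_exists ff ff' w.
by rewrite (ltype_inj dx dy) // -tx (in_orbit_ftype dy yo).
Qed.

(** * Refinements of partial flags *)

Definition coarse (F : finFieldType) (m m' d : nat) (a : 'I_m.+1 -> 'I_m'.+1) (f : chain F m' d) :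
  chain F m d := [ffun i => f (a i)].

Definition restr (m n m' n' : nat) (a : 'I_m.+1 -> 'I_m'.+1) (b : 'I_n.+1 -> 'I_n'.+1)
  (t : otype m' n') : otype m n := [ffun p : 'I_m.+1 * 'I_n.+1 => t (a p.1, b p.2)].

Definition is_coarse (m m' : nat) (a : 'I_m.+1 -> 'I_m'.+1) : bool :=
  [&& a ord0 == 0%N :> nat, a ord_max == m' :> nat &
      [forall i : 'I_m.+1, forall j : 'I_m.+1, (i <= j)%N ==> (a i <= a j)%N]].

(** The dimension vector doubles as a coarsening map: f is the coarsening along [dims f] of each of
    its complete refinements. *)
Definition dims (F : finFieldType) (m d : nat) (f : chain F m d) : {ffun 'I_m.+1 -> 'I_d.+1} :=
  [ffun i => inord (\dim (f i))].

Lemma ftype_coarse (F : finFieldType) (m n m' n' d : nat) a b (f : chain F m' d) (f' : chain F n' d) w :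
  ftype (coarse a f : chain F m d) (coarse b f' : chain F n d) w = restr a b (ftype f f' w).
Proof. by apply/ffunP => p; rewrite !ffunE. Qed.

Lemma dim_le (F : finFieldType) d (U : {vspace 'rV[F]_d}) : (\dim U <= d)%N.
Proof. by apply: leq_trans (dimvS (subvf U)) _; rewrite dimvf /dim /= mul1n. Qed.

Lemma dim_full (F : finFieldType) d : \dim (fullv : {vspace 'rV[F]_d}) = d.
Proof. by rewrite dimvf /dim /= mul1n. Qed.

Lemma dimsE (F : finFieldType) m d (f : chain F m d) i : dims f i = \dim (f i) :> nat.
Proof. by rewrite ffunE inordK // ltnS dim_le. Qed.

Lemma dims_coarse (F : finFieldType) (m d : nat) (f : chain F m d) : is_flag f -> is_coarse (dims f).
Proof.
move=> ff; apply/and3P; split.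
- by rewrite dimsE (flag0 ff) ?dimv0.
- by rewrite dimsE (flag_full ff) ?dim_full.
- by do 2!apply/forallP => ?; apply/implyP => ij; rewrite !dimsE dimvS // flagS.
Qed.

Lemma coarse_flag (F : finFieldType) (m m' d : nat) (a : 'I_m.+1 -> 'I_m'.+1) (f : chain F m' d) :
  is_coarse a -> is_flag f -> is_flag (coarse a f).
Proof.
case/and3P=> /eqP a0 /eqP am /forallP mono ff; apply/and3P; split.
- by rewrite ffunE (flag0 ff).
- by rewrite ffunE (flag_full ff).
- apply/forallP => i; apply/forallP => j; apply/implyP => ij; rewrite !ffunE flagS //.
  by have /forallP/(_ j)/implyP/(_ ij) := mono i.
Qed.

Lemma complete_dim (F : finFieldType) d (f : chain F d d) i : is_complete_flag f -> \dim (f i) = i.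
Proof. by case/andP=> _ /forallP/(_ i)/eqP. Qed.

Lemma complete_flag (F : finFieldType) d (f : chain F d d) : is_complete_flag f -> is_flag f.
Proof. by case/andP. Qed.

Lemma dims_coarse_complete (F : finFieldType) m d (b : {ffun 'I_m.+1 -> 'I_d.+1}) (f : chain F d d) :
  is_complete_flag f -> dims (coarse b f) = b.
Proof. by move=> cf; apply/ffunP => i; apply: val_inj; rewrite /= dimsE ffunE complete_dim. Qed.

(** * The action of GL_d and its transitivity on orbits *)

Section Action.
Variables (F : finFieldType) (d : nat) (M : 'M[F]_d).
Hypothesis uM : M \in unitmx.

Definition move_chain m (f : chain F m d) : chain F m d :=
  [ffun i => (linfun (mulmxr M) @: f i)%VS].

Lemma mem_move m (f : chain F m d) i v : (v \in move_chain f i) = (v *m invmx M \in f i).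
Proof.
rewrite ffunE; apply/memv_imgP/idP => [[u uf ->]|vf]; first by rewrite lfunE /= mulmxK.
by exists (v *m invmx M); rewrite // lfunE /= mulmxKV.
Qed.

Lemma move_ker : lker (linfun (mulmxr M : 'rV[F]_d -> 'rV[F]_d)) == 0%VS.
Proof. by apply/lker0P => u v; rewrite !lfunE /=; apply: (can_inj (mulmxK uM)). Qed.

Lemma ftype_move m n (f : chain F m d) (f' : chain F n d) w :
  ftype (move_chain f) (move_chain f') (w *m M) = ftype f f' w.
Proof.
apply/ffunP => -[i j]; rewrite !ffunE /=; congr pair.
  rewrite -[RHS](limg_dim_eq (f := linfun (mulmxr M))); last by rewrite (eqP move_ker) capv0.
  congr (\dim _); apply/vspaceP => v; rewrite memv_cap; apply/andP/memv_imgP.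
    case=> /memv_imgP[u uf ->] /memv_imgP[u' uf' uu']; exists u => //.
    by have /lker0P inj := move_ker; rewrite memv_cap uf (inj _ _ uu').
  by case=> u; rewrite memv_cap => /andP[uf uf'] ->; rewrite !memv_img.
rewrite -limgD; apply/memv_imgP/idP => [[u uf]|h]; last by exists w; rewrite ?lfunE.
by rewrite lfunE /= => /(can_inj (mulmxK uM)) ->.
Qed.

Lemma move_coarse m m' (a : 'I_m.+1 -> 'I_m'.+1) (f : chain F m' d) :
  move_chain (coarse a f) = coarse a (move_chain f).
Proof. by apply/ffunP => i; rewrite !ffunE. Qed.

Lemma move_flag m (f : chain F m d) : is_flag f -> is_flag (move_chain f).
Proof.
move=> ff; apply/and3P; split.
- by rewrite ffunE (flag0 ff) // limg0.
- rewrite ffunE (flag_full ff) //; apply/eqP/vspaceP => v; rewrite memvf.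
  by apply/memv_imgP; exists (v *m invmx M); rewrite ?memvf // lfunE /= mulmxKV.
- by do 2!apply/forallP => ?; apply/implyP => ij; rewrite !ffunE limgS // flagS.
Qed.

End Action.

(** Both triples have frames with the rows, columns and marks of the same label; the change of
    coordinates between the frames is the group element. *)
Lemma orbit_transitive (F : finFieldType) m n d (x : label m n d)
    (f g : chain F m d) (f' g' : chain F n d) w u : decorated x ->
  in_orbit x f f' w -> in_orbit x g g' u ->
  exists2 M, M \in unitmx & [/\ move_chain M g = f, move_chain M g' = f' & u *m M = w].
Proof.
move=> dx /(frame_orbit dx)[P [[uP hf hf'] wP]] /(frame_orbit dx)[Q [[uQ hg hg'] wQ]].
have uM : Q *m invmx P \in unitmx by rewrite unitmx_mul uQ unitmx_inv.
have sE v : supp Q (v *m invmx (Q *m invmx P)) = supp P v.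
  by apply/setP => k; rewrite !inE -{2}(mulmxKV uP Q) [_ *m (_ *m P)]mulmxA mulmxKV.
exists (Q *m invmx P) => //; split.
- by apply/ffunP => i; apply/vspaceP => v; rewrite mem_move // hf hg sE.
- by apply/ffunP => i; apply/vspaceP => v; rewrite mem_move // hf' hg' sE.
- by rewrite mulmxA; apply: (can_inj (mulmxK uP)); rewrite mulmxKV //; apply/rowP => k; rewrite wP wQ.
Qed.

(** Some point of the finer orbit coarsens into the orbit of x, and transitivity moves it above the
    given triple. *)
Lemma lift_orbit (F : finFieldType) m n m' n' d a b (x : label m n d) (x' : label m' n' d)
    (f : chain F m d) (f' : chain F n d) w :
  decorated x -> decorated x' -> is_coarse a -> is_coarse b ->
  restr a b (ltype x') = ltype x -> in_orbit x f f' w ->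
  exists (g : chain F m' d) (g' : chain F n' d),
    [/\ in_orbit x' g g' w, coarse a g = f & coarse b g' = f'].
Proof.
move=> dx dx' ca cb tx xo; have [g [g' [u go]]] := orbit_nonempty F dx'.
have /(in_orbitP _ _ _ dx')[fg fg' tg] := go.
have cgo : in_orbit x (coarse a g) (coarse b g') u.
  by apply/(in_orbitP _ _ _ dx); rewrite ftype_coarse tg !coarse_flag.
have [M uM [gf gf' uw]] := orbit_transitive dx xo cgo.
exists (move_chain M g), (move_chain M g'); split.
- by apply/(in_orbitP _ _ _ dx'); rewrite -uw ftype_move // !move_flag.
- by rewrite -move_coarse.
- by rewrite -move_coarse.
Qed.

(** * The complete refinement of g closest to a complete flag f *)

Section CanonicalRefinement.
Variables (F : finFieldType) (k d : nat) (f : chain F d d) (g : chain F k d).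
Hypotheses (hd : (0 < d)%N) (cf : is_complete_flag f) (fg : is_flag g).

Let ff : is_flag f := complete_flag cf.
Let b := dims g.
Let W (i : 'I_k) (l : 'I_d.+1) : {vspace 'rV[F]_d} := (g (olo i) + f l :&: g (oup i))%VS.

(* Through dimensions only, this says that every step of the second flag is
   g_i + (f_l :&: g_(i+1)) for some i and l, where g is its coarsening along c:
   it is the refinement of g closest to f. *)
Definition canonical_type (c : {ffun 'I_k.+1 -> 'I_d.+1}) (t : otype d d) : bool :=
  [forall j : 'I_d.+1, exists i : 'I_k, exists l : 'I_d.+1,
    [&& (t (l, c (oup i))).1 == (t (l, j)).1 &
        (c (olo i) + (t (l, c (oup i))).1 == j + (t (l, c (olo i))).1)%N]].

Let dimW i l : (\dim (W i l) + \dim (f l :&: g (olo i)) = b (olo i) + \dim (f l :&: g (oup i)))%N.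
Proof.
have lu : (g (olo i) <= g (oup i))%VS by apply: flagS => //; rewrite oupE.
rewrite dimsE -[RHS]dimv_sum_cap; congr (_ + \dim _)%N.
by rewrite capvA [(g _ :&: f l)%VS]capvC -capvA (capv_idPl lu).
Qed.

Let subW i l : (g (olo i) <= W i l <= g (oup i))%VS.
Proof.
rewrite addvSl subv_add capvSr andbT /=.
by apply: flagS => //; rewrite oupE.
Qed.

(** Within one step of g the spaces grow with l, and different steps are separated by a space of g.
    In this chain a space is determined by its dimension. *)
Let W_total i l i' l' : (W i l <= W i' l')%VS || (W i' l' <= W i l)%VS.
Proof.
wlog ii : i l i' l' / (i <= i')%N.
  by move=> h; case/orP: (leq_total i i') => ii; [|rewrite orbC]; apply: h.
move: ii; rewrite leq_eqVlt => /orP[/eqP/val_inj <-|ii].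
  by case/orP: (leq_total l l') => ll; apply/orP; [left|right]; apply: addvS => //;
    apply: capvS => //; apply: flagS.
apply/orP; left; have /andP[_ h1] := subW i l; have /andP[h2 _] := subW i' l'.
by apply: subv_trans (subv_trans h1 _) h2; apply: flagS; rewrite // oupE.
Qed.

Let gW_total i i' l : (W i' l <= g i)%VS || (g i <= W i' l)%VS.
Proof.
have /andP[h1 h2] := subW i' l; apply/orP; case: (leqP i i') => ii; [right|left].
  by apply: subv_trans h1; apply: flagS.
by apply: subv_trans h2 _; apply: flagS; rewrite // oupE.
Qed.

Let sub_dim (U U' : {vspace 'rV[F]_d}) : (U <= U')%VS || (U' <= U)%VS ->
  (\dim U <= \dim U')%N -> (U <= U')%VS.
Proof.
by case/orP=> // h h'; have /eqP <- : U' == U by rewrite eqEdim h h'.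
Qed.

Let eq_dim (U U' : {vspace 'rV[F]_d}) : (U <= U')%VS || (U' <= U)%VS ->
  \dim U = \dim U' -> U = U'.
Proof. by move=> h e; apply/eqP; rewrite eqEsubv; apply/andP; split; apply: sub_dim; rewrite ?e // orbC. Qed.

Lemma canonical_refinement_eq (g1 : chain F d d) u : is_complete_flag g1 -> coarse b g1 = g ->
  canonical_type b (ftype f g1 u) ->
  forall j : 'I_d.+1, exists2 il : 'I_k * 'I_d.+1, \dim (W il.1 il.2) = j & g1 j = W il.1 il.2.
Proof.
move=> cg1 bg1 /forallP h j; have /existsP[i /existsP[l /andP[]]] := h j.
have gE i' : g1 (b i') = g i' by rewrite -[in RHS]bg1 [RHS]ffunE.
rewrite !ftype_dim !gE => /eqP h1 /eqP h2; exists (i, l) => /=.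
  by apply/eqP; rewrite -(eqn_add2r (\dim (f l :&: g (olo i)))) dimW h2.
have e : \dim (W i l) = \dim (g1 j).
  by apply/eqP; rewrite complete_dim // -(eqn_add2r (\dim (f l :&: g (olo i)))) dimW h2.
have fg1 := complete_flag cg1.
apply/esym/eqP; rewrite eqEdim e leqnn andbT subv_add; apply/andP; split.
  rewrite -gE; apply: flagS => //; rewrite /b dimsE -(complete_dim j cg1) -e dimvS //.
  by case/andP: (subW i l).
rewrite -gE; suff -> : (f l :&: g1 (b (oup i)) = f l :&: g1 j)%VS by apply: capvSr.
apply: eq_dim; last by rewrite -h1 gE.
by case/orP: (leq_total (b (oup i)) j) => h'; apply/orP; [left|right]; apply: capvS => //; apply: flagS.
Qed.

Lemma canonical_refinement_uniq (g1 g2 : chain F d d) u :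
  is_complete_flag g1 -> coarse b g1 = g -> canonical_type b (ftype f g1 u) ->
  is_complete_flag g2 -> coarse b g2 = g -> canonical_type b (ftype f g2 u) -> g1 = g2.
Proof.
move=> c1 b1 t1 c2 b2 t2; apply/ffunP => j.
have [[i l] /= d1 ->] := canonical_refinement_eq c1 b1 t1 j.
have [[i' l'] /= d2 ->] := canonical_refinement_eq c2 b2 t2 j.
by apply: eq_dim; rewrite ?d1 ?d2.
Qed.

(** As f is complete, the dimension of [W i l] rises by at most one when l does, so for fixed i it
    takes every value between the dimensions of g_i and g_(i+1). *)
Let W_onto (j : 'I_d.+1) : exists il : 'I_k * 'I_d.+1, \dim (W il.1 il.2) == j.
Proof.
have [i /andP[i1 i2]] : exists i : 'I_k, (b (olo i) <= j <= b (oup i))%N.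
  pose P (i : 'I_k.+1) := (j <= b i)%N.
  have Pm : P ord_max by rewrite /P /b dimsE (flag_full fg) // dim_full -ltnS.
  case: (arg_minnP (fun i : 'I_k.+1 => (i : nat)) Pm) => i Pi imin.
  case: (unliftP ord0 i) => [i' iE|i0].
    exists i'; rewrite -[oup i']iE [(j <= _)%N]Pi andbT leqNgt; apply/negP => h.
    by have := imin (olo i') (ltnW h); rewrite iE /= /bump leq0n add1n ltnn.
  (* The least index is 0 here, which forces j = 0, and the first step of g serves; it exists
     because the space is not zero. *)
  have k0 : (0 < k)%N.
    rewrite lt0n; apply/eqP => k0; have := dim_full F d.
    rewrite -(flag_full fg (i := ord0)) ?k0 // (flag0 fg) // dimv0 => d0.
    by move: hd; rewrite -d0.
  exists (Ordinal k0); apply/andP; split.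
    by rewrite /b dimsE (flag0 fg) // dimv0.
  move: Pi; rewrite /P /b i0 dimsE (flag0 fg) // dimv0 leqn0 => /eqP ->.
  by rewrite leq0n.
pose P (l : 'I_d.+1) := (j <= \dim (W i l))%N.
have Pm : P ord_max.
  rewrite /P /W (flag_full ff) // capfv.
  have /addv_idPr -> : (g (olo i) <= g (oup i))%VS by apply: flagS => //; rewrite oupE.
  by rewrite -dimsE.
case: (arg_minnP (fun l : 'I_d.+1 => (l : nat)) Pm) => l Pl lmin.
exists (i, l) => /=; rewrite eqn_leq [(j <= _)%N]Pl andbT.
case: (unliftP ord0 l) => [l' lE|->]; last first.
  by rewrite /W (flag0 ff) // cap0v addv0 -dimsE.
have -> : l = oup l' by [].
have lo : (\dim (W i (olo l')) < j)%N.
  rewrite ltnNge; apply/negP => h.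
  by have := lmin (olo l') h; rewrite lE /= /bump leq0n add1n ltnn.
apply: leq_trans lo.
have step U : (\dim (f (oup l') :&: U) <= (\dim (f (olo l') :&: U)).+1)%N.
  have lu : (f (olo l') <= f (oup l'))%VS by apply: flagS => //; rewrite oupE.
  have := dimv_sum_cap (f (oup l') :&: U) (f (olo l')).
  rewrite [X in (_ + \dim X)%N]capvC capvA (capv_idPl lu) complete_dim //.
  have : (\dim (f (oup l') :&: U + f (olo l')) <= oup l')%N.
    by rewrite -(complete_dim (oup l') cf) dimvS // subv_add capvSl.
  rewrite oupE /=.
  by move: (\dim (_ + _)) (\dim (f (oup l') :&: U)) (\dim (f (olo l') :&: U)) => x y z; lia.
have := step (g (oup i)); have := dimW i (oup l'); have := dimW i (olo l').
have : (\dim (f (olo l') :&: g (olo i)) <= \dim (f (oup l') :&: g (olo i)))%N.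
  by apply: dimvS; apply: capvS => //; apply: flagS; rewrite // oupE.
move: (\dim (f (oup l') :&: g (oup i))) (\dim (f (oup l') :&: g (olo i))) => x1 x2.
move: (\dim (f (olo l') :&: g (oup i))) (\dim (f (olo l') :&: g (olo i))) => x3 x4.
by move: (\dim (W _ _)) (\dim (W _ _)) => x5 x6; lia.
Qed.

Lemma canonical_refinement : exists g1 : chain F d d,
  [/\ is_complete_flag g1, coarse b g1 = g & forall u, canonical_type b (ftype f g1 u)].
Proof.
pose s j := xchoose (W_onto j).
have sE j : \dim (W (s j).1 (s j).2) = j by apply/eqP/(xchooseP (W_onto j)).
pose g1 : chain F d d := [ffun j => W (s j).1 (s j).2].
have dg1 j : \dim (g1 j) = j by rewrite ffunE.
have g1W i l j : (W i l <= g1 j)%VS || (g1 j <= W i l)%VS by rewrite ffunE.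
have gE i : g1 (b i) = g i.
  by apply: eq_dim; rewrite ?dg1 ?dimsE // ffunE.
have cg1 : is_complete_flag g1.
  apply/andP; split; last by apply/forallP => j; rewrite dg1.
  apply/and3P; split.
  - by rewrite -dimv_eq0 dg1.
  - by rewrite eqEdim subvf dg1 dim_full /=.
  - apply/forallP => i; apply/forallP => j; apply/implyP => ij.
    by apply: sub_dim; rewrite ?dg1 // ffunE.
exists g1; split => //; first by apply/ffunP => i; rewrite ffunE gE.
move=> u; apply/forallP => j; apply/existsP; exists (s j).1; apply/existsP; exists (s j).2.
rewrite !ftype_dim !gE -[in X in _ && X](sE j) dimW eqxx andbT.
have -> : g1 j = W (s j).1 (s j).2 by rewrite ffunE.
apply/eqP; congr (\dim _); apply/eqP; rewrite eqEsubv !subv_cap !capvSl addvSr /=.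
by apply: subv_trans (capvSr _ _) _; case/andP: (subW (s j).1 (s j).2).
Qed.

End CanonicalRefinement.

Lemma complete_flag_exists (F : finFieldType) d : exists f : chain F d d, is_complete_flag f.
Proof.
pose f : chain F d d := [ffun i : 'I_d.+1 => <<take i (vbasis (fullv : {vspace 'rV[F]_d}))>>%VS].
have sb : size (vbasis (fullv : {vspace 'rV[F]_d})) = d by rewrite size_tuple dim_full.
have df i : \dim (f i) = i.
  rewrite ffunE; have := basis_free (vbasisP (fullv : {vspace 'rV[F]_d})).
  rewrite -{1}(cat_take_drop i (vbasis _)) => /catl_free /eqP ->.
  by rewrite size_take_min sb; apply/minn_idPl; rewrite -ltnS.
exists f; apply/andP; split; last by apply/forallP => i; rewrite df.
apply/and3P; split.
- by rewrite -dimv_eq0 df.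
- by rewrite eqEdim subvf df dim_full /=.
- apply/forallP => i; apply/forallP => j; apply/implyP => ij; rewrite !ffunE.
  by apply: sub_span => v; rewrite -(take_takel _ ij) => /mem_take.
Qed.

Lemma refinement_exists (F : finFieldType) k d (g : chain F k d) : (0 < d)%N -> is_flag g ->
  exists2 f : chain F d d, is_complete_flag f & coarse (dims g) f = g.
Proof.
move=> hd fg; have [f cf] := complete_flag_exists F d.
by have [g1 [c1 b1 _]] := canonical_refinement hd cf fg; exists g1.
Qed.

(** * Convolution of generic families on complete flags *)

Definition gfamily (m n d : nat) :=
  forall F : finFieldType, chain F m d -> chain F n d -> 'rV[F]_d -> algC.

(** The middle chain is unrestricted, which makes associativity unconditional; the families that
    occur vanish off the relevant flags. *)
Definition cnv m k n d (g : gfamily m k d) (h : gfamily k n d) : gfamily m n d :=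
  fun F f f' w => \sum_(f'' : chain F k d) \sum_u g F f f'' u * h F f'' f' (w - u).

Arguments cnv {m k n d} g h F f f' w.

Lemma cnvA m k l n d (g : gfamily m k d) (h : gfamily k l d) (e : gfamily l n d) F f f' w :
  cnv (cnv g h) e F f f' w = cnv g (cnv h e) F f f' w.
Proof.
transitivity (\sum_(p : chain F l d * chain F k d) \sum_(r : 'rV[F]_d * 'rV[F]_d)
    g F f p.2 r.2 * h F p.2 p.1 (r.1 - r.2) * e F p.1 f' (w - r.1)).
  rewrite -(pair_bigA _ (fun p p' => \sum_r g F f p' r.2 * h F p' p (r.1 - r.2) * e F p f' (w - r.1))) /=.
  apply: eq_bigr => p _; rewrite exchange_big /=.
  rewrite -(pair_bigA _ (fun r r' => \sum_p' g F f p' r' * h F p' p (r - r') * e F p f' (w - r))) /=.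
  apply: eq_bigr => r _; rewrite mulr_suml exchange_big /=.
  by apply: eq_bigr => p' _; rewrite mulr_suml; apply: eq_bigr.
rewrite -(pair_bigA _ (fun p p' => \sum_r g F f p' r.2 * h F p' p (r.1 - r.2) * e F p f' (w - r.1))) /=.
rewrite exchange_big; apply: eq_bigr => p' _; rewrite exchange_big /=.
rewrite -(pair_bigA _ (fun r r' => \sum_p g F f p' r' * h F p' p (r - r') * e F p f' (w - r))) /=.
rewrite exchange_big; apply: eq_bigr => r' _.
rewrite mulr_sumr exchange_big; apply: eq_bigr => p _ /=; rewrite mulr_sumr.
rewrite (reindex_inj (addIr r')) /=; apply: eq_bigr => r _.
by rewrite addrK mulrA opprD addrA addrAC.
Qed.

Lemma eq_cnv m k n d (g g' : gfamily m k d) (h h' : gfamily k n d) F f f' w :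
  (forall f f' w, g F f f' w = g' F f f' w) -> (forall f f' w, h F f f' w = h' F f f' w) ->
  cnv g h F f f' w = cnv g' h' F f f' w.
Proof.
by move=> gg hh; apply: eq_bigr => ? _; apply: eq_bigr => ? _; rewrite gg hh.
Qed.

Section CompleteFlags.
Variable d : nat.
Implicit Types (g h : gfamily d d d).

Definition completes F (f f' : chain F d d) := is_complete_flag f && is_complete_flag f'.

(** These are the families of functions that come from elements of MH. *)
Definition generic g := exists Phi : otype d d -> laurent, forall F f f' w,
  g F f f' w = if completes f f' then evF F (Phi (ftype f f' w)) else 0.

(** Unlike genericity of g, this is stable under convolution at once, by associativity; it needs a
    computation on generators only. *)
Definition lmul g := forall h, generic h -> generic (cnv g h).

(** The Laurent polynomial is chosen type by type; a type realized by no pair of complete flags gets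
    0. *)
Lemma genericP g :
  (forall F f f' w, ~~ @completes F f f' -> g F f f' w = 0) ->
  (forall F0 (f0 f0' : chain F0 d d) w0, completes f0 f0' ->
   exists a, forall F f f' w, @completes F f f' -> ftype f f' w = ftype f0 f0' w0 ->
     g F f f' w = evF F a) -> generic g.
Proof.
move=> g0 gt.
have ex t : exists a, forall F f f' w, @completes F f f' -> ftype f f' w = t -> g F f f' w = evF F a.
  have [[F0 [f0 [f0' [w0 [c0 <-]]]]]|no] := pselect (exists F (f f' : chain F d d) w, completes f f' /\ ftype f f' w = t).
    exact: gt.
  by exists 0 => F f f' w c ft; case: no; exists F, f, f', w.
have [Phi PhiP] := choice ex; exists Phi => F f f' w; case: ifPn; last exact: g0.
by move=> c; apply: PhiP.
Qed.

Lemma eq_generic g g' : (forall F f f' w, g F f f' w = g' F f f' w) -> generic g -> generic g'.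
Proof. by move=> gg [Phi PhiP]; exists Phi => F f f' w; rewrite -gg. Qed.

Lemma eq_lmul g g' : (forall F f f' w, g F f f' w = g' F f f' w) -> lmul g -> lmul g'.
Proof.
by move=> gg gl h /gl; apply: eq_generic => F f f' w; apply: eq_cnv => // ? ? ?.
Qed.

Lemma lmul_cnv g g' : lmul g -> lmul g' -> lmul (cnv g g').
Proof. by move=> gl gl' h /gl'/gl; apply: eq_generic => F f f' w; rewrite cnvA. Qed.

Lemma generic_sum (I : finType) (P : pred I) (a : I -> laurent) (g : I -> gfamily d d d) :
  (forall i, P i -> generic (g i)) ->
  generic (fun F f f' w => \sum_(i | P i) evF F (a i) * g i F f f' w).
Proof.
move=> gg; have /choice[Phi PhiP] i : exists Phi : otype d d -> laurent, P i -> forall F f f' w,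
    g i F f f' w = if completes f f' then evF F (Phi (ftype f f' w)) else 0.
  by case Pi: (P i); [have [Phi PhiP] := gg i Pi; exists Phi|exists (fun=> 0)].
exists (fun t => \sum_(i | P i) a i * Phi i t) => F f f' w.
case: ifPn => c; last by rewrite big1 // => i Pi; rewrite PhiP // (negPf c) mulr0.
by rewrite rmorph_sum; apply: eq_bigr => i Pi; rewrite rmorphM /= PhiP // c.
Qed.

Lemma lmul_sum (I : finType) (P : pred I) (a : I -> laurent) (g : I -> gfamily d d d) :
  (forall i, P i -> lmul (g i)) ->
  lmul (fun F f f' w => \sum_(i | P i) evF F (a i) * g i F f f' w).
Proof.
move=> gl h gh; apply: eq_generic (generic_sum a (fun i Pi => gl i Pi h gh)) => F f f' w /=.
rewrite /cnv; under eq_bigr do rewrite mulr_sumr.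
rewrite exchange_big; apply: eq_bigr => p _ /=; under eq_bigr do rewrite mulr_sumr.
rewrite exchange_big; apply: eq_bigr => r _ /=; rewrite mulr_suml.
by apply: eq_bigr => i _; rewrite mulrA.
Qed.

Lemma lmul_sub g g' : lmul g -> lmul g' -> lmul (fun F f f' w => g F f f' w - g' F f f' w).
Proof.
move=> gl gl'; apply: eq_lmul (lmul_sum (P := predT) (fun i : bool => if i then 1 else -1)
  (g := fun i : bool => if i then g else g') _) => [F f f' w|[] //].
by rewrite big_bool /= rmorph1 rmorphN1 mul1r mulN1r.
Qed.

End CompleteFlags.

(** * Frames of two complete flags and their relative position *)

Lemma rank_perm d (r : 'I_d -> nat) :
  (forall i : 'I_d.+1, #|[set k | (r k < i)%N]| = i) -> exists s : 'S_d, forall k, r k = s k.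
Proof.
move=> hr; have rd k : (r k < d)%N.
  have /eqP E : [set k | (r k < d)%N] == [set: 'I_d].
    by rewrite eqEcard subsetT cardsT card_ord (hr ord_max) /=.
  by move: (in_setT k); rewrite -E inE.
have ri : injective (fun k => Ordinal (rd k)).
  move=> k l [kl]; apply/eqP/contraT => nkl.
  have := hr (oup (Ordinal (rd k))); have := hr (olo (Ordinal (rd k))).
  rewrite oupE /= => h1 h2.
  have : (#|[set k; l] :|: [set j | (r j < r k)%N]| <= (r k).+1)%N.
    rewrite -[leqRHS]h2; apply/subset_leq_card/fintype.subsetP => j; rewrite !inE.
    by case/orP => [/orP[]/eqP ->|/ltnW]; rewrite -?kl.
  rewrite cardsU cards2 nkl /= h1; have -> : [set k; l] :&: [set j | (r j < r k)%N] = finset.set0.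
    apply/setP => j; rewrite !inE; apply/negP => /andP[/orP[]/eqP ->]; by rewrite -?kl ltnn.
  by rewrite cards0 subn0; lia.
by exists (perm ri) => k; rewrite permE.
Qed.

Lemma frame_reindex (F : finFieldType) d m n row col (f : chain F m d) (f' : chain F n d) P (s : 'S_d) :
  frame row col f f' P ->
  frame (row \o s) (col \o s) f f' (col_perm s P) /\
  forall (v : 'rV[F]_d) k, (v *m col_perm s P) 0 k = (v *m P) 0 (s k).
Proof.
have cE (v : 'rV[F]_d) k : (v *m col_perm s P) 0 k = (v *m P) 0 (s k).
  by rewrite !mxE; apply: eq_bigr => j _; rewrite mxE.
have sE (v : 'rV[F]_d) (r : 'I_d -> nat) i : (supp (col_perm s P) v \subset [set k | ((r \o s) k < i)%N])
    = (supp P v \subset [set k | (r k < i)%N]).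
  apply/fintype.subsetP/fintype.subsetP => h k; last by rewrite inE cE => vk; have := h (s k); rewrite !inE; apply.
  by have := h (s^-1%g k); rewrite !inE cE /= permKV.
case=> uP hf hf'; split=> //; split.
- by rewrite col_permE unitmx_mul uP unitmx_perm.
- by move=> i v; rewrite hf sE.
- by move=> j v; rewrite hf' sE.
Qed.

Section IdFrame.
Variable d : nat.
Implicit Types (p : 'S_d) (D S : {set 'I_d}).

(** The basis is numbered along f, so that the relative position of the flags is the single
    permutation p. *)
Definition idframe (F : finFieldType) p (f f' : chain F d d) P :=
  frame (fun k : 'I_d => k : nat) (fun k : 'I_d => p k : nat) f f' P.

Definition idtype p D : otype d d := cotype d d (fun k : 'I_d => k : nat) (fun k : 'I_d => p k : nat) D.

Lemma idframe_ftype (F : finFieldType) p (f f' : chain F d d) P w :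
  idframe p f f' P -> ftype f f' w = idtype p (supp P w).
Proof. exact: frame_ftype. Qed.

(** The source of uniformity in q: p and D are fixed by one triple over one field, and every triple
    of that type over any field has coordinates in which its vector is the indicator of D. *)
Lemma complete_frame (F0 : finFieldType) (f0 f0' : chain F0 d d) w0 : completes f0 f0' ->
  exists p D, forall (F : finFieldType) (f f' : chain F d d) w,
    completes f f' -> ftype f f' w = ftype f0 f0' w0 ->
    exists P, idframe p f f' P /\ forall k, (w *m P) 0 k = (k \in D)%:R.
Proof.
case/andP=> c0 c0'; have [x dx xo] := orbit_exists (complete_flag c0) (complete_flag c0') w0.
have [P0 [[uP0 hf0 hf0'] _]] := frame_orbit dx xo.
have [s sE] : exists s : 'S_d, forall k, lrow x k = s k.
  apply: rank_perm => i; rewrite -(dim_frame uP0 (hf0 i)); by apply: complete_dim.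
have [t tE] : exists t : 'S_d, forall k, lcol x k = t k.
  apply: rank_perm => i; rewrite -(dim_frame uP0 (hf0' i)); by apply: complete_dim.
exists (s^-1 * t)%g, [set k | (s^-1)%g k \in lmark x] => F f f' w /andP[c c'] ft.
have {}xo : in_orbit x f f' w.
  by apply/(in_orbitP _ _ _ dx); rewrite (complete_flag c) (complete_flag c') ft (in_orbit_ftype dx xo).
have [P [fP wP]] := frame_orbit dx xo.
have [fP' PE] := frame_reindex (s^-1)%g fP.
exists (col_perm (s^-1)%g P); split; last by move=> k; rewrite PE wP [in RHS]inE.
case: fP' => uP' hf hf'; split=> // i v.
  rewrite hf; congr (_ \subset (mem (pred_of_set _))).
  by apply/setP => k; rewrite !inE /= sE permKV.
rewrite hf'; congr (_ \subset (mem (pred_of_set _))).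
by apply/setP => k; rewrite !inE /= tE permM.
Qed.

Lemma idframe_exists (F : finFieldType) (f f' : chain F d d) : completes f f' ->
  exists p P, idframe p f f' P.
Proof.
move=> c; have [p [D h]] := complete_frame 0 c.
by have [P [fP _]] := h F f f' 0 c erefl; exists p, P.
Qed.

(* Only the order ideal generated by the support can be read off the type. *)
Definition shadow p D : {set 'I_d} := [set k : 'I_d | [exists l in D, (k <= l)%N && (p k <= p l)%N]].

Lemma shadow_sub p D S :
  (forall k l : 'I_d, (k <= l)%N -> (p k <= p l)%N -> l \in S -> k \in S) ->
  (shadow p D \subset S) = (D \subset S).
Proof.
move=> idS; apply/fintype.subsetP/fintype.subsetP => h k kD.
  by apply: h; rewrite inE; apply/exists_inP; exists k; rewrite ?leqnn.
by move: kD; rewrite inE => /exists_inP[l /h lS /andP[kl pkl]]; apply: idS lS.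
Qed.

Lemma shadow_ideal p D (k l : 'I_d) : (k <= l)%N -> (p k <= p l)%N -> l \in shadow p D -> k \in shadow p D.
Proof.
move=> kl pkl; rewrite !inE => /exists_inP[j jD /andP[lj plj]].
by apply/exists_inP; exists j; rewrite // (leq_trans kl) ?(leq_trans pkl).
Qed.

Lemma idtype_mem p D k : (idtype p D (olo k, olo (p k))).2 = (k \notin shadow p D).
Proof.
rewrite ffunE inE /= negb_exists_in; apply: eq_forallb_in => l _.
by rewrite negb_and -!ltnNge.
Qed.

Lemma idtype_shadow p D : idtype p D = idtype p (shadow p D).
Proof.
apply/ffunP => -[i j]; rewrite !ffunE /=; congr pair.
apply/forall_inP/forall_inP => h k.
  by rewrite inE => /exists_inP[l lD /andP[kl pkl]]; have := h l lD; lia.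
by move=> kD; apply: h; rewrite inE; apply/exists_inP; exists k; rewrite ?leqnn.
Qed.

(** The column p k is where the box counts for the first k and the first k + 1 rows begin to
    differ. *)
Lemma idtype_inj p p' D D' : (forall i j, (idtype p D (i, j)).1 = (idtype p' D' (i, j)).1) -> p = p'.
Proof.
have key (q q' : 'S_d) E E' : (forall i j, (idtype q E (i, j)).1 = (idtype q' E' (i, j)).1) ->
    forall k, (q' k <= q k)%N.
  move=> h k; rewrite leqNgt; apply/negP => lt.
  have S (r : 'S_d) B i j : (idtype r B (i, j)).1 = #|[set k : 'I_d | (k < i)%N && (r k < j)%N]| by rewrite ffunE.
  have := h (olo k) (oup (q k)); have := h (oup k) (oup (q k)); rewrite !S.
  have -> : [set l : 'I_d | (l < oup k)%N && (q' l < oup (q k))%N] = [set l : 'I_d | (l < olo k)%N && (q' l < oup (q k))%N].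
    apply/setP => l; rewrite !inE !oupE oloE ltnS [in LHS]leq_eqVlt; case: eqP => //= /val_inj ->.
    by rewrite ltnS (leqNgt (q' k)) lt andbF.
  move=> <-; have -> : [set l : 'I_d | (l < oup k)%N && (q l < oup (q k))%N] = k |: [set l : 'I_d | (l < olo k)%N && (q l < oup (q k))%N].
    apply/setP => l; rewrite !inE !oupE oloE ltnS [in LHS]leq_eqVlt -val_eqE /=; case: eqP => //= /val_inj ->.
    by rewrite ltnSn.
  by rewrite cardsU1 inE oloE ltnn /=; lia.
move=> h; apply/permP => k; apply: val_inj; apply/eqP; rewrite eqn_leq.
by rewrite (key _ _ _ _ h) (key _ _ _ _ (fun i j => esym (h i j))).
Qed.

End IdFrame.

(** * Shears and the flags adjacent to a given one *)

Section Shear.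
Variables (F : finFieldType) (d : nat) (k l : 'I_d) (P : 'M[F]_d).
Hypothesis kl : k != l.

(** The coordinates after replacing the basis vector e_l by e_l + c e_k. *)
Definition shear (c : F) : 'M[F]_d := P *m (1%:M - c *: delta_mx l k).

Lemma shearE c (v : 'rV[F]_d) j :
  (v *m shear c) 0 j = (v *m P) 0 j - (if j == k then c * (v *m P) 0 l else 0).
Proof.
rewrite mulmxA; move: (v *m P) => u.
rewrite mulmxBr mulmx1 -scalemxAr !mxE (bigD1 l) //= big1 ?addr0; last first.
  by move=> i il; rewrite mxE (negPf il) mulr0.
by rewrite mxE eqxx /=; case: eqP => _; rewrite ?mulr1 ?mulr0.
Qed.

Lemma shear_unit c : P \in unitmx -> shear c \in unitmx.
Proof.
move=> uP; rewrite unitmx_mul uP.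
have E : (1%:M - c *: delta_mx l k) *m (1%:M + c *: delta_mx l k) = 1%:M :> 'M[F]_d.
  rewrite mulmxDr mulmxBl mul1mx mulmx1 mulmxBl mul1mx -scalemxAl -scalemxAr mul_delta_mx_0 //.
  by rewrite !scaler0 subr0 subrK.
by have [] := mulmx1_unit E.
Qed.

Lemma supp_shear c (v : 'rV[F]_d) (S : {set 'I_d}) : (k \notin S -> l \notin S \/ c = 0) ->
  (supp (shear c) v \subset S) = (supp P v \subset S).
Proof.
move=> kS; apply/supp_subP/supp_subP => h j jS.
  have := h j jS; rewrite shearE; case: eqP => [jk|_]; last by rewrite subr0.
  subst j; case: (kS jS) => [lS|->]; last by rewrite mul0r subr0.
  by have := h l lS; rewrite shearE eq_sym (negPf kl) subr0 => ->; rewrite mulr0 subr0.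
rewrite shearE h //; case: eqP => [jk|_]; last by rewrite subr0.
by subst j; case: (kS jS) => [lS|->]; rewrite ?mul0r ?subr0 // h // mulr0 subr0.
Qed.

End Shear.

Section Adjacent.
Variables (d : nat) (k0 k1 : 'I_d).
Hypothesis k01 : k1 = k0.+1 :> nat.
Implicit Types (p : 'S_d) (D S : {set 'I_d}).

(** The step that changes. With basis vectors numbered from 0 it has dimension k0 + 1 = k1. *)
Let i1 : 'I_d.+1 := olo k1.
Let k0_k1 : k0 != k1. Proof. by rewrite -val_eqE /= k01 neq_ltn ltnSn. Qed.
Let k1_k0 : (k1 == k0) = false. Proof. by rewrite eq_sym (negPf k0_k1). Qed.

Definition adjacent (F : finFieldType) (f g : chain F d d) : bool :=
  [&& is_complete_flag g, [forall j, (j != i1) ==> (f j == g j)] & f i1 != g i1].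

Section Pencil.
Variables (F : finFieldType) (f : chain F d d) (P : 'M[F]_d).
Hypotheses (cf : is_complete_flag f) (uP : P \in unitmx).
Hypothesis hf : forall i v, (v \in f i) = (supp P v \subset [set k : 'I_d | (k < i)%N]).

Let line (c : F) : 'rV[F]_d := (delta_mx 0 k1 + c *: delta_mx 0 k0) *m invmx P.

(* The complete flags adjacent to f at i1 form a projective line minus the
   point f i1, parametrized by c. *)
Definition pencil (c : F) : chain F d d :=
  [ffun j => if j == i1 then (f (olo k0) + <[line c]>)%VS else f j].

Let lineE c k : (line c *m P) 0 k = (k == k1)%:R + c * (k == k0)%:R.
Proof. by rewrite mulmxKV // !mxE eqxx. Qed.

Lemma pencil_neq c j : j != i1 -> pencil c j = f j.
Proof. by move=> h; rewrite ffunE (negPf h). Qed.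

Lemma mem_pencil c v : (v \in pencil c i1) =
  [forall k : 'I_d, (k1 < k)%N ==> ((v *m P) 0 k == 0)] && ((v *m P) 0 k0 == c * (v *m P) 0 k1).
Proof.
rewrite ffunE eqxx; apply/memv_addP/andP.
  case=> u + [_ /vlineP[t ->] ->]; rewrite hf => /supp_subP uS.
  have u0 (k : 'I_d) : (k0 <= k)%N -> (u *m P) 0 k = 0 by move=> h; apply: uS; rewrite inE -leqNgt.
  have E k : ((u + t *: line c) *m P) 0 k = (u *m P) 0 k + t * ((k == k1)%:R + c * (k == k0)%:R).
    by rewrite mulmxDl -scalemxAl mxE; congr (_ + _); rewrite mxE lineE.
  split; last first.
    rewrite !E !u0 ?k01 // !eqxx ?(negPf k0_k1) ?k1_k0; apply/eqP; rewrite /=; ring.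
  apply/forallP => k; apply/implyP => k1k; rewrite E u0; last by rewrite ltnW // -?k01 ltnW //; lia.
  have -> : (k == k1) = false by apply/negbTE; rewrite -val_eqE /= neq_ltn k1k orbT.
  have -> : (k == k0) = false by apply/negbTE; rewrite -val_eqE /=; lia.
  by rewrite mulr0 addr0 mulr0 addr0.
case=> /forallP h /eqP h0; pose t := (v *m P) 0 k1.
exists (v - t *: line c); last first.
  by exists (t *: line c); [apply: memvZ; apply: memv_line|rewrite subrK].
rewrite hf; apply/supp_subP => k; rewrite inE -leqNgt oloE => k0k.
rewrite mulmxBl -scalemxAl mxE [X in _ + X]mxE [X in - X]mxE lineE -/t.
case: (eqVneq k k1) => [->|nk1].
  by rewrite k1_k0 /= /t; ring.
case: (eqVneq k k0) => [->|nk0]; first by rewrite h0 /= /t; ring.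
have /eqP -> : (v *m P) 0 k == 0 by have /implyP := h k; apply; move: nk0 nk1; rewrite -!val_eqE /=; lia.
by rewrite /=; ring.
Qed.

Let line_notin c : line c \notin f (olo k0).
Proof.
rewrite hf; apply/negP => /supp_subP/(_ k1); rewrite inE oloE k01 -leqNgt leqnSn => /(_ isT).
by rewrite lineE eqxx ?(negPf k0_k1) ?k1_k0 mulr0 addr0 => /eqP; rewrite oner_eq0.
Qed.

Lemma pencil_complete c : is_complete_flag (pencil c).
Proof.
have fff := complete_flag cf.
have lo_p : (f (olo k0) <= pencil c i1)%VS by rewrite ffunE eqxx addvSl.
have p_up : (pencil c i1 <= f (oup k1))%VS.
  apply/subvP => v; rewrite mem_pencil hf => /andP[/forallP h _]; apply/supp_subP => k.
  by rewrite inE oupE ltnS -ltnNge => /(implyP (h k))/eqP.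
have dp j : \dim (pencil c j) = j.
  have [->|nj] := eqVneq j i1; last by rewrite pencil_neq // complete_dim.
  by rewrite ffunE eqxx dim_add_line ?line_notin // complete_dim // !oloE k01.
apply/andP; split; last by apply/forallP => j; rewrite dp.
apply/and3P; split.
- by rewrite -dimv_eq0 dp.
- by rewrite eqEdim subvf dp dim_full /=.
- apply/forallP => i; apply/forallP => j; apply/implyP => ij.
  have [iE|ni] := eqVneq i i1; have [jE|nj] := eqVneq j i1.
  + by rewrite iE jE.
  + rewrite iE (pencil_neq c nj); apply: subv_trans p_up _; apply: flagS => //.
    by rewrite oupE; move: ij nj; rewrite iE -val_eqE /=; lia.
  + rewrite jE (pencil_neq c ni); apply: subv_trans lo_p; apply: flagS => //.
    by move: ij ni; rewrite jE -val_eqE /= k01; lia.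
  + by rewrite !pencil_neq // flagS.
Qed.

Lemma pencil_inj : injective pencil.
Proof.
move=> c c' cc; have : line c \in pencil c' i1.
  by rewrite -cc ffunE eqxx; apply: subvP (addvSr _ _) _ (memv_line _).
rewrite mem_pencil => /andP[_]; rewrite !lineE !eqxx ?(negPf k0_k1) ?k1_k0 /= => /eqP h.
move: h; rewrite add0r mulr0 addr0 !mulr1.
by [].
Qed.

Lemma pencil_adjacent g : adjacent f g = (g \in codom pencil).
Proof.
apply/and3P/codomP => [[cg /forallP fg nfg]|[c ->]]; last first.
  split; first exact: pencil_complete.
    by apply/forallP => j; apply/implyP => nj; rewrite pencil_neq.
  apply/negP => /eqP fp; have : line c \in f i1.
    by rewrite fp ffunE eqxx; apply: subvP (addvSr _ _) _ (memv_line _).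
  rewrite hf => /supp_subP/(_ k1); rewrite inE oloE ltnn => /(_ isT)/eqP.
  by rewrite lineE eqxx k1_k0 mulr0 addr0 oner_eq0.
have {}fg j : j != i1 -> f j = g j by move=> nj; have /implyP/(_ nj)/eqP := fg j.
have [v vg vf] : exists2 v, v \in g i1 & v \notin f i1.
  apply/subvPn; apply: contraNN nfg => gf; rewrite eq_sym eqEdim gf.
  by rewrite !complete_dim //=.
have lo : f (olo k0) = g (olo k0) by apply: fg; rewrite -val_eqE /= k01 neq_ltn ltnSn.
have up : f (oup k1) = g (oup k1) by apply: fg; rewrite -(inj_eq (@ord_inj _)) oupE oloE neq_ltn ltnSn orbT.
have lo_g : (g (olo k0) <= g i1)%VS by apply: flagS; [exact: complete_flag|rewrite oloE /= k01].
have g_up : (g i1 <= g (oup k1))%VS by apply: flagS; [exact: complete_flag|rewrite oupE oloE].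
have vk (k : 'I_d) : (k1 < k)%N -> (v *m P) 0 k = 0.
  move=> h; have : v \in f (oup k1) by rewrite up; apply: subvP vg.
  by rewrite hf => /supp_subP; apply; rewrite inE oupE -leqNgt.
have v1 : (v *m P) 0 k1 != 0.
  apply: contraNneq vf => v1; rewrite hf; apply/supp_subP => k; rewrite inE oloE -leqNgt leq_eqVlt.
  by case/orP=> [/eqP/ord_inj <-//|/vk].
(* The parameter is the slope of any vector of the new step that is not in the old one. *)
pose c := (v *m P) 0 k0 / (v *m P) 0 k1.
have vp : v \in pencil c i1.
  rewrite mem_pencil /c divfK // eqxx andbT; apply/forallP => k; apply/implyP => /vk ->.
  exact: eqxx.
have vlo : v \notin f (olo k0).
  apply: contra v1; rewrite hf => /supp_subP -> //.
  by rewrite inE oloE k01 -leqNgt leqnSn.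
have dimlv : \dim (f (olo k0) + <[v]>) = i1.
  by rewrite dim_add_line // complete_dim // !oloE k01.
exists c; apply/ffunP => j; have [->|nj] := eqVneq j i1; last by rewrite pencil_neq ?fg.
have cp := pencil_complete c.
transitivity (f (olo k0) + <[v]>)%VS; last symmetry.
  apply/esym/eqP; rewrite eqEdim dimlv complete_dim // leqnn andbT subv_add -memvE vg andbT.
  by rewrite lo.
apply/esym/eqP; rewrite eqEdim dimlv complete_dim // leqnn andbT subv_add -memvE vp andbT.
by rewrite ffunE eqxx addvSl.
Qed.

Lemma pencil_sum (H : chain F d d -> algC) : \sum_(g | adjacent f g) H g = \sum_c H (pencil c).
Proof.
rewrite (eq_bigl (mem (pencil @: [set: F]))); last first.
  move=> g; rewrite pencil_adjacent; apply/codomP/imsetP => [[c ->]|[c _ ->]]; last by exists c.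
  by exists c; rewrite ?inE.
rewrite big_imset /=; last by move=> ? ? _ _; apply: pencil_inj.
by apply: eq_bigl => c; rewrite inE.
Qed.

Variables (p : 'S_d) (f' : chain F d d).
Hypothesis hf' : forall j v, (v \in f' j) = (supp P v \subset [set k : 'I_d | (p k < j)%N]).

Let swap_lt i (k : 'I_d) : i != i1 -> (tperm k0 k1 k < i)%N = (k < i)%N.
Proof.
rewrite -val_eqE /= => ni; case: tpermP => [->|->|//]; rewrite k01; move: ni; rewrite k01; lia.
Qed.

(** When e_k0 enters f' before e_k1, replacing e_k1 by e_k1 + c e_k0 does not disturb f'. The new
    vector spans the line of the new step, so k0 and k1 exchange rows. *)
Lemma pencil_frame_ascent c : (p k0 < p k1)%N || (c == 0) ->
  frame (fun k => tperm k0 k1 k : nat) (fun k => p k : nat) (pencil c) f' (shear k0 k1 P c).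
Proof.
move=> pc; split; first exact: shear_unit.
- move=> i v; have [->|ni] := eqVneq i i1.
    have E (k : 'I_d) : (k \notin [set k : 'I_d | (tperm k0 k1 k < i1)%N]) = (k == k0) || (k1 < k)%N.
      rewrite inE oloE -leqNgt -val_eqE /=; case: tpermP => [->|->|/eqP n0 /eqP n1]; rewrite ?k01; [lia|lia|].
      by move: n0 n1; rewrite -!val_eqE /= k01; lia.
    rewrite mem_pencil; apply/andP/supp_subP => [[/forallP h /eqP h0] k|h].
      rewrite E shearE => /orP[/eqP ->|lk]; first by rewrite eqxx h0 subrr.
      have -> : (k == k0) = false by apply/negbTE; rewrite -val_eqE /=; lia.
      by rewrite subr0; apply/eqP/(implyP (h k)).
    split; last first.
      by have := h k0; rewrite E eqxx shearE eqxx => /(_ isT)/eqP; rewrite subr_eq0.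
    apply/forallP => k; apply/implyP => lk; have := h k; rewrite E lk orbT shearE => /(_ isT).
    have -> : (k == k0) = false by apply/negbTE; rewrite -val_eqE /=; lia.
    by rewrite subr0 => ->.
  rewrite pencil_neq // hf supp_shear //.
    by congr (_ \subset (mem (pred_of_set _))); apply/setP => k; rewrite !inE swap_lt.
  by move=> h; left; move: h; rewrite !inE !(swap_lt _ ni); move: ni; rewrite -val_eqE /= k01; lia.
- move=> j v; rewrite hf' supp_shear //; rewrite !inE => h.
  by case/orP: pc => [pc|/eqP ->]; [left; lia|right].
Qed.

(** Here the line is rescaled to e_k0 + c^-1 e_k1, which replaces e_k0 without disturbing f'; the
    relative position does not change. *)
Lemma pencil_frame_descent c : (p k1 < p k0)%N -> c != 0 ->
  idframe p (pencil c) f' (shear k1 k0 P c^-1).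
Proof.
move=> pc c0; have k10 : k1 != k0 by rewrite eq_sym.
split; first exact: shear_unit.
- move=> i v; have [->|ni] := eqVneq i i1.
    rewrite mem_pencil; apply/andP/supp_subP => [[/forallP h /eqP h0] k|h].
      rewrite inE oloE -leqNgt leq_eqVlt shearE -val_eqE /= eq_sym => /orP[kk|lk].
        by rewrite kk (ord_inj (eqP kk)) h0 mulKf // subrr.
      have -> : (k == k1 :> nat) = false by lia.
      by rewrite subr0; apply/eqP/(implyP (h k)).
    split.
      apply/forallP => k; apply/implyP => lk; have := h k; rewrite inE oloE -leqNgt (ltnW lk) shearE => /(_ isT).
      have -> : (k == k1) = false by apply/negbTE; rewrite -val_eqE /=; lia.
      by rewrite subr0 => ->.
    have := h k1; rewrite inE oloE ltnn shearE eqxx => /(_ isT)/eqP; rewrite subr_eq0 => /eqP ->.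
    by rewrite mulVKf.
  rewrite pencil_neq // hf supp_shear //; rewrite !inE => h; left.
  by move: h ni; rewrite -val_eqE /= k01; lia.
- by move=> j v; rewrite hf' supp_shear //; rewrite !inE => h; left; lia.
Qed.

End Pencil.
End Adjacent.

(** The scalars other than 0 and 1 number q - 2; here q enters the structure constants of the simple
    generators. *)
Lemma sum_two_points (F : finFieldType) (G : bool -> bool -> algC) :
  \sum_(c : F) G (c == 0) (c == 1) =
  G true false + G false true + (#|F|%:R - 2) * G false false.
Proof.
have E (H : F -> algC) : \sum_c H c = H 0 + (H 1 + \sum_(c | (c != 0) && (c != 1)) H c).
  by rewrite (bigD1 0) //= (bigD1 1) ?oner_neq0.
have cF : #|F|%:R = 1 + (1 + \sum_(c : F | (c != 0) && (c != 1)) 1) :> algC.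
  by rewrite -(E (fun=> 1)) sumr_const.
rewrite E eqxx oner_eq0 eq_sym oner_eq0 eqxx -addrA; congr (_ + (_ + _)).
rewrite cF addrA [1 + 1 + _]addrC addrK mulr_suml; apply: eq_bigr => c /andP[c0 c1].
by rewrite (negPf c0) (negPf c1) mul1r.
Qed.

Lemma cnv_deltal m k n d (g : gfamily m k d) (h : gfamily k n d) F (A : pred (chain F k d)) f f' w :
  (forall f'' u, g F f f'' u = (A f'' && (u == 0))%:R) ->
  cnv g h F f f' w = \sum_(f'' | A f'') h F f'' f' w.
Proof.
move=> gE; rewrite [RHS]big_mkcond; apply: eq_bigr => f'' _.
rewrite (bigD1 0) //= big1 ?addr0; last by move=> u u0; rewrite gE (negPf u0) andbF mul0r.
by rewrite gE eqxx andbT subr0; case: (A _); rewrite ?mul1r ?mul0r.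
Qed.

Lemma cnv_deltar m k n d (g : gfamily m k d) (h : gfamily k n d) F (A : pred (chain F k d)) f f' w :
  (forall f'' u, h F f'' f' u = (A f'' && (u == 0))%:R) ->
  cnv g h F f f' w = \sum_(f'' | A f'') g F f f'' w.
Proof.
move=> hE; rewrite [RHS]big_mkcond; apply: eq_bigr => f'' _.
rewrite (bigD1 w) //= big1 ?addr0; last first.
  by move=> u uw; rewrite hE subr_eq0 eq_sym (negPf uw) andbF mulr0.
by rewrite hE subrr eqxx andbT; case: (A _); rewrite ?mulr1 ?mulr0.
Qed.

(** * The generators T_s and X_a *)

Section Multipliers.
Variable d : nat.
Implicit Types (p : 'S_d) (D S : {set 'I_d}).

Section Simple.
Variables (k0 k1 : 'I_d).
Hypothesis k01 : k1 = k0.+1 :> nat.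

Definition simple_fam : gfamily d d d :=
  fun F f g u => ((is_complete_flag f && adjacent k1 f g) && (u == 0))%:R.

Lemma simple_cnv h F (f f' : chain F d d) w : is_complete_flag f ->
  cnv simple_fam h F f f' w = \sum_(g | adjacent k1 f g) h F g f' w.
Proof.
move=> cf; rewrite (@cnv_deltal _ _ _ _ _ _ _ (fun g => is_complete_flag f && adjacent k1 f g)) //.
by apply: eq_bigl => g; rewrite cf.
Qed.

Lemma lmul_simple : lmul simple_fam.
Proof.
move=> h [Phi PhiP]; apply: genericP => [F f f' w|F0 f0 f0' w0 c00].
  move=> nc; apply: big1 => g _; apply: big1 => u _; rewrite /simple_fam PhiP.
  case: ifP => [/andP[_ cf']|_]; last by rewrite mulr0.
  by move: nc; rewrite /completes cf' andbT => /negPf ->; rewrite mul0r.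
have [p [D pD]] := complete_frame w0 c00.
(* Since w has coordinates 0 and 1, its support after the shear depends on c only through the truth
   values z of c = 0 and o of c = 1. The sets [up] and [down] are the supports in the two frames of
   the adjacent flag. *)
pose up z o := [set k | if k == k0 then (if k1 \in D then (if k0 \in D then ~~ o else ~~ z) else k0 \in D) else k \in D].
pose down (o : bool) := [set k | if k == k1 then (if k0 \in D then (if k1 \in D then ~~ o else true) else k1 \in D) else k \in D].
pose t (z o : bool) : otype d d := if (p k0 < p k1)%N || z
  then cotype d d (fun k => tperm k0 k1 k : nat) (fun k => p k : nat) (up z o)
  else idtype p (down o).
exists (Phi (t true false) + Phi (t false true) + (laurent_q - 2%:R) * Phi (t false false)).
move=> F f f' w /andP[cf cf'] ft; have [P [fP wP]] := pD F f f' w (introT andP (conj cf cf')) ft.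
case: (fP) => uP hf hf'.
rewrite simple_cnv // (pencil_sum k01 cf uP hf).
rewrite (eq_bigr (fun c => evF F (Phi (t (c == 0) (c == 1))))); last first.
  move=> c _; rewrite PhiP /completes (pencil_complete k01 cf uP hf) cf' /=; congr (evF F (Phi _)).
  rewrite /t; case: ifPn => [pc|].
    rewrite (frame_ftype w (pencil_frame_ascent k01 cf uP hf hf' pc)); congr cotype.
    apply/setP => k; rewrite !inE shearE !wP; case: (k =P k0) => [->|_]; last first.
      by rewrite subr0; case: (k \in D); rewrite ?oner_eq0 ?eqxx.
    case: (k1 \in D); case: (k0 \in D); rewrite /= ?mulr1 ?mulr0 ?subr0 ?sub0r ?oppr_eq0 ?oner_eq0 ?eqxx //.
    by rewrite subr_eq0 eq_sym.
  rewrite negb_or -leqNgt leq_eqVlt => /andP[/orP[/eqP/ord_inj/perm_inj kk|pk] c0].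
    by move: k01; rewrite kk; lia.
  rewrite (idframe_ftype w (pencil_frame_descent k01 cf uP hf hf' pk c0)); congr idtype.
  apply/setP => k; rewrite !inE shearE !wP; case: (k =P k1) => [->|_]; last first.
    by rewrite subr0; case: (k \in D); rewrite ?oner_eq0 ?eqxx.
  case: (k1 \in D); case: (k0 \in D); rewrite /= ?mulr1 ?mulr0 ?subr0 ?sub0r ?oppr_eq0 ?invr_eq0 ?oner_eq0 ?eqxx //.
  by rewrite subr_eq0 eq_sym -(inj_eq invr_inj) invrK invr1.
rewrite (sum_two_points F (fun z o => evF F (Phi (t z o)))) !rmorphD /= rmorphM rmorphB /= evF_q rmorph_nat.
by [].
Qed.

End Simple.

Definition vector_fam (a : 'I_d.+1) : gfamily d d d :=
  fun F f g u => (is_complete_flag f && (f == g) && (u \in f a))%:R.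

Lemma vector_cnv a h F (f f' : chain F d d) w : is_complete_flag f ->
  cnv (vector_fam a) h F f f' w = \sum_(u | u \in f a) h F f f' (w - u).
Proof.
move=> cf; rewrite /cnv (bigD1 f) //= [X in _ + X]big1 ?addr0.
  rewrite [RHS]big_mkcond; apply: eq_bigr => u _; rewrite /vector_fam cf eqxx /=.
  by case: ifP; rewrite ?mul1r ?mul0r.
move=> g gf; apply: big1 => u _; rewrite /vector_fam eq_sym (negPf gf) andbF mul0r.
by [].
Qed.

Lemma lmul_vector a : lmul (vector_fam a).
Proof.
move=> h [Phi PhiP]; apply: genericP => [F f f' w|F0 f0 f0' w0 c00].
  move=> nc; apply: big1 => g _; apply: big1 => u _; rewrite /vector_fam PhiP.
  case: ifP => [/andP[cg cf']|_]; last by rewrite mulr0.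
  case: eqP => [fg|]; last by rewrite andbF mul0r.
  by move: nc; rewrite /completes fg cg cf'.
have [p [D pD]] := complete_frame w0 c00.
(* The number of k-th coordinates of u for which w - u has support S at k: free below a, while from
   a on u has coordinate 0 and S must agree with D. *)
pose wt S (k : 'I_d) : laurent := if (k < a)%N then (if k \in S then laurent_q - 1 else 1) else ((k \in S) == (k \in D))%:R.
exists (\sum_(S : {set 'I_d}) (\prod_k wt S k) * Phi (idtype p S)).
move=> F f f' w cc ft; have [P [fP wP]] := pD F f f' w cc ft.
case: (fP) => uP hf hf'; have /andP[cf cf'] := cc.
rewrite vector_cnv // (eq_bigr (fun u => evF F (Phi (idtype p (supp P (w - u)))))); last first.
  by move=> u _; rewrite PhiP cc (idframe_ftype _ fP).
rewrite (partition_big (fun u => supp P (w - u)) predT) //= rmorph_sum.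
apply: eq_bigr => S _; rewrite rmorphM /=.
rewrite (eq_bigr (fun=> evF F (Phi (idtype p S)))) => [|u /andP[_ /eqP ->] //].
rewrite sumr_const -[LHS]mulr_natl; congr (_ * _).
pose A (k : 'I_d) : pred F := [pred y | ((k < a)%N || (y == 0)) && (((k \in D)%:R - y != 0) == (k \in S))].
have subE u k : ((w - u) *m P) 0 k = (k \in D)%:R - (u *m P) 0 k.
  by rewrite mulmxBl mxE wP; congr (_ + _); rewrite mxE.
transitivity (#|[set u : 'rV[F]_d | [forall k, A k ((u *m P) 0 k)]]|%:R : algC).
  congr (_%:R); apply: eq_card => u; rewrite [LHS]unfold_in inE /= hf.
  apply/andP/forallP => [[/supp_subP ua /eqP SE] k|hA].
    rewrite /A /=; apply/andP; split.
      by case: (ltnP k a) => //= ak; rewrite ua // inE -leqNgt.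
    by rewrite -SE inE subE.
  split.
    apply/supp_subP => k; rewrite inE -leqNgt => ak.
    by have := hA k; rewrite /A /= ltnNge ak /= => /andP[/eqP].
  by apply/eqP/setP => k; have := hA k; rewrite /A /= inE subE => /andP[_ /eqP].
rewrite card_frame // natr_prod rmorph_prod; apply: eq_bigr => k _.
have cardA (B : pred F) : (forall y, A k y = B y) -> #|A k| = #|B| by move=> AB; apply: eq_card => y; apply: AB.
rewrite /wt; case: (ltnP k a) => ka.
  case kS: (k \in S); last first.
    rewrite (cardA (pred1 (k \in D)%:R)) ?card1 ?rmorph1 // => y; rewrite /A /= ka kS /=.
    by rewrite eqbF_neg negbK subr_eq0 eq_sym.
  rewrite (cardA (predC1 (k \in D)%:R)) => [|y]; last by rewrite /A /= ka kS /= eqb_id subr_eq0 eq_sym.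
  rewrite rmorphB rmorph1 /= evF_q cardC1 -subn1 natrB //.
  by apply/card_gt0P; exists 0.
have ka' : (k < a)%N = false by rewrite ltnNge ka.
case: eqP => kS /=.
  rewrite (cardA (pred1 0)) ?card1 ?rmorph1 // => y; rewrite /A /= ka' kS /=.
  by case: (y =P 0) => //= ->; rewrite subr0; case: (k \in D); rewrite ?oner_eq0 ?eqxx.
rewrite (cardA pred0) ?card0 ?rmorph0 // => y; rewrite /A /= ka' /=.
case: (y =P 0) => //= ->; rewrite subr0; apply/negbTE/eqP => Dk; apply: kS; rewrite -Dk.
by case: (k \in D); rewrite ?oner_eq0 ?eqxx.
Qed.

End Multipliers.

(** * All orbits of complete flags from the generators *)

Section Generation.
Variable d : nat.
Implicit Types (p : 'S_d) (D S : {set 'I_d}).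

Definition at_pos p F (f f' : chain F d d) : bool :=
  [forall i, forall j, \dim (f i :&: f' j)%VS == (idtype p finset.set0 (i, j)).1].

(** For flags in position p, the shadow of the support of u, expressed without a frame. *)
Definition jset p F (f f' : chain F d d) u : {set 'I_d} :=
  [set k | u \notin (f (olo k) + f' (olo (p k)))%VS].

Definition ideal p S : bool :=
  [forall k : 'I_d, forall l : 'I_d, [&& (k <= l)%N, (p k <= p l)%N & l \in S] ==> (k \in S)].

Lemma idealP p S : reflect
  (forall k l : 'I_d, (k <= l)%N -> (p k <= p l)%N -> l \in S -> k \in S) (ideal p S).
Proof.
apply: (iffP forallP) => [h k l kl pkl lS|h k].
  by have /forallP/(_ l)/implyP := h k; apply; rewrite kl pkl.
by apply/forallP => l; apply/implyP => /and3P[? ? ?]; apply: h; eassumption.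
Qed.

Lemma at_pos_frame F p p' (f f' : chain F d d) P : idframe p' f f' P -> at_pos p f f' = (p == p').
Proof.
move=> fP; have E i j : \dim (f i :&: f' j) = (idtype p' finset.set0 (i, j)).1.
  by rewrite -(ftype_dim f f' 0) (idframe_ftype _ fP) !ffunE.
apply/idP/eqP => [h|->].
  by apply: (@idtype_inj _ _ _ finset.set0 finset.set0) => i j; rewrite -E; have /forallP/(_ i)/forallP/(_ j)/eqP := h.
by apply/forallP => i; apply/forallP => j; rewrite E.
Qed.

Lemma jset_frame F p (f f' : chain F d d) P u : idframe p f f' P -> jset p f f' u = shadow p (supp P u).
Proof.
move=> fP; apply/setP => k; rewrite inE -(ftype_mem f f' u) (idframe_ftype _ fP) idtype_mem.
by rewrite negbK.
Qed.

Definition efam p S : gfamily d d d := fun F f f' u =>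
  [&& completes f f', at_pos p f f' & jset p f f' u \subset S]%:R.

Definition mfam p S : gfamily d d d := fun F f f' u =>
  [&& completes f f', at_pos p f f' & jset p f f' u == S]%:R.

Lemma efam_frame F p p' S (f f' : chain F d d) P u : completes f f' -> ideal p S ->
  idframe p' f f' P -> efam p S f f' u = ((p == p') && (supp P u \subset S))%:R.
Proof.
move=> c /idealP idS fP; rewrite /efam c (at_pos_frame _ fP) /=; case: eqP => //= pp.
by subst p'; rewrite (jset_frame _ fP) shadow_sub.
Qed.

Section Step.
Variables (k0 k1 : 'I_d) (p : 'S_d) (S : {set 'I_d}).
Hypotheses (k01 : k1 = k0.+1 :> nat) (desc : (p k1 < p k0)%N) (idS : ideal p S) (k0S : k0 \notin S).

Let s : 'S_d := tperm k0 k1.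

(** At a descent k0 and k1 are incomparable; the swap puts k0 below k1 and creates no other
    relation. This one demands nothing, because k1 lies in the preimage only if k0 lies in S. *)
Lemma ideal_swap : ideal (s * p)%g (s @^-1: S).
Proof.
apply/idealP => k l kl; rewrite !permM !inE => psl sS.
have [le|lt] := leqP (s k) (s l); first by apply: (idealP _ _ idS) sS.
have nz (i j : 'I_d) : i <> j -> (i != j :> nat) by move=> ij; apply: contra_not_neq ij => /ord_inj.
move: sS lt; rewrite /s; case: (tpermP k0 k1 l) => [lE|lE|/nz l0 /nz l1] sS;
  case: (tpermP k0 k1 k) => [kE|kE|/nz n0 /nz n1]; move: kl; rewrite ?lE ?kE; lia.
Qed.

(* A descent of p exchanging an index outside S with its successor splits off a
   simple generator on the left. *)
Lemma efam_step F (f f' : chain F d d) w :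
  efam p S f f' w = cnv (simple_fam k1) (efam (s * p)%g (s @^-1: S)) F f f' w.
Proof.
have [c|nc] := boolP (completes f f'); last first.
  rewrite /efam (negPf nc) /=; apply/esym; apply: big1 => g _; apply: big1 => u _.
  rewrite /simple_fam; case cf: (is_complete_flag f); last by rewrite mul0r.
  by move: nc; rewrite /completes cf /= => /negPf ->; rewrite andbF mulr0.
have /andP[cf cf'] := c; have [p' [P fP]] := idframe_exists c.
rewrite (efam_frame w c idS fP) simple_cnv //.
case: (fP) => uP hf hf'; rewrite (pencil_sum k01 cf uP hf).
have cp x : completes (pencil k0 k1 f P x) f' by rewrite /completes (pencil_complete k01 cf uP hf).
have up x : (p' k0 < p' k1)%N || (x == 0) ->
    efam (s * p)%g (s @^-1: S) (pencil k0 k1 f P x) f' w =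
    ((p == p') && (supp (shear k0 k1 P x) w \subset S))%:R.
  move=> px; have [fQ QE] := frame_reindex s (pencil_frame_ascent k01 cf uP hf hf' px).
  have fQ' : idframe (s * p')%g (pencil k0 k1 f P x) f' (col_perm s (shear k0 k1 P x)).
    case: fQ => uQ hQ hQ'; split=> // [i|j] v; rewrite ?hQ ?hQ'; congr (_ \subset (mem (pred_of_set _)));
    by apply/setP => k; rewrite !inE /= ?permM // /s tpermK.
  rewrite (efam_frame w (cp x) ideal_swap fQ') (inj_eq (mulgI s)); congr (nat_of_bool (_ && _))%:R.
  apply/fintype.subsetP/fintype.subsetP => h k.
    by rewrite inE => kQ; have := h (s k); rewrite !inE QE /s tpermK; apply.
  by rewrite !inE QE => kQ; apply: h; rewrite inE.
have [asc|] := ltnP (p' k0) (p' k1).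
  have -> : (p == p') = false by apply: contraTF asc => /eqP <-; rewrite -leqNgt ltnW.
  rewrite big1 // => x _; rewrite up ?asc //.
  by have -> : (p == p') = false by apply: contraTF asc => /eqP <-; rewrite -leqNgt ltnW.
rewrite leq_eqVlt => /orP[/eqP/ord_inj/perm_inj kk|desc'].
  by move: k01; rewrite kk; lia.
(* At a descent only the adjacent flag with c = 0 changes its position; the others remain in
   position p'. *)
rewrite (bigD1 0) //= big1 ?addr0.
  rewrite up ?eqxx ?orbT //; have -> // : supp (shear k0 k1 P 0) w = supp P w.
  by apply/setP => k; rewrite !inE shearE mul0r; case: ifP; rewrite subr0.
move=> x x0; rewrite (efam_frame w (cp x) ideal_swap (pencil_frame_descent k01 cf uP hf hf' desc' x0)).
have -> : ((s * p)%g == p') = false => //.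
by apply: contraTF desc' => /eqP <-; rewrite !permM /s tpermL tpermR -leqNgt ltnW.
Qed.

End Step.

Lemma efam_id F (f f' : chain F d d) u :
  efam 1%g finset.set0 f f' u = ((is_complete_flag f && (f == f')) && (u == 0))%:R.
Proof.
have [c|nc] := boolP (completes f f'); last first.
  rewrite /efam (negPf nc) /=; case: (f =P f') => [ff|]; rewrite ?andbF //.
  by move: nc; rewrite /completes -ff andbb => /negPf ->.
have [p [P fP]] := idframe_exists c.
rewrite (efam_frame u c _ fP); last by apply/idealP => ? ? _ _; rewrite inE.
have /andP[-> _] := c; congr (nat_of_bool (_ && _))%:R; case: (fP) => uP hf hf'.
  apply/eqP/eqP => [p1|ff].
    apply/ffunP => i; apply/vspaceP => v; rewrite hf hf' -p1.
    by congr (_ \subset (mem (pred_of_set _))); apply/setP => k; rewrite !inE perm1.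
  have f1 : idframe 1%g f f' P.
    split=> // j v; rewrite -ff hf.
    by congr (_ \subset (mem (pred_of_set _))); apply/setP => k; rewrite !inE perm1.
  by apply/eqP; rewrite -(at_pos_frame 1%g fP) (at_pos_frame 1%g f1).
apply/supp_subP/eqP => [h|-> k _]; last by rewrite mul0mx mxE.
apply: (can_inj (mulmxK uP)); rewrite mul0mx; apply/rowP => k.
by rewrite h ?mxE // inE.
Qed.

Lemma lmul_id : lmul (efam 1%g finset.set0).
Proof.
move=> h gh; apply: eq_generic (gh) => F f f' w.
rewrite (@cnv_deltal _ _ _ _ _ _ _ (fun g => is_complete_flag f && (f == g))); last by move=> *; apply: efam_id.
case cf: (is_complete_flag f); first by rewrite /= (big_pred1 f) // => g; rewrite eq_sym.
by have [Phi ->] := gh; rewrite /completes cf big_pred0_eq.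
Qed.

(** A measure in place of the length of p: exchanging the values at a descent increases it, and it
    is bounded by d^3. *)
Let weight p := (\sum_(k < d) k * p k)%N.

Lemma weight_le p : (weight p <= d * (d * d))%N.
Proof.
have -> : (d * (d * d) = \sum_(k < d) d * d)%N by rewrite sum_nat_const card_ord.
by apply: leq_sum => k _; apply: leq_mul; apply: ltnW.
Qed.

Lemma weight_swap p (k0 k1 : 'I_d) : k1 = k0.+1 :> nat -> (p k1 < p k0)%N ->
  (weight p < weight (tperm k0 k1 * p)%g)%N.
Proof.
move=> k01 desc; have n01 : k1 != k0 by rewrite -val_eqE /= k01; lia.
have E q : weight q = (k0 * q k0 + (k1 * q k1 + \sum_(k < d | (k != k0) && (k != k1)) k * q k))%N.
  by rewrite /weight (bigD1 k0) //= (bigD1 k1).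
rewrite !E.
rewrite !permM tpermL tpermR.
have -> : (\sum_(k < d | (k != k0) && (k != k1)) k * (tperm k0 k1 * p)%g k =
           \sum_(k < d | (k != k0) && (k != k1)) k * p k)%N.
  by apply: eq_bigr => k /andP[h0 h1]; rewrite permM tpermD // eq_sym.
rewrite !addnA ltn_add2r k01; nia.
Qed.

(** Without descents p is increasing, so p k >= k for all k; the sums of both sides agree, which
    forces equality. *)
Lemma descent_or_id p : p = 1%g \/
  exists k0 k1 : 'I_d, k1 = k0.+1 :> nat /\ (p k1 < p k0)%N.
Proof.
have [h|no] := pselect (exists k0 k1 : 'I_d, k1 = k0.+1 :> nat /\ (p k1 < p k0)%N); first by right.
left; have ge (k : 'I_d) : (k <= p k)%N.
  case: k => k; elim: k => [//|k IH] kd.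
  have kd' := ltnW kd; have {}IH := IH kd'; apply: leq_ltn_trans IH _.
  rewrite ltn_neqAle; apply/andP; split.
    apply/eqP => /ord_inj/perm_inj/(congr1 val) /= /n_Sn; exact.
  by rewrite leqNgt; apply/negP => h; apply: no; exists (Ordinal kd'), (Ordinal kd).
have s0 : (\sum_k (p k - k) = 0)%N.
  rewrite sumnB; last by move=> k _; apply: ge.
  by rewrite [X in (_ - X)%N](reindex_inj (@perm_inj _ p)) subnn.
apply/permP => k; rewrite perm1; apply: ord_inj; apply/eqP; rewrite eqn_leq ge andbT -subn_eq0.
by move/eqP: s0; rewrite sum_nat_eq0 => /forallP/(_ k).
Qed.

Lemma lmul_efam0 p : lmul (efam p finset.set0).
Proof.
have [N] := ubnP (d * (d * d) - weight p)%N; elim: N p => // N IH p pN.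
have [->|[k0 [k1 [k01 desc]]]] := descent_or_id p; first exact: lmul_id.
have id0 : ideal p finset.set0 by apply/idealP => ? ? _ _; rewrite inE.
have k0S : k0 \notin (finset.set0 : {set 'I_d}) by rewrite inE.
apply: eq_lmul (fun F f f' w => esym (efam_step k01 desc id0 k0S f f' w)) _.
rewrite preimset0; apply: lmul_cnv; first exact: lmul_simple k01.
have lt x y z : (z - y < N.+1 -> x <= z -> y < x -> z - x < N)%N by lia.
by apply: IH; apply: lt pN (weight_le _) (weight_swap k01 desc).
Qed.

(** If S skips k0 but contains its successor k1, then p has a descent there, since S is an ideal,
    and a simple generator splits off. Otherwise S is an initial segment k < a, its subspace is f_a,
    and the family is X_a times the family of position p with w = 0. *)
Lemma lmul_efam p S : ideal p S -> lmul (efam p S).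
Proof.
have [N] := ubnP (d * (d * d) - weight p)%N; elim: N p S => // N IH p S pN idS.
have [[k0 [k1 [k01 k0S k1S]]]|no] :=
  pselect (exists k0 k1 : 'I_d, [/\ k1 = k0.+1 :> nat, k0 \notin S & k1 \in S]).
  have desc : (p k1 < p k0)%N.
    rewrite ltnNge; apply: contra k0S => le.
    by apply: (idealP _ _ idS _ _ _ le k1S); rewrite k01.
  apply: eq_lmul (fun F f f' w => esym (efam_step k01 desc idS k0S f f' w)) _.
  apply: lmul_cnv; first exact: lmul_simple k01.
  apply: IH; last exact: ideal_swap.
  have lt x y z : (z - y < N.+1 -> x <= z -> y < x -> z - x < N)%N by lia.
  exact: lt pN (weight_le _) (weight_swap k01 desc).
have [a aS] : exists a : 'I_d.+1, forall k, (k \in S) = (k < a)%N.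
  pose Q (a : 'I_d.+1) := [forall k in S, (k < a)%N].
  have Qm : Q ord_max by apply/forall_inP => k _; apply: ltn_ord.
  case: (arg_minnP (P := Q) (fun a : 'I_d.+1 => (a : nat)) Qm) => a /forall_inP Qa amin.
  exists a => k; apply/idP/idP => [/Qa //|ka].
  case: (unliftP ord0 a) ka => [a' aE|->//]; rewrite aE -[lift _ _]/(oup a') oupE ltnS => ka.
  have a'S : a' \in S.
    apply: contraT => a'S; have : Q (olo a').
      apply/forall_inP => j jS; have := Qa j jS; rewrite aE -[lift _ _]/(oup a') oupE ltnS leq_eqVlt.
      by case/orP=> // /eqP/ord_inj ja; rewrite -ja jS in a'S.
    by move/amin; rewrite aE -[lift _ _]/(oup a') oupE oloE ltnn.
  have [m] := ubnP (a' - k)%N; elim: m k ka => // m IHm k ka mk.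
  have [ak|lt] := leqP a' k; first by have /ord_inj -> : k = a' :> nat by apply/eqP; rewrite eqn_leq ka.
  have kd : (k.+1 < d)%N by apply: leq_ltn_trans lt _.
  have mk' : (a' - Ordinal kd < m)%N by rewrite /= subnS prednK ?subn_gt0.
  by apply: contraT => kS; case: no; exists k, (Ordinal kd); split => //; exact: (IHm (Ordinal kd)).
apply: eq_lmul (lmul_cnv (lmul_vector a) (lmul_efam0 p)) => F f f' w.
have [c|nc] := boolP (completes f f'); last first.
  rewrite /efam (negPf nc) /=; apply: big1 => g _; apply: big1 => u _.
  rewrite /vector_fam; case: (f =P g) => [<-|]; last by rewrite andbF mul0r.
  by rewrite (negPf nc) mulr0.
have /andP[cf _] := c; have [p' [P fP]] := idframe_exists c.
have id0 : ideal p finset.set0 by apply/idealP => ? ? _ _; rewrite inE.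
case: (fP) => uP hf _; rewrite (efam_frame w c idS fP) vector_cnv //.
rewrite (eq_bigr (fun u => ((p == p') && (w == u))%:R)); last first.
  move=> u _; rewrite (efam_frame _ c id0 fP); congr (nat_of_bool (_ && _))%:R.
  apply/supp_subP/eqP => [h|-> k _]; last by rewrite subrr mul0mx mxE.
  apply/eqP; rewrite -subr_eq0; apply/eqP/(can_inj (mulmxK uP)); rewrite mul0mx.
  by apply/rowP => k; rewrite h ?mxE // inE.
have -> : (supp P w \subset S) = (w \in f a).
  by rewrite hf; congr (_ \subset (mem (pred_of_set _))); apply/setP => k; rewrite inE aS.
case: (p == p'); last by rewrite big1.
case wa: (w \in f a); last by rewrite big1 // => u ua; case: (w =P u) => // wu; rewrite wu ua in wa.
rewrite (bigD1 w) //= eqxx big1 ?addr0 // => u /andP[_ uw].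
by rewrite eq_sym (negPf uw).
Qed.

Lemma jset_ideal p F (f f' : chain F d d) u : completes f f' -> at_pos p f f' -> ideal p (jset p f f' u).
Proof.
move=> c ap; have [p' [P fP]] := idframe_exists c.
have pp : p = p' by apply/eqP; rewrite -(at_pos_frame p fP).
subst p'; rewrite (jset_frame _ fP); apply/idealP => k l; exact: shadow_ideal.
Qed.

(* Moebius inversion over the order ideals. *)
Lemma lmul_mfam p S : ideal p S -> lmul (mfam p S).
Proof.
have [N] := ubnP #|S|; elim: N S => // N IH S SN idS.
(* Exactly one ideal is attached to a triple, so subtracting the strictly smaller ideals leaves S.
   The coefficient [evF F 1] gives the sum the shape of [lmul_sum]. *)
have E F (f f' : chain F d d) u : mfam p S f f' u = efam p S f f' u -
    \sum_(S' | ideal p S' && (S' \proper S)) evF F 1 * mfam p S' f f' u.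
  have [/andP[c ap]|n] := boolP (completes f f' && at_pos p f f'); last first.
    rewrite /mfam /efam !andbA !(negPf n) big1 ?subrr // => S' _.
    by rewrite andbA (negPf n) mulr0.
  have idJ := jset_ideal u c ap; set J := jset p f f' u in idJ *.
  rewrite /mfam /efam c ap /= -/J.
  have [JS|nJS] := boolP (J \proper S).
    rewrite (bigD1 J) ?idJ ?JS //= eqxx rmorph1 mul1r big1 ?addr0; last first.
      by move=> S' /andP[_ nJ]; rewrite -/J eq_sym (negPf nJ) mulr0.
    by move: JS; rewrite properEneq => /andP[/negPf -> ->]; rewrite subrr.
  rewrite big1 ?subr0; last first.
    move=> S' /andP[_ S'S]; rewrite -/J; case: (J =P S') => [JS'|]; last by rewrite mulr0.
    by move: nJS; rewrite JS' S'S.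
  congr (nat_of_bool _)%:R; move: nJS; rewrite properEneq negb_and negbK.
  by case: eqP => [-> _|_ /= /negPf ->//]; rewrite fintype.subxx.
apply: eq_lmul (fun F f f' u => esym (E F f f' u)) _.
apply: lmul_sub; first exact: lmul_efam.
apply: (lmul_sum (fun=> 1)) => S' /andP[idS' S'S]; apply: IH => //.
by apply: leq_trans (proper_card S'S) _; rewrite -ltnS.
Qed.

Definition chi t : gfamily d d d := fun F f f' u => (completes f f' && (ftype f f' u == t))%:R.

Lemma generic0 : generic (fun F (f f' : chain F d d) w => 0).
Proof. by exists (fun=> 0) => F f f' w; rewrite rmorph0; case: ifP. Qed.

Lemma lmul_chi t : lmul (chi t).
Proof.
have [[F0 [f0 [f0' [w0 [c0 <-]]]]]|no] := pselect (exists F (f f' : chain F d d) w, completes f f' /\ ftype f f' w = t); last first.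
  move=> h _; apply: eq_generic generic0 => F f f' w.
  apply/esym; apply: big1 => g _; apply: big1 => u _; rewrite /chi.
  have -> : (completes f g && (ftype f g u == t)) = false => [|]; last by rewrite mul0r.
  by apply/negP => /andP[c /eqP ft]; apply: no; exists F, f, g, u.
have [p [P0 fP0]] := idframe_exists c0; rewrite (idframe_ftype w0 fP0); set D := supp P0 w0.
have idJ : ideal p (shadow p D) by apply/idealP => k l; exact: shadow_ideal.
apply: eq_lmul (lmul_mfam idJ) => F f f' u; rewrite /mfam /chi; case c: (completes f f') => //=.
have [p' [P fP]] := idframe_exists c; rewrite (at_pos_frame p fP) (idframe_ftype u fP).
case: (p =P p') => [pp|pp]; last first.
  by rewrite /=; case: eqP => // E; case: pp; apply: (@idtype_inj _ _ _ D (supp P u)) => i j; rewrite E.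
subst p'; rewrite (jset_frame u fP) /=; congr (nat_of_bool _)%:R; apply/eqP/eqP => [E|E].
  by rewrite idtype_shadow E -idtype_shadow.
by apply/setP => k; apply: negb_inj; rewrite -!idtype_mem E.
Qed.

(** A generic family is a finite combination of the [chi]. The index set consists of the decorated
    labels, whose types are distinct and include all that occur, because [otype] itself is
    infinite. *)
Lemma generic_cnv (g h : gfamily d d d) : generic g -> generic h -> generic (cnv g h).
Proof.
move=> [Phi PhiP]; suff : lmul g by apply.
pose A := [pred x : label d d d | decorated x].
apply: eq_lmul (lmul_sum (P := A) (fun x => Phi (ltype x)) (fun x _ => lmul_chi (ltype x))) => F f f' w.
rewrite PhiP /chi; case: ifP => c; last by rewrite big1 // => x _; rewrite mulr0.
have /andP[cf cf'] := c; have [x dx xo] := orbit_exists (complete_flag cf) (complete_flag cf') w.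
have ft := in_orbit_ftype dx xo; rewrite (bigD1 x) //= ft eqxx mulr1 big1 ?addr0 // => y /andP[dy yx].
case: eqP => [E|]; last by rewrite mulr0.
by move: yx; rewrite (ltype_inj dx dy E) eqxx.
Qed.

End Generation.

(** * Structure constants for partial flags *)

Lemma canonical_type_dim (F : finFieldType) k d (b : {ffun 'I_k.+1 -> 'I_d.+1}) (f g : chain F d d) u v :
  canonical_type b (ftype f g u) = canonical_type b (ftype f g v).
Proof.
by apply: eq_forallb => j; apply: eq_existsb => i; apply: eq_existsb => l; rewrite !ftype_dim.
Qed.

Lemma ftype_dimsr (F F' : finFieldType) m n d (f : chain F m d) (f' : chain F n d) w
    (g : chain F' m d) (g' : chain F' n d) u : is_flag f -> is_flag g ->
  ftype f f' w = ftype g g' u -> forall j, \dim (f' j) = \dim (g' j).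
Proof.
move=> ff fg E j; have := ftype_dim f f' w ord_max j; rewrite E ftype_dim.
by rewrite (flag_full ff) // (flag_full fg) // !capfv.
Qed.

Lemma ftype_dimsl (F F' : finFieldType) m n d (f : chain F m d) (f' : chain F n d) w
    (g : chain F' m d) (g' : chain F' n d) u : is_flag f' -> is_flag g' ->
  ftype f f' w = ftype g g' u -> forall i, \dim (f i) = \dim (g i).
Proof.
move=> ff fg E i; have := ftype_dim f f' w i ord_max; rewrite E ftype_dim.
by rewrite (flag_full ff) // (flag_full fg) // !capvf.
Qed.

Lemma dims_eq (F F' : finFieldType) m d (f : chain F m d) (g : chain F' m d) :
  (forall i, \dim (f i) = \dim (g i)) -> dims f = dims g.
Proof. by move=> E; apply/ffunP => i; rewrite !ffunE E. Qed.

Lemma complete_eq (F F' : finFieldType) d (f : chain F d d) (g : chain F' d d) :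
  is_flag f -> is_complete_flag g -> (forall i, \dim (f i) = \dim (g i)) -> is_complete_flag f.
Proof.
move=> ff cg E; apply/andP; split => //; apply/forallP => i.
by rewrite E complete_dim.
Qed.

Definition orbit_fam m n d (x : label m n d) : gfamily m n d :=
  fun F f f' w => char_fun x f f' w.

Lemma orbit_famE m n d (x : label m n d) F (f : chain F m d) (f' : chain F n d) w : decorated x ->
  is_flag f -> is_flag f' -> orbit_fam x f f' w = (ftype f f' w == ltype x)%:R.
Proof.
move=> dx ff ff'; rewrite /orbit_fam /char_fun; congr (nat_of_bool _)%:R.
by apply/asboolP/eqP => [/(in_orbitP _ _ _ dx)[]//|E]; apply/(in_orbitP _ _ _ dx).
Qed.

Lemma orbit_fam_neq0 m n d (x : label m n d) F (f : chain F m d) (f' : chain F n d) w :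
  orbit_fam x f f' w != 0 -> in_orbit x f f' w.
Proof. by rewrite /orbit_fam /char_fun; case: asboolP => //; rewrite eqxx. Qed.

Lemma generic_type d (A : pred (otype d d)) :
  generic (fun F f f' u => (@completes d F f f' && A (ftype f f' u))%:R).
Proof.
exists (fun t => (A t)%:R) => F f f' w; rewrite rmorph_nat.
by case: ifP.
Qed.

(* Each middle flag g has exactly one canonical refinement relative to f, so the
   sum over g becomes a sum over complete flags. *)
Lemma cnv_coarse m k n d a c (b : {ffun 'I_k.+1 -> 'I_d.+1}) (x : label m k d) (y : label k n d)
    F (f : chain F d d) (f' : chain F d d) w : (0 < d)%N ->
  decorated x -> decorated y -> is_coarse a -> is_coarse b -> is_coarse c ->
  (forall (g : chain F k d) h u, in_orbit x h g u -> dims g = b) ->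
  completes f f' ->
  cnv (orbit_fam x) (orbit_fam y) F (coarse a f) (coarse c f') w =
  cnv (fun F f g u => (completes f g && (canonical_type b (ftype f g u) && (restr a b (ftype f g u) == ltype x)))%:R)
    (fun F g f' u => (completes g f' && (restr b c (ftype g f' u) == ltype y))%:R) F f f' w.
Proof.
move=> hd dx dy ca cb cc xb /andP[cf cf']; have ff := complete_flag cf; have ff' := complete_flag cf'.
pose K (g : chain F k d) := \sum_u orbit_fam x (coarse a f) g u * orbit_fam y g (coarse c f') (w - u).
pose Q (g : chain F d d) := is_complete_flag g && canonical_type b (ftype f g 0).
transitivity (\sum_(g | Q g) K (coarse b g)).
  rewrite (partition_big (coarse b) predT) //=; apply: eq_bigr => g _.
  rewrite [RHS](eq_bigr (fun=> K g)) => [|h /andP[_ /eqP ->] //]; rewrite -/(K g).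
  have [/andP[fg /eqP dg]|ng] := boolP (is_flag g && (dims g == b)).
    have [g1 [c1 b1 t1]] := canonical_refinement hd cf fg.
    rewrite (big_pred1 g1) // => h; rewrite /Q -dg; apply/idP/eqP => [/andP[/andP[ch th] /eqP bh]|->].
      exact: (canonical_refinement_uniq cf fg ch bh th c1 b1 (t1 0)).
    by rewrite c1 t1 b1 eqxx.
  have -> : K g = 0.
    apply: big1 => u _; apply/eqP; rewrite mulf_eq0; apply/orP; left.
    apply: contraNT ng => /orbit_fam_neq0 xo.
    by rewrite (xb _ _ _ xo) eqxx andbT; case/andP: (in_orbit_flag xo).
  by rewrite big1.
rewrite big_mkcond; apply: eq_bigr => g _; rewrite /completes cf cf' /=.
case: ifPn => [/andP[cg tg]|ng].
  apply: eq_bigr => u _; rewrite cg (canonical_type_dim _ _ _ _ 0) tg /= -!ftype_coarse.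
  by rewrite !orbit_famE // coarse_flag // complete_flag.
rewrite big1 // => u _; rewrite (canonical_type_dim _ _ _ _ 0).
by move: ng; rewrite /Q andbA => /negPf ->; rewrite mul0r.
Qed.

(** One complete refinement of one point of z has a label z', and every point of z over every field
    is the coarsening of a point of z'. The convolution is then a product of two generic families on
    complete flags, evaluated at the type of z'. *)
Lemma cnv_orbit_generic m k n d (x : label m k d) (y : label k n d) (z : label m n d) :
  (0 < d)%N -> decorated x -> decorated y -> decorated z ->
  exists a, forall F f f' w, in_orbit z f f' w ->
    cnv (orbit_fam x) (orbit_fam y) F f f' w = evF F a.
Proof.
move=> hd dx dy dz.
(* Any field would do: the dimension vectors are the same over all fields. *)
have [h0 [g0 [u0 xo0]]] := orbit_nonempty 'F_2 dx.
have /(in_orbitP _ _ _ dx)[fh0 fg0 t0] := xo0.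
have xb F (g : chain F k d) h u : in_orbit x h g u -> dims g = dims g0.
  case/(in_orbitP _ _ _ dx)=> fh fg t; apply/dims_eq/(ftype_dimsr fh fh0 (etrans t (esym t0))).
have [f0 [f0' [w0 zo0]]] := orbit_nonempty 'F_2 dz.
have /(in_orbitP _ _ _ dz)[ff0 ff0' tz0] := zo0.
have [e ce ef] := refinement_exists hd ff0.
have [e' ce' ef'] := refinement_exists hd ff0'.
have [z' dz' zo'] := orbit_exists (complete_flag ce) (complete_flag ce') w0.
have tz' := in_orbit_ftype dz' zo'.
pose A t := canonical_type (dims g0) t && (restr (dims f0) (dims g0) t == ltype x).
pose B t := restr (dims g0) (dims f0') t == ltype y.
have [Phi PhiP] := generic_cnv (@generic_type d A) (@generic_type d B).
exists (Phi (ltype z')) => F f f' w zo.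
have ca := dims_coarse ff0; have cc := dims_coarse ff0'.
have rz : restr (dims f0) (dims f0') (ltype z') = ltype z by rewrite -tz' -ftype_coarse ef ef'.
have [g [g' [go gf gf']]] := lift_orbit dz dz' ca cc rz zo.
have /(in_orbitP _ _ _ dz')[fg fg' tg] := go.
have E := etrans tg (esym tz').
have cg : is_complete_flag g := complete_eq fg ce (ftype_dimsl fg' (complete_flag ce') E).
have cg' : is_complete_flag g' := complete_eq fg' ce' (ftype_dimsr fg (complete_flag ce) E).
have cgg : completes g g' by rewrite /completes cg.
rewrite -gf -gf' (cnv_coarse _ hd dx dy ca (dims_coarse fg0) cc (xb F) cgg).
by rewrite -/(A _) -/(B _) PhiP cgg tg.
Qed.

(** The polynomial of [cnv_orbit_generic] satisfies the defining condition, so the default of the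
    choice is not taken; restricting the middle flag to Z loses no nonzero term. *)
Lemma struct_constE m k n d (Z : forall F : finFieldType, pred (chain F k d))
    (x : label m k d) (y : label k n d) (z : label m n d) :
  (0 < d)%N -> decorated x -> decorated y -> decorated z ->
  (forall F f (g : chain F k d) f' u v, in_orbit x f g u -> in_orbit y g f' v -> Z F g) ->
  forall F f f' w, in_orbit z f f' w ->
    evF F (struct_const Z x y z) = cnv (orbit_fam x) (orbit_fam y) F f f' w.
Proof.
move=> hd dx dy dz hZ.
have cE F f f' w : convolution (Z F) (char_fun x) (char_fun y) f f' w =
    cnv (orbit_fam x) (orbit_fam y) F f f' w.
  rewrite /convolution big_mkcond; apply: eq_bigr => g _; case: ifPn => // nZ.
  apply/esym; apply: big1 => u _; apply/eqP; apply: contraNT nZ.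
  by rewrite mulf_eq0 => /norP[/orbit_fam_neq0 xo /orbit_fam_neq0 yo]; apply: hZ xo yo.
have [a aP] := cnv_orbit_generic hd dx dy dz.
move=> F f f' w zo; rewrite /struct_const -cE.
have P := classical_sets.xgetPex 0 (ex_intro (fun c : laurent => forall (F : finFieldType) (f : chain F m d) (f' : chain F n d) w, in_orbit z f f' w ->
  laurent_eval (sqrtC #|F|%:R) c = convolution (Z F) (char_fun x) (char_fun y) f f' w) a
  (fun F f f' w zo => etrans (esym (aP F f f' w zo)) (esym (cE F f f' w)))).
exact: P zo.
Qed.

(** * Elements as functions *)

Section Coordinates.
Variables (m n d : nat) (I : finType) (lab : I -> label m n d).
Variables (zl : forall F : finFieldType, pred (chain F m d)) (zr : forall F : finFieldType, pred (chain F n d)).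

(** The common interface of MS, MV and MH: the labels name exactly the orbits on the triples whose
    flags satisfy [zl] and [zr], each once. *)
Definition orbit_basis :=
  [/\ injective lab, forall i, decorated (lab i),
      forall i (F : finFieldType) (f : chain F m d) (f' : chain F n d) w, in_orbit (lab i) f f' w -> zl f && zr f' &
      forall (F : finFieldType) (f : chain F m d) (f' : chain F n d) w, zl f -> zr f' -> exists i, in_orbit (lab i) f f' w].

Definition ev (g : {ffun I -> laurent^o}) : gfamily m n d :=
  fun F f f' w => \sum_i evF F (g i) * orbit_fam (lab i) f f' w.

Definition elt (Phi : otype m n -> laurent) : {ffun I -> laurent^o} :=
  [ffun i => Phi (ltype (lab i))].

Hypothesis hb : orbit_basis.

Lemma ev_at g i F (f : chain F m d) (f' : chain F n d) w :
  in_orbit (lab i) f f' w -> ev g f f' w = evF F (g i).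
Proof.
case: hb => inj dec _ _ io; rewrite /ev (bigD1 i) //= big1 ?addr0.
  by rewrite /orbit_fam /char_fun; case: asboolP; rewrite // mulr1.
move=> j ji; rewrite /orbit_fam /char_fun; case: asboolP => [jo|]; last by rewrite mulr0.
case/eqP: ji; apply/inj/ltype_inj => //.
by rewrite -(in_orbit_ftype (dec _) io) (in_orbit_ftype (dec _) jo).
Qed.

Lemma ev_out g F (f : chain F m d) (f' : chain F n d) w : ~~ (zl f && zr f') -> ev g f f' w = 0.
Proof.
case: hb => _ _ out _ nz; apply: big1 => i _; rewrite /orbit_fam /char_fun.
by case: asboolP => [/out h|]; [rewrite h in nz|rewrite mulr0].
Qed.

(** Each orbit has a point over every field, so each coordinate is known at every sqrt q. *)
Lemma ev_inj g h : (forall F (f : chain F m d) (f' : chain F n d) w, zl f -> zr f' -> ev g f f' w = ev h f f' w) -> g = h.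
Proof.
case: hb => _ dec out _ gh; apply/ffunP => i; apply: evF_inj => F.
have [f [f' [w io]]] := orbit_nonempty F (dec i).
by have /andP[zf zf'] := out _ _ _ _ _ io; rewrite -!(ev_at _ io) gh.
Qed.

Lemma ev_elt Phi F (f : chain F m d) (f' : chain F n d) w :
  ev (elt Phi) f f' w = if zl f && zr f' then evF F (Phi (ftype f f' w)) else 0.
Proof.
case: ifP => [/andP[zf zf']|/negbT]; last exact: ev_out.
case: (hb) => _ dec _ ex; have [i io] := ex _ _ _ w zf zf'.
by rewrite (ev_at _ io) ffunE (in_orbit_ftype (dec i) io).
Qed.

Lemma elt_exists g : exists Phi, g = elt Phi.
Proof.
case: hb => inj dec _ _.
exists (fun t => if [pick i | ltype (lab i) == t] is Some i then g i else 0).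
apply/ffunP => i; rewrite ffunE; case: pickP => [j /eqP/ltype_inj E|/(_ i)]; last by rewrite eqxx.
by rewrite (inj _ _ (E _ _)).
Qed.

Lemma ev_scale a g F (f : chain F m d) (f' : chain F n d) w :
  ev (a *: g) f f' w = evF F a * ev g f f' w.
Proof.
by rewrite /ev mulr_sumr; apply: eq_bigr => i _; rewrite !ffunE rmorphM mulrA.
Qed.

End Coordinates.

Lemma ev_bilinear m k n d (I J K : finType) lab1 lab2 lab3 zl zr zm zm'
    (Z : forall F : finFieldType, pred (chain F k d)) :
  (0 < d)%N -> @orbit_basis m k d I lab1 zl zm -> @orbit_basis k n d J lab2 zm' zr ->
  @orbit_basis m n d K lab3 zl zr ->
  (forall F f, zm F f && zm' F f -> Z F f) ->
  forall g h F (f : chain F m d) (f' : chain F n d) w,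
  ev lab3 (bilinear_ext (fun x y z => struct_const Z (lab1 x) (lab2 y) (lab3 z)) g h) f f' w =
  cnv (ev lab1 g) (ev lab2 h) F f f' w.
Proof.
move=> hd hb1 hb2 hb3 zZ g h F f f' w.
have [_ dec1 out1 _] := hb1; have [_ dec2 out2 _] := hb2; have [_ dec3 _ ex3] := hb3.
have [/andP[zf zf']|nz] := boolP (zl F f && zr F f'); last first.
  rewrite (ev_out hb3) //; apply/esym; apply: big1 => f'' _; apply: big1 => u _.
  move: nz; rewrite negb_and => /orP[nf|nf].
    by rewrite (ev_out hb1) ?mul0r // (negPf nf).
  by rewrite [X in _ * X](ev_out hb2) ?mulr0 // (negPf nf) andbF.
have [z zo] := ex3 _ _ _ w zf zf'; rewrite (ev_at hb3 _ zo) ffunE.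
transitivity (\sum_x \sum_y evF F (g x) * evF F (h y) * cnv (orbit_fam (lab1 x)) (orbit_fam (lab2 y)) F f f' w).
  rewrite rmorph_sum; apply: eq_bigr => x _; rewrite rmorph_sum; apply: eq_bigr => y _.
  rewrite !rmorphM /= (struct_constE _ _ _ _ _ zo) // => F' e e' e'' u v xo yo.
  by apply: zZ; case/andP: (out1 _ _ _ _ _ xo) => _ ->; case/andP: (out2 _ _ _ _ _ yo) => ->.
rewrite /cnv; under eq_bigr do under eq_bigr do rewrite mulr_sumr.
under eq_bigr do rewrite exchange_big; rewrite exchange_big; apply: eq_bigr => f'' _ /=.
under eq_bigr do under eq_bigr do rewrite mulr_sumr.
under eq_bigr do rewrite exchange_big; rewrite exchange_big; apply: eq_bigr => u _ /=.
rewrite mulr_suml; apply: eq_bigr => x _; rewrite mulr_sumr; apply: eq_bigr => y _.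
by rewrite mulrACA.
Qed.

Lemma regular_scale (R : nzRingType) (a : R) (b : R^o) : a *: b = a * b.
Proof. by []. Qed.

Lemma bilinear_ext_linearl (I J K : finType) (c : I -> J -> K -> laurent) a g g' h :
  bilinear_ext c (a *: g + g') h = a *: bilinear_ext c g h + bilinear_ext c g' h.
Proof.
apply/ffunP => z; rewrite !ffunE scaler_sumr -big_split; apply: eq_bigr => x _ /=.
rewrite scaler_sumr -big_split; apply: eq_bigr => y _ /=; rewrite !ffunE.
by rewrite !regular_scale !mulrDl !mulrA.
Qed.

Lemma bilinear_ext_linearr (I J K : finType) (c : I -> J -> K -> laurent) a g h h' :
  bilinear_ext c g (a *: h + h') = a *: bilinear_ext c g h + bilinear_ext c g h'.
Proof.
apply/ffunP => z; rewrite !ffunE scaler_sumr -big_split; apply: eq_bigr => x _ /=.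
rewrite scaler_sumr -big_split; apply: eq_bigr => y _ /=; rewrite !ffunE.
by rewrite !regular_scale mulrDr mulrDl [X in X * _ + _]mulrCA !mulrA.
Qed.

(** * Completeness of a flag in terms of row and column sums *)

Section LabelShape.
Variables (m n d : nat) (x : label m n d).

Lemma sum_columns (j : 'I_n.+1) : (ltype x (ord_max, j)).1 = (\sum_(l < n | l < j) \sum_i x.1 i l)%N.
Proof.
rewrite ffunE /= exchange_big pair_big_dep /=; apply: eq_bigl => p; rewrite ltn_ord.
by [].
Qed.

Lemma sum_rows (i : 'I_m.+1) : (ltype x (i, ord_max)).1 = (\sum_(l < m | l < i) \sum_j x.1 l j)%N.
Proof.
rewrite ffunE /= pair_big_dep /=; apply: eq_bigl => p; rewrite ltn_ord !andbT.
by [].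
Qed.

End LabelShape.

Lemma partial_sums n (c : 'I_n -> nat) :
  (forall j : 'I_n.+1, \sum_(l < n | l < j) c l = j)%N <-> (forall l, c l = 1%N).
Proof.
split=> h; last first.
  move=> j; rewrite (eq_bigr (fun=> 1%N)) => [|l _]; last exact: h.
  rewrite sum1_card -[RHS](card_ord j); have jn : (j <= n)%N by rewrite -ltnS.
  have wi : injective (widen_ord jn) by move=> k l kl; apply/ord_inj/(congr1 (@nat_of_ord n) kl).
  rewrite -(card_imset _ wi); apply: eq_card => l; rewrite unfold_in.
  apply/idP/imsetP => [lj|[k _ lE]]; last by rewrite lE; exact (ltn_ord k).
  by exists (Ordinal lj); [rewrite inE|apply: ord_inj].
move=> l; have := h (oup l); have := h (olo l).
rewrite oloE oupE => h1; rewrite (bigD1 l) //=.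
rewrite (eq_bigl (fun j : 'I_n => (j < l)%N)) ?h1 => [|j]; first by lia.
by rewrite ltnS [RHS]ltn_neqAle andbC.
Qed.

Section Shapes.
Variables (F : finFieldType) (m n d : nat).

Lemma complete_columns (x : label m d d) (f : chain F m d) (f' : chain F d d) w :
  decorated x -> in_orbit x f f' w ->
  is_complete_flag f' = [forall j, (\sum_i (x.1 i j : nat) == 1)%N].
Proof.
move=> dx xo; have /andP[ff ff'] := in_orbit_flag xo.
have E j : \dim (f' j) = (\sum_(l < d | l < j) \sum_i x.1 i l)%N.
  by rewrite -sum_columns -(in_orbit_ftype dx xo) ftype_dim (flag_full ff) // capfv.
have [h1 h2] := partial_sums (fun l => \sum_i x.1 i l)%N.
rewrite /is_complete_flag ff' /=; apply/forallP/forallP => h j.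
  by apply/eqP/h1 => l; rewrite -E; apply/eqP.
by rewrite E h2 // => l; apply/eqP.
Qed.

Lemma complete_rows (x : label d n d) (f : chain F d d) (f' : chain F n d) w :
  decorated x -> in_orbit x f f' w ->
  is_complete_flag f = [forall i, (\sum_j (x.1 i j : nat) == 1)%N].
Proof.
move=> dx xo; have /andP[ff ff'] := in_orbit_flag xo.
have E i : \dim (f i) = (\sum_(l < d | l < i) \sum_j x.1 l j)%N.
  by rewrite -sum_rows -(in_orbit_ftype dx xo) ftype_dim (flag_full ff') // capvf.
have [h1 h2] := partial_sums (fun l => \sum_j x.1 l j)%N.
rewrite /is_complete_flag ff /=; apply/forallP/forallP => h i.
  by apply/eqP/h1 => l; rewrite -E; apply/eqP.
by rewrite E h2 // => l; apply/eqP.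
Qed.

End Shapes.

Lemma is_perm_mx_sums d (A : 'M[nat]_d) : is_perm_mx A =
  [forall i, (\sum_j A i j == 1)%N] && [forall j, (\sum_i A i j == 1)%N].
Proof.
apply/is_perm_mxP/andP => [[s ->]|[/forallP r /forallP c]].
  split; apply/forallP => i.
    rewrite (bigD1 (s i)) //= big1; first by rewrite !mxE eqxx.
    by move=> j; rewrite !mxE eq_sym => /negPf ->.
  rewrite (bigD1 ((s^-1)%g i)) //= big1; first by rewrite !mxE permKV eqxx.
  by move=> j; rewrite !mxE -(inj_eq (@perm_inj _ s)) permKV => /negPf ->.
have ex i : exists j, A i j == 1%N.
  have [j Aij] : exists j, A i j != 0%N.
    apply/existsP; apply: contraT; rewrite negb_exists => /forallP h.
    by have := r i; rewrite big1 // => j _; apply/eqP; rewrite -[_ == _]negbK.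
  exists j; have := r i; rewrite (bigD1 j) //=; lia.
pose f i := xchoose (ex i).
have fE i : A i (f i) = 1%N by apply/eqP/(xchooseP (ex i)).
have other i j : j != f i -> A i j = 0%N.
  by move=> nj; have := r i; rewrite (bigD1 (f i)) //= fE (bigD1 j) //=; lia.
have fi : injective f.
  move=> i i' ff; apply/eqP; apply: contraT => ii.
  have := c (f i); rewrite (bigD1 i) //= fE (bigD1 i') ?[X in (_ + (X + _))%N]ff //=; last by rewrite eq_sym.
  by rewrite ff fE.
exists (perm fi); apply/matrixP => i j; rewrite !mxE permE.
by have [<-|nj] := eqVneq (f i) j; rewrite ?fE // other // eq_sym.
Qed.

Definition XX_lab n d (x : XX_label n d) : label n n d := val x.
Definition XY_lab n d (x : XY_label n d) : label n d d := val x.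
Definition YY_lab d (x : YY_label d) : label d d d := val x.

Lemma XX_basis n d : orbit_basis (@XX_lab n d) (@in_X n d) (@in_X n d).
Proof.
split; first exact: val_inj.
- by move=> x; apply: (valP x).
- by move=> x F f f' w /in_orbit_flag.
- move=> F f f' w ff ff'; have [x dx xo] := orbit_exists ff ff' w.
  by exists (Sub x dx); rewrite /XX_lab SubK.
Qed.

Lemma XY_basis n d : orbit_basis (@XY_lab n d) (@in_X n d) (@in_Y d).
Proof.
split; first exact: val_inj.
- by move=> x; case/andP: (valP x).
- move=> x F f f' w xo; case/andP: (valP x) => dx cx.
  by rewrite /in_Y (complete_columns dx xo) cx andbT; case/andP: (in_orbit_flag xo).
- move=> F f f' w ff cf'; have [x dx xo] := orbit_exists ff (complete_flag cf') w.
  have xP : decorated x && [forall j, (\sum_i (x.1 i j : nat) == 1)%N].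
    by rewrite dx -(complete_columns dx xo).
  by exists (Sub x xP); rewrite /XY_lab SubK.
Qed.

Lemma YY_basis d : orbit_basis (@YY_lab d) (@in_Y d) (@in_Y d).
Proof.
have E (x : label d d d) F (f f' : chain F d d) w : decorated x -> in_orbit x f f' w ->
    in_Y f && in_Y f' = is_perm_mx (map_mx (@nat_of_ord _) x.1).
  move=> dx xo; rewrite /in_Y (complete_columns dx xo) (complete_rows dx xo) is_perm_mx_sums.
  by congr (_ && _); apply: eq_forallb => i; congr (_ == _); apply: eq_bigr => j _; rewrite mxE.
split; first exact: val_inj.
- by move=> x; case/andP: (valP x).
- by move=> x F f f' w xo; case/andP: (valP x) => dx px; rewrite (E _ _ _ _ _ dx xo).
- move=> F f f' w cf cf'; have [x dx xo] := orbit_exists (complete_flag cf) (complete_flag cf') w.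
  have xP : decorated x && is_perm_mx (map_mx (@nat_of_ord _) x.1).
    by rewrite dx -(E _ _ _ _ _ dx xo) cf cf'.
  by exists (Sub x xP); rewrite /YY_lab SubK.
Qed.

Definition evXX n d (s : MS n d) : gfamily n n d := ev (@XX_lab n d) s.
Definition evXY n d (s : MV n d) : gfamily n d d := ev (@XY_lab n d) s.
Definition evYY d (s : MH d) : gfamily d d d := ev (@YY_lab d) s.

(** * The actions as convolutions, and the bimodule laws *)

Section DoubleCentralizer.
Variables n d : nat.
Hypothesis hd : (0 < d)%N.
Implicit Types (s : MS n d) (m : MV n d) (h : MH d).

Lemma ev_MS_act s m F (f : chain F n d) (f' : chain F d d) w :
  evXY (MS_act s m) f f' w = cnv (evXX s) (evXY m) F f f' w.
Proof. by apply: (ev_bilinear hd (XX_basis n d) (XY_basis n d) (XY_basis n d)) => ? ? /andP[]. Qed.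

Lemma ev_MH_act h m F (f : chain F n d) (f' : chain F d d) w :
  evXY (MH_act h m) f f' w = cnv (evXY m) (evYY h) F f f' w.
Proof. by apply: (ev_bilinear hd (XY_basis n d) (YY_basis d) (XY_basis n d)) => ? ? /andP[]. Qed.

Lemma ev_MS_mul s s' F (f : chain F n d) (f' : chain F n d) w :
  evXX (MS_mul s s') f f' w = cnv (evXX s) (evXX s') F f f' w.
Proof. by apply: (ev_bilinear hd (XX_basis n d) (XX_basis n d) (XX_basis n d)) => ? ? /andP[]. Qed.

Lemma ev_MH_mul h h' F (f : chain F d d) (f' : chain F d d) w :
  evYY (MH_mul h h') f f' w = cnv (evYY h) (evYY h') F f f' w.
Proof. by apply: (ev_bilinear hd (YY_basis d) (YY_basis d) (YY_basis d)) => ? ? /andP[]. Qed.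

Lemma evXY_inj m m' : (forall F (f : chain F n d) (f' : chain F d d) w,
  is_flag f -> is_complete_flag f' -> evXY m f f' w = evXY m' f f' w) -> m = m'.
Proof. exact: (ev_inj (XY_basis n d)). Qed.

Lemma MS_act_mul s s' m : MS_act (MS_mul s s') m = MS_act s (MS_act s' m).
Proof.
apply: evXY_inj => F f f' w _ _; rewrite !ev_MS_act.
rewrite (eq_cnv _ _ _ (fun f f' w => ev_MS_mul s s' f f' w) (fun _ _ _ => erefl)) cnvA.
exact: (eq_cnv _ _ _ (fun _ _ _ => erefl) (fun f f' w => esym (ev_MS_act s' m f f' w))).
Qed.

Lemma MH_act_mul h h' m : MH_act (MH_mul h h') m = MH_act h' (MH_act h m).
Proof.
apply: evXY_inj => F f f' w _ _; rewrite !ev_MH_act.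
rewrite (eq_cnv _ _ _ (fun _ _ _ => erefl) (fun f f' w => ev_MH_mul h h' f f' w)) -cnvA.
exact: (eq_cnv _ _ _ (fun f f' w => esym (ev_MH_act h m f f' w)) (fun _ _ _ => erefl)).
Qed.

Lemma MS_MH_comm s h m : MS_act s (MH_act h m) = MH_act h (MS_act s m).
Proof.
apply: evXY_inj => F f f' w _ _; rewrite ev_MS_act ev_MH_act.
rewrite (eq_cnv _ _ _ (fun _ _ _ => erefl) (fun f f' w => ev_MH_act h m f f' w)) -cnvA.
exact: (eq_cnv _ _ _ (fun f f' w => esym (ev_MS_act s m f f' w)) (fun _ _ _ => erefl)).
Qed.

Lemma MS_act_linear s : linear (MS_act s).
Proof. move=> a u v; exact: bilinear_ext_linearr. Qed.

Lemma MH_act_linear h : linear (@MH_act n d h).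
Proof. move=> a u v; exact: bilinear_ext_linearl. Qed.

End DoubleCentralizer.

(** * The double centralizer *)

(** Makes the equality of two steps of known dimension visible in the type. *)
Lemma dim_cap_eq (F : finFieldType) d (U U' : {vspace 'rV[F]_d}) :
  \dim U = \dim U' -> (\dim (U :&: U') == \dim U) = (U == U').
Proof.
move=> E; apply/eqP/eqP => [h|->]; last by rewrite capvv.
have e1 : (U :&: U')%VS = U by apply/eqP; rewrite eqEdim capvSl h leqnn.
have e2 : (U :&: U')%VS = U' by apply/eqP; rewrite eqEdim capvSr h E leqnn.
by rewrite -e1 e2.
Qed.

Lemma mem_origin (F : finFieldType) m n d (f : chain F m d) (f' : chain F n d) w :
  is_flag f -> is_flag f' -> (ftype f f' w (ord0, ord0)).2 = (w == 0).
Proof. by move=> ff ff'; rewrite ftype_mem (flag0 ff) // (flag0 ff') // addv0 memv0. Qed.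

Lemma flag_max (F : finFieldType) m d (f : chain F m d) : is_flag f -> f ord_max = fullv.
Proof. by move=> ff; rewrite (flag_full ff). Qed.

Lemma coarse_id (F : finFieldType) m d (f : chain F m d) : coarse id f = f.
Proof. by apply/ffunP => i; rewrite ffunE. Qed.

Lemma is_coarse_id m : is_coarse (@id 'I_m.+1).
Proof. by apply/and3P; split => //; do 2!apply/forallP => ?; apply/implyP. Qed.

Section Elements.
Variables n d : nat.
Hypothesis hd : (0 < d)%N.
Notation dimtype := {ffun 'I_n.+1 -> 'I_d.+1}.
Implicit Types (s : MS n d) (m : MV n d) (h : MH d) (b : dimtype).

(** The dimensions force f_i = f'_(b i), and the bit at the origin says that w lies in f_0 + f'_0 =
    0. *)
Definition xi b : MV n d := elt (@XY_lab n d) (fun t : otype n d =>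
  ([forall i, ((t (i, b i)).1 == b i) && ((t (i, ord_max)).1 == b i)] && (t (ord0, ord0)).2)%:R).

Lemma ev_xi b F (f : chain F n d) (f' : chain F d d) w : is_coarse b ->
  evXY (xi b) f f' w = ((is_complete_flag f' && (f == coarse b f')) && (w == 0))%:R.
Proof.
move=> cb; rewrite /evXY (ev_elt (XY_basis n d)) /in_X /in_Y.
case cf': (is_complete_flag f'); last by rewrite andbF.
have ff' := complete_flag cf'.
case ff: (is_flag f) => /=; last first.
  by case: eqP => // E; rewrite E coarse_flag in ff.
rewrite rmorph_nat mem_origin //; congr (nat_of_bool (_ && _))%:R.
apply/forallP/eqP => [h|-> i]; last by rewrite !ftype_dim ffunE capvv (flag_max ff') // capvf complete_dim ?eqxx.
apply/ffunP => i; rewrite ffunE; have := h i; rewrite !ftype_dim (flag_max ff') // capvf => /andP[e1 /eqP e2].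
by apply/eqP; rewrite -dim_cap_eq ?e2 // complete_dim.
Qed.

(** Acting by it sums over the complete flags with the same coarsening along b: the symmetrizer of a
    parabolic subalgebra, without its denominator. *)
Definition parabolic b : MH d := elt (@YY_lab d) (fun t : otype d d =>
  ([forall i, (t (b i, b i)).1 == b i] && (t (ord0, ord0)).2)%:R).

Lemma ev_parabolic b F (f : chain F d d) (f' : chain F d d) w :
  evYY (parabolic b) f f' w =
  ([&& is_complete_flag f, is_complete_flag f' & coarse b f == coarse b f'] && (w == 0))%:R.
Proof.
rewrite /evYY (ev_elt (YY_basis d)) /in_Y.
case cf: (is_complete_flag f) => //=; case cf': (is_complete_flag f') => //=.
have ff := complete_flag cf; have ff' := complete_flag cf'.
rewrite rmorph_nat mem_origin //; congr (nat_of_bool (_ && _))%:R.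
have E i : ((ftype f f' w (b i, b i)).1 == b i) = (f (b i) == f' (b i)).
  by rewrite ftype_dim -[X in _ == X](complete_dim (b i) cf) dim_cap_eq // !complete_dim.
apply/forallP/eqP => [h|E' i].
  by apply/ffunP => i; rewrite !ffunE; apply/eqP; rewrite -E.
by rewrite E; have /ffunP/(_ i) := E'; rewrite !ffunE => ->.
Qed.

Definition refinements b F (f : chain F n d) : nat :=
  #|[pred g : chain F d d | is_complete_flag g && (f == coarse b g)]|.

(* The number of refinements is polynomial in q, being a structure constant. *)
Lemma count_refinements b : exists N : laurent, forall F (f' : chain F d d),
  is_complete_flag f' -> (refinements b (coarse b f'))%:R = evF F N.
Proof.
have gY : generic (evYY (parabolic b)).
  by eexists => F f f' w; apply: (ev_elt (YY_basis d)).
have [Phi PhiP] := generic_cnv gY gY.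
(* The type of (f', f', 0), the same for all complete flags over all fields. *)
exists (Phi [ffun p : 'I_d.+1 * 'I_d.+1 => (minn p.1 p.2, true)]) => F f' cf'.
have ff' := complete_flag cf'.
have -> : [ffun p : 'I_d.+1 * 'I_d.+1 => (minn p.1 p.2, true)] = ftype f' f' 0.
  apply/ffunP => -[i j]; rewrite !ffunE mem0v /=; congr pair.
  case/orP: (leq_total i j) => ij; have sij := flagS ff' ij.
    by rewrite (capv_idPl sij) complete_dim // (minn_idPl ij).
  by rewrite (capv_idPr sij) complete_dim // (minn_idPr ij).
have := PhiP F f' f' 0; rewrite /completes cf' /= => <-.
rewrite (@cnv_deltal _ _ _ _ _ _ _ (fun g => is_complete_flag g && (coarse b f' == coarse b g))); last first.
  by move=> g u; rewrite ev_parabolic cf'.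
rewrite (eq_bigr (fun=> 1)) => [|g /andP[cg E]]; last by rewrite ev_parabolic cg cf' eq_sym E eqxx.
by rewrite sumr_const.
Qed.

Lemma act_parabolic b m F (f : chain F n d) (f' : chain F d d) w : is_complete_flag f' ->
  evXY (MH_act (parabolic b) m) f f' w =
  \sum_(g | is_complete_flag g && (coarse b f' == coarse b g)) evXY m f g w.
Proof.
move=> cf'; rewrite ev_MH_act //; apply: cnv_deltar => g u.
by rewrite ev_parabolic cf' /= [in RHS]eq_sym.
Qed.

Lemma act_xi s b F (f : chain F n d) (f' : chain F d d) w : is_coarse b -> is_complete_flag f' ->
  evXY (MS_act s (xi b)) f f' w = evXX s f (coarse b f') w.
Proof.
move=> cb cf'; rewrite ev_MS_act // (@cnv_deltar _ _ _ _ _ _ _ (pred1 (coarse b f'))); last first.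
  by move=> g u; rewrite ev_xi // cf'.
by rewrite big_pred1_eq.
Qed.

Lemma xi_act h b F (f : chain F n d) (f' : chain F d d) w : is_coarse b ->
  evXY (MH_act h (xi b)) f f' w = \sum_(g | is_complete_flag g && (f == coarse b g)) evYY h g f' w.
Proof.
by move=> cb; rewrite ev_MH_act //; apply: cnv_deltal => g u; rewrite ev_xi.
Qed.

Lemma refinements_neq0 b F (f' : chain F d d) : is_complete_flag f' ->
  (refinements b (coarse b f'))%:R != 0 :> algC.
Proof.
by move=> cf'; rewrite pnatr_eq0 -lt0n; apply/card_gt0P; exists f'; rewrite inE cf' eqxx.
Qed.

Lemma parabolic_xi b (N : laurent) : is_coarse b ->
  (forall F (f' : chain F d d), is_complete_flag f' -> (refinements b (coarse b f'))%:R = evF F N) ->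
  MH_act (parabolic b) (xi b) = N *: xi b.
Proof.
move=> cb hN; apply: evXY_inj => F f f' w ff cf'; rewrite act_parabolic // [RHS]ev_scale -/(evXY _) -(hN _ _ cf').
rewrite (eq_bigr (fun=> evXY (xi b) f f' w)) ?sumr_const ?mulr_natl // => g /andP[cg /eqP E].
by rewrite !ev_xi // cg cf' E.
Qed.

Lemma parabolic_invariant b m (N : laurent) : 
  (forall F (f' : chain F d d), is_complete_flag f' -> (refinements b (coarse b f'))%:R = evF F N) ->
  MH_act (parabolic b) m = N *: m ->
  forall F (f : chain F n d) (f1 f2 : chain F d d) w, is_complete_flag f1 -> is_complete_flag f2 ->
    coarse b f1 = coarse b f2 -> evXY m f f1 w = evXY m f f2 w.
Proof.
move=> hN Em F f f1 f2 w c1 c2 E.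
have h f' : is_complete_flag f' ->
    (refinements b (coarse b f'))%:R * evXY m f f' w = evXY (MH_act (parabolic b) m) f f' w.
  by move=> cf'; rewrite Em [RHS]ev_scale (hN _ _ cf').
apply: (mulfI (refinements_neq0 b c1)); rewrite h // {1}E h //.
by rewrite !act_parabolic // E.
Qed.

Definition column_dims (t : otype n n) : dimtype := [ffun j => inord (t (ord_max, j)).1].

(* Any label refining t may be picked, by right invariance under parabolic b. *)
Definition descend (mb : dimtype -> MV n d) : MS n d := elt (@XX_lab n d) (fun t =>
  if [pick x : XY_label n d | restr id (column_dims t) (ltype (XY_lab x)) == t] is Some x
  then mb (column_dims t) x else 0).

(** The label that was picked need not be that of (f, f', w), but [lift_orbit] realizes it by a
    complete flag g' with the same coarsening as f', and invariance compares the two. *)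
Lemma ev_descend (mb : dimtype -> MV n d) b F (f : chain F n d) (f' : chain F d d) w :
  is_coarse b -> is_flag f -> is_complete_flag f' ->
  (forall f1 f2 : chain F d d, is_complete_flag f1 -> is_complete_flag f2 ->
    coarse b f1 = coarse b f2 -> evXY (mb b) f f1 w = evXY (mb b) f f2 w) ->
  evXX (descend mb) f (coarse b f') w = evXY (mb b) f f' w.
Proof.
move=> cb ff cf' inv; have ff' := complete_flag cf'.
have fb := coarse_flag cb ff'.
rewrite /evXX (ev_elt (XX_basis n d)) /in_X ff fb /=.
have -> : column_dims (ftype f (coarse b f') w) = b.
  apply/ffunP => j; rewrite ffunE ftype_dim (flag_max ff) // capfv ffunE complete_dim //.
  by apply: val_inj; rewrite /= inordK.
have [_ dec out ex] := XY_basis n d.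
case: pickP => [x /eqP tx|no]; last first.
  have [x xo] := ex _ _ _ w ff cf'; have := no x.
  by rewrite -(in_orbit_ftype (dec x) xo) -ftype_coarse coarse_id eqxx.
have [z dz zo] := orbit_exists ff fb w.
have tz : restr id b (ltype (XY_lab x)) = ltype z by rewrite tx (in_orbit_ftype dz zo).
have [g [g' [go gf gf']]] := lift_orbit dz (dec x) (is_coarse_id n) cb tz zo.
rewrite coarse_id in gf; subst g.
have cg' : is_complete_flag g' by case/andP: (out _ _ _ _ _ go).
by rewrite (inv f' g') // -(ev_at (XY_basis n d) _ go).
Qed.

Definition piece b m : MV n d :=
  [ffun x => if [forall i, (ltype (XY_lab x) (i, ord_max)).1 == b i] then m x else 0].

Lemma ev_piece b m F (f : chain F n d) (f' : chain F d d) w : is_flag f -> is_complete_flag f' ->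
  evXY (piece b m) f f' w = if dims f == b then evXY m f f' w else 0.
Proof.
move=> ff cf'; have [_ dec _ ex] := XY_basis n d; have [x xo] := ex _ _ _ w ff cf'.
rewrite /evXY !(ev_at (XY_basis n d) _ xo) ffunE -(in_orbit_ftype (dec x) xo).
have -> : [forall i, (ftype f f' w (i, ord_max)).1 == b i] = (dims f == b).
  have E i : (ftype f f' w (i, ord_max)).1 = dims f i.
    by rewrite ftype_dim (flag_max (complete_flag cf')) // capvf dimsE.
  apply/forallP/eqP => [h|<- i]; last by rewrite E.
  by apply/ffunP => i; apply: ord_inj; rewrite -E; apply/eqP.
by case: ifP => _; rewrite ?rmorph0.
Qed.

Lemma piece_sum m : m = \sum_b piece b m.
Proof.
apply/ffunP => x; rewrite sum_ffunE.
pose b : dimtype := [ffun i => inord (ltype (XY_lab x) (i, ord_max)).1].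
have bE i : b i = (ltype (XY_lab x) (i, ord_max)).1 :> nat.
  rewrite ffunE inordK // ltnS; have [_ dec _ _] := XY_basis n d.
  have [f [f' [w xo]]] := orbit_nonempty 'F_2 (dec x).
  by rewrite -(in_orbit_ftype (dec x) xo) ftype_dim dim_le.
rewrite (bigD1 b) //= big1 ?addr0; last first.
  move=> c cb; rewrite ffunE; case: ifP => // /forallP h; case/eqP: cb.
  by apply/ffunP => i; apply: ord_inj; rewrite bE; apply/esym/eqP.
rewrite ffunE; case: ifP => // /negbT/forallP[] i.
by rewrite bE.
Qed.

(** The element h has at (g, f') the value of m at (coarse b g, f'). The action sums it over the
    refinements g of f, which gives N equal terms, or none if f has another dimension vector. *)
Lemma piece_xi b m (N : laurent) : is_coarse b ->
  (forall F (f' : chain F d d), is_complete_flag f' -> (refinements b (coarse b f'))%:R = evF F N) ->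
  exists h, MH_act h (xi b) = N *: piece b m.
Proof.
move=> cb hN; have [Phi PhiE] := elt_exists (XY_basis n d) m.
exists (elt (@YY_lab d) (fun t => Phi (restr b id t))).
apply: evXY_inj => F f f' w ff cf'; rewrite xi_act // [RHS]ev_scale -/(evXY _) ev_piece //.
rewrite (eq_bigr (fun=> evXY m f f' w)); last first.
  move=> g /andP[cg /eqP E]; rewrite /evYY (ev_elt (YY_basis d)) /in_Y cg cf' /= -ftype_coarse.
  by rewrite coarse_id -E PhiE /evXY (ev_elt (XY_basis n d)) /in_X /in_Y ff cf'.
rewrite sumr_const -[LHS]mulr_natl; case: eqP => [db|nb].
  by have [g cg gE] := refinement_exists hd ff; rewrite db in gE; rewrite -gE -(hN _ _ cg).
rewrite mulr0 (eq_card0 (A := _)) ?mul0r // => g; rewrite inE; apply/negP => /andP[cg /eqP E].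
by apply: nb; rewrite E dims_coarse_complete.
Qed.

End Elements.

From mathcomp Require Import classical_sets functions.

Section LinearMaps.
Variables (R : nzRingType) (U V : lmodType R) (phi : U -> V).
Hypothesis phiL : linear phi.

Lemma linear_map0 : phi 0 = 0.
Proof. by have := phiL (-1) 0 0; rewrite scaler0 addr0 scaleN1r addNr. Qed.

Lemma linear_mapZ a u : phi (a *: u) = a *: phi u.
Proof. by rewrite -[a *: u]addr0 phiL linear_map0 addr0. Qed.

Lemma linear_map_sum (I : finType) (u : I -> U) : phi (\sum_i u i) = \sum_i phi (u i).
Proof.
apply: (big_morph phi); last exact: linear_map0.
by move=> x y; rewrite -[x]scale1r phiL !scale1r.
Qed.

End LinearMaps.

(** * The two commutants *)

Section Centralizers.
Variables n d : nat.
Hypothesis hd : (0 < d)%N.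
Notation dimtype := {ffun 'I_n.+1 -> 'I_d.+1}.

(** Every partial flag is the coarsening of a complete one, so the images of the xi_b contain all
    values of s. *)
Lemma MS_act_inj : injective (@MS_act n d).
Proof.
move=> s s' E; apply: (ev_inj (XX_basis n d)) => F f g w ff fg.
have [f' cf' <-] := refinement_exists hd fg; have cb := dims_coarse fg.
by rewrite -!/(evXX _) -!(act_xi hd _ _ _ cb cf') E.
Qed.

Lemma End_MH_sub_MS phi : @End_MH n d phi -> exists s, MS_act s = phi.
Proof.
case=> phiL phiC.
have [N hN] := choice (@count_refinements n d).
pose s := descend (fun b => phi (xi b)); exists s.
(* As phi commutes with MH, the image of xi_b inherits its eigenvalue N under [parabolic b] and is
   therefore invariant. *)
have sxi (b : dimtype) : is_coarse b -> MS_act s (xi b) = phi (xi b).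
  move=> cb; apply: evXY_inj => F f f' w ff cf'; rewrite act_xi // ev_descend // => f1 f2 c1 c2.
  apply: (parabolic_invariant hd (hN b)) => //.
  by rewrite -phiC (parabolic_xi hd cb (hN b)) linear_mapZ.
apply/funext => m; rewrite {1 2}(piece_sum m).
rewrite (linear_map_sum (@MS_act_linear n d s)) (linear_map_sum phiL); apply: eq_bigr => b _.
have [cb|nb] := boolP (is_coarse b); last first.
  have -> : piece b m = 0; last by rewrite (linear_map0 (@MS_act_linear n d s)) (linear_map0 phiL).
  apply: evXY_inj => F f f' w ff cf'; rewrite ev_piece //; case: eqP => [db|_].
    by rewrite -db dims_coarse in nb.
  by rewrite /evXY /ev big1 // => x _; rewrite ffunE rmorph0 mul0r.
have [h hE] := piece_xi hd m cb (hN b).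
have E : N b *: MS_act s (piece b m) = N b *: phi (piece b m).
  rewrite -(linear_mapZ (@MS_act_linear n d s)) -(linear_mapZ phiL) -hE.
  by rewrite MS_MH_comm // sxi // phiC.
apply: evXY_inj => F f f' w ff cf'; apply: (mulfI (refinements_neq0 b cf')).
by rewrite (hN b) // -!ev_scale E.
Qed.

Section LargeRank.
Hypothesis hnd : (d <= n)%N.

(** All steps of a complete flag, with the whole space repeated after step d. This is where d <= n
    enters: no step is lost, and [sec] recovers the flag. *)
Let b0 : dimtype := [ffun i : 'I_n.+1 => inord (minn i d)].
Let sec (j : 'I_d.+1) : 'I_n.+1 := inord j.

Let b0E i : b0 i = minn i d :> nat.
Proof. by rewrite ffunE inordK // ltnS geq_minr. Qed.

Let b0_coarse : is_coarse b0.
Proof.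
apply/and3P; split; rewrite ?b0E ?min0n //=; first by apply/eqP/minn_idPr.
by apply/forallP => i; apply/forallP => j; apply/implyP => ij; rewrite !b0E; lia.
Qed.

Let b0_sec j : b0 (sec j) = j.
Proof.
have jd : (j <= d)%N by rewrite -ltnS.
by apply: ord_inj; rewrite b0E inordK ?ltnS ?(leq_trans jd) //; apply/minn_idPl.
Qed.

Let coarse_sec F (f : chain F d d) : coarse sec (coarse b0 f) = f.
Proof. by apply/ffunP => j; rewrite [LHS]ffunE [LHS]ffunE b0_sec. Qed.

Lemma MH_act_inj : injective (@MH_act n d).
Proof.
move=> h h' E; apply: (ev_inj (YY_basis d)) => F f f' w cf cf'.
have K k : evXY (MH_act k (xi b0)) (coarse b0 f) f' w = evYY k f f' w.
  rewrite xi_act // (big_pred1 f) // => g; apply/andP/eqP => [[_ /eqP e]|-> //].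
  by rewrite -(coarse_sec f) e coarse_sec.
by rewrite -!/(evYY _) -!K E.
Qed.

(** The idempotent of the dimension vector b0: the three dimensions force f_i = f'_i of dimension b0
    i, and the last bit forces w = 0. *)
Let block : MS n d := elt (@XX_lab n d) (fun t =>
  ([forall i, [&& (t (i, i)).1 == b0 i, (t (i, ord_max)).1 == b0 i & (t (ord_max, i)).1 == b0 i]]
   && (t (ord0, ord0)).2)%:R).

Let ev_block F (f f' : chain F n d) w : is_flag f -> is_flag f' ->
  evXX block f f' w = ((dims f == b0) && (f == f') && (w == 0))%:R.
Proof.
move=> ff ff'; rewrite /evXX (ev_elt (XX_basis n d)) /in_X ff ff' /= rmorph_nat mem_origin //.
congr (nat_of_bool (_ && _))%:R; apply/forallP/andP => [h|[/eqP db /eqP <-] i].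
  split; apply/eqP/ffunP => i; have := h i; rewrite !ftype_dim !flag_max // capvf capfv => /and3P[/eqP e /eqP e1 /eqP e2].
    by apply: ord_inj; rewrite dimsE.
  by apply/eqP; rewrite -dim_cap_eq e1 // e.
by rewrite !ftype_dim !flag_max // capvf capfv capvv -db dimsE eqxx.
Qed.

Let block_act m F (f : chain F n d) (f' : chain F d d) w : is_flag f -> is_complete_flag f' ->
  evXY (MS_act block m) f f' w = if dims f == b0 then evXY m f f' w else 0.
Proof.
move=> ff cf'; rewrite ev_MS_act // (@cnv_deltal _ _ _ _ _ _ _ (fun g => (dims f == b0) && (f == g))).
  by case: (_ == b0); rewrite ?big_pred0_eq //= (big_pred1 f) // => g; rewrite eq_sym.
move=> g u; have [fg|ng] := boolP (is_flag g); first exact: ev_block.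
rewrite /evXX (ev_out (XX_basis n d)) /in_X ?(negPf ng) ?andbF //.
by case: (f =P g) => [fg|]; rewrite ?andbF //; move: ng; rewrite -fg ff.
Qed.

Lemma End_MS_sub_MH phi : @End_MS n d phi -> exists h, MH_act h = phi.
Proof.
case=> phiL phiC; set m := phi (xi b0).
have block_xi : MS_act block (xi b0) = xi b0.
  apply: evXY_inj => F f f' w ff cf'; rewrite block_act // ev_xi // cf' /=.
  by case: (f =P coarse b0 f') => [->|_]; rewrite ?dims_coarse_complete ?eqxx // if_same.
have mb : MS_act block m = m by rewrite -phiC block_xi.
(* For b0 the number of refinements is N = 1, so there is nothing to divide by. *)
have [h hE] : exists h, MH_act h (xi b0) = 1 *: piece b0 m.
  apply: piece_xi => // F f' cf'; rewrite rmorph1 /refinements (eq_card1 (x := f')) // => g.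
  rewrite !inE; apply/andP/eqP => [[_ /eqP e]|->]; last by rewrite cf' eqxx.
  by rewrite -(coarse_sec f') e coarse_sec.
have {}hE : MH_act h (xi b0) = m.
  rewrite hE scale1r; apply: evXY_inj => F f f' w ff cf'.
  by rewrite ev_piece // -block_act // mb.
exists h; apply/funext => m'; have [Phi PhiE] := elt_exists (XY_basis n d) m'.
(* At (f, coarse b0 f') this takes the value of m' at (f, f'); hence xi_b0 generates MV over MS, and
   phi is determined by its image of xi_b0. *)
pose s : MS n d := elt (@XX_lab n d) (fun t => Phi (restr id sec t)).
have sE : MS_act s (xi b0) = m'.
  apply: evXY_inj => F f f' w ff cf'; rewrite act_xi // /evXX (ev_elt (XX_basis n d)) /in_X ff.
  rewrite (coarse_flag b0_coarse (complete_flag cf')) /= -ftype_coarse coarse_id coarse_sec.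
  by rewrite PhiE /evXY (ev_elt (XY_basis n d)) /in_X /in_Y ff cf'.
by rewrite -sE phiC -/m -hE MS_MH_comm.
Qed.

End LargeRank.
End Centralizers.

(* The right action reverses products, hence the order of composition in the
   second clause.  Compatibility with units follows from bijectivity and
   multiplicativity, as the identity lies in both commutants. *)
Theorem theorem6p1p6 (n d : nat) (hn : (0 < n)%N) (hd : (0 < d)%N)
    (hnd : (d <= n)%N) :
  ([/\ set_bij [set: MH d] (@End_MS n d) (@MH_act n d),
       (forall h h' : MH d,
          @MH_act n d (MH_mul h h') = @MH_act n d h' \o @MH_act n d h) &
       linear (@MH_act n d)])
  /\
  ([/\ set_bij [set: MS n d] (@End_MH n d) (@MS_act n d),
       (forall s s' : MS n d,
          @MS_act n d (MS_mul s s') = @MS_act n d s \o @MS_act n d s') &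
       linear (@MS_act n d)]).
Proof.
split; split.
- split.
  + move=> h _; split; first exact: MH_act_linear.
    by move=> s m; rewrite -MS_MH_comm.
  + by move=> h h' _ _; apply: MH_act_inj.
  + by move=> phi /(End_MS_sub_MH hd hnd)[h hE]; exists h.
- by move=> h h'; apply/funext => m; apply: MH_act_mul.
- by move=> a h h'; apply/funext => m; apply: bilinear_ext_linearr.
- split.
  + move=> s _; split; first exact: MS_act_linear.
    by move=> h m; rewrite MS_MH_comm.
  + by move=> s s' _ _; apply: MS_act_inj.
  + by move=> phi /(End_MH_sub_MS hd)[s sE]; exists s.
- by move=> s s'; apply/funext => m; apply: MS_act_mul.
- by move=> a s s'; apply/funext => m; apply: bilinear_ext_linearl.
Qed.
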